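(* Let $(A,\mathfrak m)$ be an analytically unramified Cohen-Macaulay local ring of dimension $d\geq 1$. Let $I$ be an $\mathfrak m$-primary ideal and let $\mathcal F=\{I_n\}_{n\in\mathbb Z}$ be an $I$-admissible filtration with $I_1=\overline I$ and $I_n=\overline{I^n}$ for all $n\gg 0$. Then $T_{\mathcal F}\colon\operatorname{CM}(A)\times\operatorname{CM}(A)\to\operatorname{mod}(A)$ is a functor (contravariant in the first and covariant in the second variable), where the action on morphisms is the restriction of that of $\operatorname{Ext}^1_A(-,-)$.
   Context: $\operatorname{CM}(A)$ is the category of maximal Cohen-Macaulay (MCM) $A$-modules and $\operatorname{mod}(A)$ the category of finitely generated $A$-modules. $A$ is analytically unramified if its $\mathfrak m$-adic completion is reduced. $\overline{\mathfrak a}$ denotes the integral closure of an ideal $\mathfrak a$. A filtration $\mathcal F=\{F_n\}_{n\in\mathbb Z}$ of ideals of $A$ is $I$-admissible if $I^n\subseteq F_n$ for all $n$, $F_nF_m\subseteq F_{n+m}$ for all $n,m$, and $F_n=IF_{n-1}$ for $n\gg0$. For an MCM $A$-module $M$ set $$e^T_{\mathcal F}(M)=\lim_{n\to\infty}\frac{(d-1)!}{n^{d-1}}\,\ell\bigl(\operatorname{Tor}^A_1(M,A/I_{n+1})\bigr).$$ For $\alpha\in\operatorname{Ext}^1_A(M,N)$ represented by $0\to N\to E\to M\to 0$ (with $M,N$, hence $E$, MCM) set $e^T_{\mathcal F}(\alpha)=e^T_{\mathcal F}(M)+e^T_{\mathcal F}(N)-e^T_{\mathcal F}(E)\ge 0$.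 The extension $\alpha$ is $T_{\mathcal F}$-split if $e^T_{\mathcal F}(\alpha)=0$, and $T_{\mathcal F}(M,N)$ is the subset of $\operatorname{Ext}^1_A(M,N)$ consisting of all $T_{\mathcal F}$-split extensions. *)

(* Defs.v *)
From HB Require Import structures.
From mathcomp Require Import all_boot all_order all_algebra.
From mathcomp Require Import all_classical all_reals all_analysis.

Set Implicit Arguments.
Unset Strict Implicit.
Unset Printing Implicit Defensive.

Import Order.TTheory GRing.Theory Num.Theory.
Import numFieldNormedType.Exports.

Local Open Scope classical_set_scope.
Local Open Scope ring_scope.

Section Submodules.
Context {A : comNzRingType} {V : lmodType A}.
Implicit Types (N K : set V) (J S : set A).

Definition submodule N : Prop := GRing.submod_closed [in N].

Definition submod_span (X : set V) : set V :=
  [set v | forall N, submodule N -> X `<=` N -> N v].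

(* The submodule J N of V (J need not be an ideal). *)
Definition smul J N : set V :=
  submod_span [set v | exists a x, [/\ J a, N x & v = a *: x]].

(* The length of N / K for submodules K `<=` N: the supremum of the k such
   that K `<=` L 0 `<` ... `<` L k `<=` N for some submodules L i. *)
Definition length_quot (R : realType) N K : \bar R :=
  ereal_sup [set k%:R%:E | k in [set k : nat | exists L : nat -> set V,
    [/\ forall i, (i <= k)%N -> submodule (L i),
        K `<=` L 0%N, L k `<=` N
      & forall i, (i < k)%N -> L i `<` L i.+1]]].

End Submodules.

Definition fin_gen (A : comNzRingType) (V : lmodType A) : Prop :=
  exists s : seq V, submod_span [set` s] = setT.

Section Ideals.
Variable A : comNzRingType.
Implicit Types (I J K P Q m : set A).

Definition ideal J : Prop := submodule (J : set A^o).

Definition ideal_mul J K : set A := smul J (K : set A^o).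

Definition ideal_pow J (n : nat) : set A := iter n (ideal_mul J) setT.

(* I^n = A for n <= 0. *)
Definition ideal_powz I (n : int) : set A :=
  if n is Posz k then ideal_pow I k else setT.

Definition prime_ideal P : Prop :=
  [/\ ideal P, ~ P 1 & forall x y, P (x * y) -> P x \/ P y].

Definition maximal_ideal P : Prop :=
  [/\ ideal P, ~ P 1
    & forall J, ideal J -> P `<=` J -> J = P \/ J = setT].

Definition primary_ideal Q : Prop :=
  [/\ ideal Q, ~ Q 1
    & forall x y, Q (x * y) -> Q x \/ exists n : nat, Q (y ^+ n)].

Definition radical J : set A := [set x | exists n : nat, J (x ^+ n)].

Definition primary_to m Q : Prop := primary_ideal Q /\ radical Q = m.

Definition integral_closure J : set A :=
  [set x | exists (n : nat) (a : nat -> A),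
    [/\ (0 < n)%N,
        forall i, (1 <= i <= n)%N -> ideal_pow J i (a i)
      & x ^+ n + \sum_(1 <= i < n.+1) a i * x ^+ (n - i) = 0]].

Definition noetherian : Prop :=
  forall J, ideal J -> exists s : seq A^o, submod_span [set` s] = J.

Definition local_ring m : Prop :=
  [/\ noetherian, maximal_ideal m & forall J, maximal_ideal J -> J = m].

Definition prime_chain (k : nat) : Prop :=
  exists P : nat -> set A,
    (forall i, (i <= k)%N -> prime_ideal (P i)) /\
    (forall i, (i < k)%N -> P i `<` P i.+1).

Definition krull_dim (d : nat) : Prop :=
  prime_chain d /\ forall k, prime_chain k -> (k <= d)%N.

(* An element of the completion lim A/m^n is the class of a coherent sequence
   (x_n mod m^n)_n, which is zero when x_n \in m^n for every n. *)
Definition coherent m (x : nat -> A) : Prop :=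
  forall n, ideal_pow m n (x n.+1 - x n).

Definition null_seq m (x : nat -> A) : Prop :=
  forall n, ideal_pow m n (x n).

Definition analytically_unramified m : Prop :=
  forall x, coherent m x ->
  forall k : nat, null_seq m (fun n => x n ^+ k) -> null_seq m x.

Definition admissible I (F : int -> set A) : Prop :=
  [/\ forall n, ideal (F n) /\ F (n + 1) `<=` F n,
      forall n, ideal_powz I n `<=` F n,
      forall n k, ideal_mul (F n) (F k) `<=` F (n + k)
    & exists n0 : int, forall n, n0 <= n -> F n = ideal_mul I (F (n - 1))].

End Ideals.

Section Depth.
Context {A : comNzRingType}.
Variable m : set A.

Definition regular_seq (M : lmodType A) (s : seq A) : Prop :=
  [/\ forall i x, (i < size s)%N ->
        smul [set` take i s] (setT : set M) (s`_i *: x) ->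
        smul [set` take i s] (setT : set M) x
    & smul [set` s] (setT : set M) <> setT].

Definition depth (M : lmodType A) (n : nat) : Prop :=
  (exists s : seq A, [/\ [set` s] `<=` m, regular_seq M s & size s = n]) /\
  (forall s : seq A, [set` s] `<=` m -> regular_seq M s -> (size s <= n)%N).

Definition cohen_macaulay : Prop := exists2 d, krull_dim A d & depth A^o d.

(* The zero module, of infinite depth, is an object of CM(A). *)
Definition maximal_CM (M : lmodType A) : Prop :=
  fin_gen M /\
  ((forall x : M, x = 0) \/ exists2 d, krull_dim A d & depth M d).

Record CM_module := {
  CM_sort :> lmodType A;
  CM_sortP : maximal_CM CM_sort
}.

End Depth.

Record fg_module (A : comNzRingType) := {
  fg_sort :> lmodType A;
  fg_sortP : fin_gen fg_sort
}.

Section Tor.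
Context {A : comNzRingType}.

Definition bilinear_map (M N T : lmodType A) (b : M -> N -> T) : Prop :=
  (forall y, linear (b^~ y)) /\ (forall x, linear (b x)).

Definition is_tensor (M N T : lmodType A) (b : M -> N -> T) : Prop :=
  bilinear_map b /\
  forall (U : lmodType A) (c : M -> N -> U), bilinear_map c ->
    exists h : {linear T -> U}, (forall x y, h (b x y) = c x y) /\
      forall h' : {linear T -> U}, (forall x y, h' (b x y) = c x y) -> h' =1 h.

Definition exact_at (U V W : lmodType A) (f : U -> V) (g : V -> W) : Prop :=
  forall v, g v = 0 <-> exists u, f u = v.

(* The degrees used by Tor_1 of a resolution of M by finite free modules. *)
Record free_resolution (M : lmodType A) := {
  rk0 : nat; rk1 : nat; rk2 : nat;
  diff2 : {linear 'rV[A]_rk2 -> 'rV[A]_rk1};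
  diff1 : {linear 'rV[A]_rk1 -> 'rV[A]_rk0};
  augm : {linear 'rV[A]_rk0 -> M};
  augm_surj : forall x, exists v, augm v = x;
  exact0 : exact_at diff1 augm;
  exact1 : exact_at diff2 diff1
}.

(* l is the length of Tor_1(M, Q): for some free resolution P of M, the length
   of the homology in degree 1 of P (x) Q, which does not depend on P. *)
Definition is_length_Tor1 (R : realType) (M Q : lmodType A) (l : \bar R) :=
  exists (P : free_resolution M) (T0 T1 T2 : lmodType A)
    (b0 : 'rV[A]_(rk0 P) -> Q -> T0) (b1 : 'rV[A]_(rk1 P) -> Q -> T1)
    (b2 : 'rV[A]_(rk2 P) -> Q -> T2)
    (t1 : {linear T1 -> T0}) (t2 : {linear T2 -> T1}),
  [/\ is_tensor b0, is_tensor b1 & is_tensor b2] /\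
  [/\ forall v q, t1 (b1 v q) = b0 (diff1 P v) q,
      forall v q, t2 (b2 v q) = b1 (diff2 P v) q
    & l = length_quot R [set x | t1 x = 0] (range t2)].

Definition is_quotient (J : set A) (Q : lmodType A)
    (pi : {linear A^o -> Q}) : Prop :=
  (forall q, exists a, pi a = q) /\ (forall a, pi a = 0 <-> J a).

Definition length_Tor1 (R : realType) (M : lmodType A) (J : set A) : \bar R :=
  xget 0%E [set l | exists (Q : lmodType A) (pi : {linear A^o -> Q}),
    is_quotient J pi /\ is_length_Tor1 M Q l].

Definition eT (R : realType) (d : nat) (F : int -> set A) (M : lmodType A) : R :=
  limn (fun n : nat =>
    (d.-1)`!%:R / n%:R ^+ d.-1 * fine (length_Tor1 R M (F n.+1%:Z))).

End Tor.

Section Extensions.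
Context {A : comNzRingType}.

(* Short exact sequences 0 -> N -> E -> M -> 0. *)
Record extension (M N : lmodType A) := Extension {
  ext_mid : lmodType A;
  ext_in : {linear N -> ext_mid};
  ext_out : {linear ext_mid -> M};
  ext_in_inj : injective ext_in;
  ext_exact : exact_at ext_in ext_out;
  ext_out_surj : forall x, exists e, ext_out e = x
}.

Definition ext_morphism (M N M' N' : lmodType A) (f : N -> N') (g : M -> M')
    (E : extension M N) (E' : extension M' N') : Prop :=
  exists h : {linear ext_mid E -> ext_mid E'},
    (forall y, h (ext_in E y) = ext_in E' (f y)) /\
    (forall e, ext_out E' (h e) = g (ext_out E e)).

Definition ext_equiv (M N : lmodType A) (E E' : extension M N) : Prop :=
  ext_morphism id id E E'.

(* A set of extensions; [set _] lives in a universe too small for it. *)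
Definition ext_set (M N : lmodType A) := extension M N -> Prop.

(* Ext^1(M, N), as the set of the equivalence classes of extensions. *)
Definition Ext1 (M N : lmodType A) (c : ext_set M N) : Prop :=
  exists E, c = ext_equiv E.

(* The class of f_* E (resp. g^* E) consists of the extensions E' such that
   there is a morphism E -> E' over (f, id) (resp. E' -> E over (id, g)). *)
Definition Ext1_push (M N N' : lmodType A) (f : N -> N')
    (c : ext_set M N) : ext_set M N' :=
  fun E' => exists2 E, c E & ext_morphism f id E E'.

Definition Ext1_pull (M M' N : lmodType A) (g : M' -> M)
    (c : ext_set M N) : ext_set M' N :=
  fun E' => exists2 E, c E & ext_morphism id g E' E.

Section DirectSum.
Variables (U V U' V' : lmodType A) (f : {linear U -> V}) (g : {linear U' -> V'}).

Definition sum_map (x : U * U') : V * V' := (f x.1, g x.2).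

Lemma sum_map_linear : linear sum_map.
Proof. by move=> a x y; rewrite /sum_map /= !linearP. Qed.

HB.instance Definition _ :=
  GRing.isLinear.Build A (U * U')%type (V * V')%type _ sum_map sum_map_linear.

End DirectSum.

Section ExtSum.
Variables (M N M' N' : lmodType A) (E : extension M N) (E' : extension M' N').

Let i : {linear (N * N')%type -> (ext_mid E * ext_mid E')%type} :=
  sum_map (ext_in E) (ext_in E').
Let p : {linear (ext_mid E * ext_mid E')%type -> (M * M')%type} :=
  sum_map (ext_out E) (ext_out E').

Lemma ext_sum_inj : injective i.
Proof.
by move=> [x x'] [y y'] [] /ext_in_inj -> /ext_in_inj ->.
Qed.

Lemma ext_sum_exact : exact_at i p.
Proof.
move=> [e e']; split.
  case=> /ext_exact [x <-] /ext_exact [x' <-].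
  by exists (x, x').
case=> -[x x'] [<- <-].
by congr pair; apply/ext_exact; [exists x | exists x'].
Qed.

Lemma ext_sum_surj : forall x, exists e, p e = x.
Proof.
move=> [x x']; have [e <-] := ext_out_surj E x.
by have [e' <-] := ext_out_surj E' x'; exists (e, e').
Qed.

Definition ext_sum : extension (M * M')%type (N * N')%type :=
  Extension ext_sum_inj ext_sum_exact ext_sum_surj.

End ExtSum.

Definition Ext1_sum (M N : lmodType A) (c c' : ext_set M N) :
    ext_set (M * M)%type (N * N)%type :=
  fun X => exists E E', [/\ c E, c' E' & ext_equiv (ext_sum E E') X].

(* The Baer sum. *)
Definition Ext1_add (M N : lmodType A) (c c' : ext_set M N) :
    ext_set M N :=
  Ext1_push (fun y : N * N => y.1 + y.2)
    (Ext1_pull (fun x : M => (x, x)) (Ext1_sum c c')).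

Definition Ext1_scale (M N : lmodType A) (a : A) (c : ext_set M N) :
    ext_set M N :=
  Ext1_push (fun y : N => a *: y) c.

End Extensions.

Section TSplit.
Context {A : comNzRingType}.
Variables (R : realType) (d : nat) (F : int -> set A).

Definition eT_ext (M N : lmodType A) (E : extension M N) : R :=
  eT R d F M + eT R d F N - eT R d F (ext_mid E).

Definition T_split (M N : lmodType A) (E : extension M N) : Prop :=
  eT_ext E = 0.

Definition T_ (M N : lmodType A) (c : ext_set M N) : Prop :=
  Ext1 c /\ exists2 E, c E & T_split E.

End TSplit.

Arguments T_ {A} R d F M N c.

(* Functors CM(A)^op * CM(A) -> mod(A). *)
Record CM_bifunctor (A : comNzRingType) (m : set A) := {
  bif_obj :> CM_module m -> CM_module m -> fg_module A;
  bif_map : forall (M M' N N' : CM_module m),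
    {linear M' -> M} -> {linear N -> N'} ->
    {linear bif_obj M N -> bif_obj M' N'};
  bif_id : forall (M N : CM_module m) (x : bif_obj M N), bif_map idfun idfun x = x;
  bif_comp : forall (M M' M'' N N' N'' : CM_module m)
    (g : {linear M' -> M}) (g' : {linear M'' -> M'})
    (f : {linear N -> N'}) (f' : {linear N' -> N''}) (x : bif_obj M N),
    bif_map (g \o g') (f' \o f) x = bif_map g' f' (bif_map g f x)
}.

(* The sets S M N of classes of extensions, with the operations of Ext^1 and
   its action on morphisms, form a functor CM(A)^op * CM(A) -> mod(A). The
   functor is carried by modules T M N in bijection with the sets S M N, since
   the type of these classes is too large to be an lmodType. *)
Definition is_Ext1_subfunctor (A : comNzRingType) (m : set A)
    (S : forall M N : CM_module m, ext_set M N -> Prop) : Prop :=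
  exists (T : CM_bifunctor m)
    (cl : forall M N : CM_module m, T M N -> ext_set M N),
  forall M N : CM_module m,
  [/\ injective (cl M N) /\ (forall c, S M N c <-> exists x, cl M N x = c),
      forall x y : T M N, cl M N (x + y) = Ext1_add (cl M N x) (cl M N y),
      forall (a : A) (x : T M N), cl M N (a *: x) = Ext1_scale a (cl M N x)
    & forall (M' N' : CM_module m) (g : {linear M' -> M}) (f : {linear N -> N'})
        (x : T M N),
        cl M' N' (bif_map T g f x) = Ext1_pull g (Ext1_push f (cl M N x))].

(* Main.v *)
(** Let J be an ideal and K the kernel of a free cover G of M. Then Tor_1(M, A/J)
    is (K cap J G) / J K. For an extension 0 -> N -> E -> M -> 0 the number
    l(Tor_1 M) + l(Tor_1 N) - l(Tor_1 E) is the sum of the lengths of the kernels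
    of N/JN -> E/JE and of K_N/J K_N -> K_E/J K_E, where K_N and K_E come from
    compatible free covers. Both kernels can only shrink under pushouts and
    pullbacks of extensions, so that T-split extensions are stable under the
    action of morphisms, hence under Baer sums, and form a submodule of
    Ext^1(M, N), which is finitely generated.

    The limits e^T exist because the modules Tor_1(M, A/I_n) are the components
    of a finitely generated graded module over the Rees algebra of I, so that
    their lengths are eventually polynomial in n by Hilbert-Serre; by Artin-Rees
    they are O(n^(d-1)), since l(M/I^n M) = O(n^d): as A is Cohen-Macaulay, a
    maximal regular sequence of length d generates an m-primary ideal. *)

Require Import Defs.
From HB Require Import structures.
From mathcomp Require Import all_boot all_order all_algebra.
From mathcomp Require Import all_classical all_reals all_analysis.
From mathcomp Require Import zify ring lra.

Set Implicit Arguments.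
Unset Strict Implicit.
Unset Printing Implicit Defensive.

Import Order.TTheory GRing.Theory Num.Theory.
Import numFieldNormedType.Exports.

Local Open Scope classical_set_scope.
Local Open Scope ring_scope.

(** * Submodules *)

(* Lengths are computed without quotient modules: a length belongs to a pair of submodules of one
   ambient module, and exact sequences become additivity of lengths along inclusions. The two
   kernels are compared for each single n. The normalised defects of a pushout or pullback are thus
   squeezed between 0 and those of the given extension, which tend to 0 when it is T-split. Since
   classes of extensions are too large to form a module, they are replaced by cocycles on a fixed
   presentation of M: linear maps from the free module of relations to N, modulo those induced by
   maps on the free module of generators. A cocycle is a finite family of elements of N, so that
   finite generation follows from noetherianity, while pushouts, pullbacks and Baer sums become
   compositions and sums of linear maps. *)
Identity Coercion set_to_fun : set >-> Funclass.

Section Submod.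
Context {A : comNzRingType}.

Record submod (V : lmodType A) := Submod {
  submod_set :> set V;
  submod_setP : submodule submod_set
}.

Lemma submoduleE (V : lmodType A) (N : set V) :
  submodule N <-> N 0 /\ forall a x y, N x -> N y -> N (a *: x + y).
Proof.
split=> -[N0 NL]; split; first by rewrite -in_setE.
- by move=> a x y Nx Ny; rewrite -in_setE; apply: NL; rewrite inE.
- by rewrite -topredE /= in_setE.
- by move=> a x y; rewrite -!topredE /= !in_setE; apply: NL.
Qed.

Section Membership.
Variables (V : lmodType A) (N : submod V).

Lemma sm0 : N 0.
Proof. by have /submoduleE[] := submod_setP N. Qed.

Lemma smL a x y : N x -> N y -> N (a *: x + y).
Proof. by have /submoduleE[_ +] := submod_setP N; apply. Qed.

Lemma smD x y : N x -> N y -> N (x + y).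
Proof. by move=> Nx Ny; rewrite -[x]scale1r; apply: smL. Qed.

Lemma smZ a x : N x -> N (a *: x).
Proof. by move=> Nx; rewrite -[_ *: _]addr0; apply: smL => //; apply: sm0. Qed.

Lemma smN x : N x -> N (- x).
Proof. by move=> Nx; rewrite -scaleN1r; apply: smZ. Qed.

Lemma smB x y : N x -> N y -> N (x - y).
Proof. by move=> Nx Ny; apply: smD => //; apply: smN. Qed.

Lemma sm_subK x y : N (x - y) -> N y -> N x.
Proof. by move=> Nxy Ny; rewrite -(subrK y x); apply: smD. Qed.

Lemma sm_sum (T : Type) (r : seq T) (P : pred T) (f : T -> V) :
  (forall i, P i -> N (f i)) -> N (\sum_(i <- r | P i) f i).
Proof. by move=> Nf; elim/big_ind: _ => //; [exact: sm0 | exact: smD]. Qed.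

End Membership.

Lemma submod_eq (V : lmodType A) (N K : submod V) : N `<=` K -> K `<=` N -> N = K.
Proof.
case: N K => [N hN] [K hK] /= NK KN; have eqNK : N = K by apply/seteqP.
by subst K; rewrite (Prop_irrelevance hN hK).
Qed.

Section Operations.
Context {V W : lmodType A}.
Implicit Types (N K : submod V) (f : {linear V -> W}) (J : set A).

Lemma fullm_subproof : submodule (setT : set V).
Proof. exact/submoduleE. Qed.
Definition fullm := Submod fullm_subproof.

Lemma zerom_subproof : submodule ([set 0] : set V).
Proof. by apply/submoduleE; split=> // a x y -> ->; rewrite /= scaler0 addr0. Qed.
Definition zerom := Submod zerom_subproof.

Lemma capm_subproof N K : submodule (N `&` K).
Proof.
apply/submoduleE; split=> [|a x y [? ?] [? ?]]; split; by [exact: sm0 | exact: smL].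
Qed.
Definition capm N K := Submod (capm_subproof N K).

Lemma addm_subproof N K :
  submodule [set v | exists x y, [/\ N x, K y & v = x + y]].
Proof.
apply/submoduleE; split=> [|a _ _ [x [y [? ? ->]]] [x' [y' [? ? ->]]]].
  by exists 0, 0; rewrite addr0; split=> //; apply: sm0.
exists (a *: x + x'), (a *: y + y'); split; try exact: smL.
by rewrite scalerDr addrACA.
Qed.
Definition addm N K := Submod (addm_subproof N K).

Lemma imm_subproof f N : submodule (f @` N).
Proof.
apply/submoduleE; split=> [|a _ _ [x Nx <-] [y Ny <-]].
  by exists 0; rewrite ?linear0 //; apply: sm0.
by exists (a *: x + y); rewrite ?linearP //; apply: smL.
Qed.
Definition imm f N := Submod (imm_subproof f N).

Lemma prem_subproof f (N : submod W) : submodule (f @^-1` N).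
Proof.
apply/submoduleE; split=> [|a x y Nx Ny]; rewrite /preimage /=.
  by rewrite linear0; apply: sm0.
by rewrite linearP; apply: smL.
Qed.
Definition prem f (N : submod W) := Submod (prem_subproof f N).

Lemma spanm_subproof (X : set V) : submodule (submod_span X).
Proof.
apply/submoduleE; split=> [N /submoduleE[]//|a x y Xx Xy N hN XN].
by have /submoduleE[_] := hN; apply; [apply: Xx | apply: Xy].
Qed.
Definition spanm X := Submod (spanm_subproof X).

Definition mulm J N : submod V :=
  spanm [set v | exists a x, [/\ J a, N x & v = a *: x]].

Lemma scalem_subproof (a : A) N : submodule [set a *: x | x in N].
Proof.
apply/submoduleE; split=> [|b _ _ [x Nx <-] [y Ny <-]].
  by exists 0; rewrite ?scaler0 //; apply: sm0.
exists (b *: x + y); first exact: smL.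
by rewrite scalerDr !scalerA mulrC.
Qed.
Definition scalem a N := Submod (scalem_subproof a N).

(** Since the colon ideal is a submodule of [A^o], a claim about [c *: x] for all c in a span need
    only be checked for the generators of that span. *)
Lemma colon_subproof N (x : V) : submodule [set c : A^o | N (c *: x)].
Proof.
apply/submoduleE; split=> [|a b b' /= Nb Nb']; first by rewrite /= scale0r; apply: sm0.
by rewrite scalerDl -scalerA; apply: smL.
Qed.
Definition colon N x := Submod (colon_subproof N x).

End Operations.

Section Generation.
Context {V : lmodType A}.
Implicit Types (N K L : submod V) (J : set A).

Lemma subset_spanm (X : set V) : X `<=` spanm X.
Proof. by move=> x Xx N _; apply. Qed.

Lemma spanm_sub (X : set V) N : X `<=` N -> spanm X `<=` N.
Proof. by move=> XN x; apply => //; apply: submod_setP. Qed.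

Lemma spanmS (X Y : set V) : X `<=` Y -> spanm X `<=` spanm Y.
Proof. by move=> XY; apply: spanm_sub => x /XY; apply: subset_spanm. Qed.

End Generation.

Section OperationsTheory.
Context {V : lmodType A}.
Implicit Types (N K L : submod V) (J : set A).

Lemma mulm_gen J N a x : J a -> N x -> mulm J N (a *: x).
Proof. by move=> Ja Nx; apply: subset_spanm; exists a, x. Qed.

Lemma mulm_sub J N K : (forall a x, J a -> N x -> K (a *: x)) -> mulm J N `<=` K.
Proof. by move=> h; apply: spanm_sub => _ [a [x [Ja Nx ->]]]; apply: h. Qed.

Lemma mulm_subr J N : mulm J N `<=` N.
Proof. by apply: mulm_sub => a x _; apply: smZ. Qed.

Lemma mulmS J J' N N' : J `<=` J' -> N `<=` N' -> mulm J N `<=` mulm J' N'.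
Proof. by move=> JJ' NN'; apply: mulm_sub => a x /JJ' ? /NN' ?; apply: mulm_gen. Qed.

Lemma addm_inl N K : N `<=` addm N K.
Proof. by move=> x Nx; exists x, 0; rewrite addr0; split=> //; apply: sm0. Qed.

Lemma addm_inr N K : K `<=` addm N K.
Proof. by move=> x Nx; exists 0, x; rewrite add0r; split=> //; apply: sm0. Qed.

Lemma addm_sub N K L : N `<=` L -> K `<=` L -> addm N K `<=` L.
Proof. by move=> NL KL _ [x [y [/NL ? /KL ? ->]]]; apply: smD. Qed.

Lemma addmS N K N' K' : N `<=` N' -> K `<=` K' -> addm N K `<=` addm N' K'.
Proof.
by move=> NN KK; apply: addm_sub => x; [move/NN; apply: addm_inl | move/KK; apply: addm_inr].
Qed.

Lemma mulm_comp J J' N : mulm J (mulm J' N) `<=` mulm (ideal_mul J J') N.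
Proof.
apply: mulm_sub => a x Ja; suff: mulm J' N `<=` prem (GRing.scale a) (mulm (ideal_mul J J') N).
  by apply.
apply: mulm_sub => b y Jb Ny; rewrite /= scalerA; apply: mulm_gen => //.
by apply: (subset_spanm (V := A^o)); exists a, b.
Qed.

Lemma mulm_ideal_mul J J' N : mulm (ideal_mul J J') N `<=` mulm J (mulm J' N).
Proof.
apply: mulm_sub => c x Jc Nx.
move: c Jc; apply: (spanm_sub (N := colon (mulm J (mulm J' N)) x)) => _ [a [b [Ja Jb ->]]] /=.
rewrite /=; have -> : (a *: b) *: x = a *: (b *: x) by rewrite scalerA.
exact: (mulm_gen Ja (mulm_gen Jb Nx)).
Qed.

Lemma mulm_spanm (X : set A^o) N : mulm (spanm X) N = mulm X N.
Proof.
apply: submod_eq; last by apply: mulmS => //; exact: (@subset_spanm A^o X).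
apply: mulm_sub => c x Xc Nx.
by move: c Xc; apply: (spanm_sub (N := colon (mulm X N) x)) => a Xa; apply: mulm_gen.
Qed.

Lemma mulm_setT N : mulm setT N = N.
Proof.
apply: submod_eq; first exact: mulm_subr.
by move=> x Nx; rewrite -[x]scale1r; apply: mulm_gen.
Qed.

Lemma mulm_addm J N K : mulm J (addm N K) `<=` addm (mulm J N) (mulm J K).
Proof.
apply: mulm_sub => a _ Ja [x [y [Nx Ky ->]]]; rewrite scalerDr.
by exists (a *: x), (a *: y); split=> //; apply: mulm_gen.
Qed.

Lemma spanmE (X : set V) : spanm X = submod_span X :> set V.
Proof. by []. Qed.

End OperationsTheory.

Section Images.
Context {V W : lmodType A}.
Variable f : {linear V -> W}.

Lemma mulm_map J (N : submod V) (K : submod W) :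
  (forall x, N x -> K (f x)) -> forall x, mulm J N x -> mulm J K (f x).
Proof.
move=> h; suff: mulm J N `<=` prem f (mulm J K) by [].
by apply: mulm_sub => a x Ja Nx; rewrite /= linearZ; apply: mulm_gen => //; apply: h.
Qed.

Lemma mulm_imm J (N : submod V) y :
  mulm J (imm f N) y -> exists2 x, mulm J N x & f x = y.
Proof.
suff: mulm J (imm f N) `<=` imm f (mulm J N) by move=> + hy; case/(_ _ hy) => x; exists x.
apply: mulm_sub => a _ Ja [x Nx <-]; exists (a *: x); last by rewrite linearZ.
exact: mulm_gen.
Qed.

End Images.
End Submod.

Arguments fullm {A V}.
Arguments zerom {A V}.

(* Keeps simplification from unfolding membership into a quantification over all
   submodules. *)
#[global] Opaque spanm mulm.

(** * Length *)

Section Length.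
Context {A : comNzRingType}.

(** A chain of k strict inclusions whose smallest term contains K and whose largest term is N
    itself. Fixing the last term suits induction; [chain_widen] and [chainSr] relax both ends. *)
Inductive chain {V : lmodType A} (K : submod V) : submod V -> nat -> Prop :=
| chain0 (N : submod V) : K `<=` N -> chain K N 0
| chainS (N N' : submod V) k : chain K N k -> N `<` N' -> chain K N' k.+1.

Definition finlen {V : lmodType A} (N K : submod V) : Prop :=
  exists b, forall k, chain K N k -> (k <= b)%N.

(** A natural number, so that additivity is plain arithmetic; it is the junk value 0 unless K is
    contained in N and the chains have bounded length. *)
Definition len {V : lmodType A} (N K : submod V) : nat :=
  xget 0%N [set n | chain K N n /\ forall k, chain K N k -> (k <= n)%N].

Section ChainTheory.
Context {V : lmodType A}.
Implicit Types N K L : submod V.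

Lemma properP N K : N `<` K -> N `<=` K /\ exists2 x, K x & ~ N x.
Proof.
move=> [NK neNK]; split=> //; apply: contrapT => h; apply: neNK => x Kx.
by apply: contrapT => Nx; apply: h; exists x.
Qed.

Lemma proper_ex N K x : N `<=` K -> K x -> ~ N x -> N `<` K.
Proof. by move=> NK Kx Nx; split=> // KN; apply/Nx/KN. Qed.

Lemma chain_sub K N k : chain K N k -> K `<=` N.
Proof. by elim=> // {}N N' {}k _ KN /properP[NN' _] x /KN /NN'. Qed.

Lemma chain_widen K N N' k : chain K N k -> N `<=` N' -> chain K N' k.
Proof.
case=> [N0 KN0|N0 N1 k' c lt01] sub; first by apply: chain0 => x /KN0 /sub.
apply: chainS c _; have [sub01 [x N1x nx]] := properP lt01.
by apply: (proper_ex (x := x)) => [y /sub01 /sub||//]; last exact: sub.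
Qed.

Lemma chainSr K K' N k : chain K N k -> K' `<=` K -> chain K' N k.
Proof.
move=> + K'K; elim=> [N0 KN0|N0 N1 k' _ IH lt01]; last exact: chainS IH lt01.
by apply: chain0 => x /K'K /KN0.
Qed.

Lemma chain_cat L K N a b : chain L K b -> chain K N a -> chain L N (b + a).
Proof.
move=> cb; elim=> [N0 KN0|N0 N1 k' _ IH lt01]; first by rewrite addn0; apply: chain_widen cb _.
by rewrite addnS; apply: chainS IH lt01.
Qed.

(* By the modular law a strict inclusion N < N' remains strict after
   intersecting with K or after adding K. *)
Lemma chain_split L K N k : L `<=` K -> chain L N k ->
  exists a b, [/\ chain K (addm N K) a, chain L (capm N K) b & (k <= a + b)%N].
Proof.
move=> LK; elim=> [N0 LN0|N0 N1 k' _ [a [b [ca cb le]]] lt01].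
  exists 0%N, 0%N; split=> //; apply: chain0; first exact: addm_inr.
  by move=> x Lx; split; [exact: LN0 | exact: LK].
have [sub01 [x N1x nx]] := properP lt01.
have subD : addm N0 K `<=` addm N1 K by apply: addmS.
have subI : capm N0 K `<=` capm N1 K by move=> y [/sub01].
have [ltD|eqD] := pselect (addm N0 K `<` addm N1 K).
  exists a.+1, b; split; [exact: chainS ca ltD | exact: chain_widen cb _ | lia].
exists a, b.+1; split; [exact: chain_widen ca _| | lia].
(* Here N0 + K = N1 + K, so x is y + z with y in N0 and z in K; this z shows that the intersections
   with K differ. *)
apply: (chainS cb); have [y [z [N0y Kz eqx]]] : addm N0 K x.
  apply: contrapT => hx; apply/eqD/(proper_ex subD (addm_inl _ N1x) hx).
apply: (proper_ex (x := z) subI).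
  by split=> //; rewrite -[z](addKr y) -eqx addrC; apply: smB => //; apply: sub01.
by move=> [N0z _]; apply: nx; rewrite eqx; apply: smD.
Qed.

Lemma lenP N K : K `<=` N -> finlen N K ->
  chain K N (len N K) /\ forall k, chain K N k -> (k <= len N K)%N.
Proof.
move=> KN fin; rewrite /len; case: xgetP => // h; exfalso.
case: fin => b hb; have [n [/asboolP cn hn]] :
    exists n, `[< chain K N n >] /\ forall k, chain K N k -> (k <= n)%N.
  have ex : exists n, `[< chain K N n >] by exists 0%N; apply/asboolP; apply: chain0.
  have ub n : `[< chain K N n >] -> (n <= b)%N by move/asboolP; apply: hb.
  case: (ex_maxnP ex ub) => n cn hn; exists n; split=> // k ck.
  by apply: hn; apply/asboolP.
by apply: (h n); split.
Qed.

Lemma len_unique N K n : chain K N n -> (forall k, chain K N k -> (k <= n)%N) ->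
  len N K = n.
Proof.
move=> cn hn; have [] := lenP (chain_sub cn) (ex_intro _ n hn).
by move=> /hn le1 /(_ _ cn) le2; lia.
Qed.

Lemma finlenS N N' K K' : N' `<=` N -> K `<=` K' -> finlen N K -> finlen N' K'.
Proof.
move=> N'N KK' [b hb]; exists b => k ck; apply: hb.
exact: chain_widen (chainSr ck KK') N'N.
Qed.

(** Concatenating maximal chains gives one inequality; cutting an arbitrary chain at K by
    [chain_split] gives the other. *)
Lemma len_add N K L : L `<=` K -> K `<=` N -> finlen N L ->
  len N L = (len N K + len K L)%N.
Proof.
move=> LK KN fNL; have fNK : finlen N K by apply: finlenS fNL.
have fKL : finlen K L by apply: finlenS fNL.
have [c1 h1] := lenP KN fNK; have [c2 h2] := lenP LK fKL.
apply: len_unique; first by rewrite addnC; apply: chain_cat c2 c1.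
move=> k /(chain_split LK)[a [b [ca cb le]]].
have /h1 : chain K N a by apply: chain_widen ca _; apply: addm_sub.
have /h2 : chain L K b by apply: chain_widen cb _ => x [].
lia.
Qed.

Lemma finlen_add N K L : L `<=` K -> K `<=` N -> finlen N K -> finlen K L -> finlen N L.
Proof.
move=> LK KN [b1 h1] [b2 h2]; exists (b1 + b2)%N => k /(chain_split LK)[a [b [ca cb le]]].
have /h1 : chain K N a by apply: chain_widen ca _; apply: addm_sub.
have /h2 : chain L K b by apply: chain_widen cb _ => x [].
lia.
Qed.

Lemma finlenxx N : finlen N N.
Proof.
exists 0%N => k; suff h N' : chain N N' k -> N' `<=` N -> (k <= 0)%N by move=> /h; apply.
move: N' => N' ; case=> [//|N0 N1 k' c /properP[_ [x N1x nx]] sub].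
by case: nx; apply: (chain_sub c); apply: sub.
Qed.

Lemma len_xx N : len N N = 0%N.
Proof.
have := @len_add N N N (fun _ => id) (fun _ => id) (finlenxx N).
lia.
Qed.

Lemma len_leS N N' K K' : N' `<=` N -> K `<=` K' -> K' `<=` N' -> finlen N K ->
  (len N' K' <= len N K)%N.
Proof.
move=> N'N KK' K'N' fin; have fin' : finlen N' K' by apply: finlenS fin.
have KN : K `<=` N by move=> x /KK' /K'N' /N'N.
have [c _] := lenP K'N' fin'; have [_ ->//] := lenP KN fin.
exact: chain_widen (chainSr c KK') N'N.
Qed.

(** The bridge from the extended real supremum of the statement to the maximum [len] with which all
    computations are done. *)
Lemma length_quotE (R : realType) N K : K `<=` N -> finlen N K ->
  length_quot R N K = (len N K)%:R%:E.
Proof.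
move=> KN fin; have [c hmax] := lenP KN fin.
apply/eqP; rewrite eq_le; apply/andP; split.
  apply: ub_ereal_sup => _ [k [L [hL KL LN lt] <-]]; rewrite lee_fin ler_nat; apply: hmax.
  (* Only the terms of index at most k are known to be submodules; the others are replaced by
     [zerom]. *)
  have ex i : exists M : submod V, (i <= k)%N -> M = L i :> set V.
    case: (leqP i k) => [ik|_]; last by exists zerom.
    by exists (Submod (hL i ik)).
  have [M hM] := boolp.choice ex.
  apply: (chain_widen (N := M k)); last by rewrite hM.
  have : (k <= k)%N by []; elim: {-2}k => [_|j IH jk].
    by apply: chain0; rewrite hM.
  apply: (chainS (IH (ltnW jk))); rewrite !hM //; last exact: ltnW.
  exact: lt.
apply: ereal_sup_ubound; exists (len N K) => //.
elim: c => [N0 KN0|N0 N1 k c [L [hL KL LN lt]] lt01].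
  by exists (fun=> K); split=> // i _; apply: submod_setP.
exists (fun i => if (i <= k)%N then L i else N1); split.
- move=> i _; case: ifP => [/hL//|_]; exact: submod_setP.
- by [].
- by rewrite ltnn.
- move=> i; rewrite ltnS => ik; rewrite ik; case: ltnP => [/lt//|ki].
  have <- : k = i by lia.
  have [sub01 [x N1x nx]] := properP lt01; split=> [y /LN /sub01//|h].
  by apply/nx/LN/h.
Qed.

End ChainTheory.

Section Transfer.
Context {V W : lmodType A}.
Variable f : {linear V -> W}.

(** The hypotheses say that f induces an injection N / K -> N' / K'. A term L of the chain is sent
    to f(L) + K'; strictness survives because two elements whose images agree modulo K' differ by an
    element of K. *)
Lemma chain_inj (N K : submod V) (N' K' : submod W) k : K' `<=` N' ->
  (forall x, N x -> N' (f x)) -> (forall x, N x -> K' (f x) -> K x) ->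
  chain K N k -> chain K' N' k.
Proof.
move=> K'N' fN fK c; apply: (@chain_widen _ _ (addm (imm f N) K')); last first.
  by apply: addm_sub => // _ [x /fN ? <-].
elim: c fK {fN} => [N0 KN0 _|N0 N1 k' c IH lt01 fK]; first by apply: chain0; apply: addm_inr.
have [sub01 [x N1x nx]] := properP lt01.
apply: chainS (IH _) _ => [y /sub01|]; first exact: fK.
apply: (proper_ex (x := f x)).
- by apply: addmS => // _ [y /sub01 ? <-]; exists y.
- by apply: addm_inl; exists x.
move=> [_ [z [[y N0y <-] K'z eqf]]]; apply: nx; apply: (@sm_subK _ _ N0 x y) => //.
apply: (chain_sub c); apply: fK; first by apply: smB => //; apply: sub01.
by rewrite linearB /= eqf addrC addKr.
Qed.

Lemma finlen_inj (N K : submod V) (N' K' : submod W) : K' `<=` N' ->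
  (forall x, N x -> N' (f x)) -> (forall x, N x -> K' (f x) -> K x) ->
  finlen N' K' -> finlen N K.
Proof. by move=> h1 h2 h3 [b hb]; exists b => k /(chain_inj h1 h2 h3); apply: hb. Qed.

Lemma len_inj (N K : submod V) (N' K' : submod W) : K `<=` N -> K' `<=` N' ->
  (forall x, N x -> N' (f x)) -> (forall x, N x -> K' (f x) -> K x) ->
  finlen N' K' -> (len N K <= len N' K')%N.
Proof.
move=> KN h1 h2 h3 fin; have [_] := lenP h1 fin; apply; apply: (chain_inj h1 h2 h3).
by have [] := lenP KN (finlen_inj h1 h2 h3 fin).
Qed.

(** Every class of N' / K' has a representative in f(N). Pulling a chain back along f and
    intersecting with N keeps its inclusions strict. *)
Lemma chain_surj (N K : submod V) (N' K' : submod W) k : K `<=` N ->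
  (forall x, K x -> K' (f x)) ->
  (forall y, N' y -> exists x, N x /\ K' (y - f x)) ->
  chain K' N' k -> chain K N k.
Proof.
move=> KN fK fN c; apply: (@chain_widen _ _ (capm N (prem f N'))) => [|x []//].
elim: c fN => [N0 KN0 _|N0 N1 k' c IH lt01 fN].
  by apply: chain0 => x Kx; split; [exact: KN | exact/KN0/fK].
have [sub01 [y N1y ny]] := properP lt01.
apply: chainS (IH _) _ => [z /sub01|]; first exact: fN.
have [x [Nx K'x]] := fN y N1y.
have N0x : N0 (y - f x) by apply: (chain_sub c).
apply: (proper_ex (x := x)) => [z [Nz /sub01 N0z]|| [_ N0fx]]; first by split.
- by split=> //=; rewrite -(subKr y (f x)); apply: smB => //; apply: sub01.
- by apply: ny; apply: sm_subK N0x N0fx.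
Qed.

Lemma finlen_surj (N K : submod V) (N' K' : submod W) : K `<=` N ->
  (forall x, K x -> K' (f x)) ->
  (forall y, N' y -> exists x, N x /\ K' (y - f x)) ->
  finlen N K -> finlen N' K'.
Proof. by move=> h1 h2 h3 [b hb]; exists b => k /(chain_surj h1 h2 h3); apply: hb. Qed.

Lemma len_surj (N K : submod V) (N' K' : submod W) : K `<=` N -> K' `<=` N' ->
  (forall x, K x -> K' (f x)) ->
  (forall y, N' y -> exists x, N x /\ K' (y - f x)) ->
  finlen N K -> (len N' K' <= len N K)%N.
Proof.
move=> KN K'N' h2 h3 fin; have [_] := lenP KN fin; apply; apply: (chain_surj KN h2 h3).
by have [] := lenP K'N' (finlen_surj KN h2 h3 fin).
Qed.

Lemma len_iso (N K : submod V) (N' K' : submod W) : K `<=` N -> K' `<=` N' ->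
  (forall x, N x -> N' (f x)) -> (forall x, N x -> K x <-> K' (f x)) ->
  (forall y, N' y -> exists x, N x /\ K' (y - f x)) ->
  finlen N K -> len N K = len N' K' /\ finlen N' K'.
Proof.
move=> KN K'N' fN fK surj fin.
have fK' x : K x -> K' (f x) by move=> Kx; apply/fK => //; apply: KN.
have fin' : finlen N' K' := finlen_surj KN fK' surj fin.
split=> //; apply/eqP; rewrite eqn_leq (len_surj KN K'N' fK' surj fin) andbT.
by apply: len_inj => // x Nx /fK; apply.
Qed.

End Transfer.
End Length.

(** * Subquotients *)

Section Subquotient.
Context {A : comNzRingType} {V : lmodType A}.
Variables N K : submod V.

(* Junk value 0 when x is not congruent to an element of N. *)
Definition subq_repr (x : V) : V := xget 0 [set y | N y /\ K (x - y)].

Lemma subq_reprP x : N x -> N (subq_repr x) /\ K (x - subq_repr x).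
Proof.
move=> Nx; rewrite /subq_repr; case: xgetP => // h; exfalso.
by apply: (h x); split=> //; rewrite subrr; apply: sm0.
Qed.

(** Congruent elements have the same set of candidates, hence the same chosen one. *)
Lemma subq_repr_eq x y : K (x - y) -> subq_repr x = subq_repr y.
Proof.
move=> Kxy; rewrite /subq_repr; congr xget; apply/seteqP; split=> z [Nz Kz]; split=> //.
  by rewrite -(subrKA x) -opprB addrC; apply: smB.
by rewrite -(subrKA y); apply: smD.
Qed.

Definition subq_pred (x : V) : bool := `[< N x /\ subq_repr x = x >].

(** The classes of N / K are their chosen representatives, so that equality of classes is plain
    equality in a subtype of V. *)
Definition subq : Type := {x : V | subq_pred x}.

HB.instance Definition _ := Choice.on subq.

Definition subq_val (x : subq) : V := sval x.

Lemma subq_valP x : N (subq_val x).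
Proof. by case: x => x /= /asboolP[]. Qed.

Lemma subq_cls_subproof x : subq_pred (subq_repr (if `[< N x >] then x else 0)).
Proof.
set y := if _ then _ else _; have Ny : N y.
  by rewrite /y; case: asboolP => // _; apply: sm0.
have [Nr Kr] := subq_reprP Ny; apply/asboolP; split=> //.
by rewrite -(subq_repr_eq Kr).
Qed.

(* The class of 0 when x is not in N. *)
Definition subq_cls (x : V) : subq := exist (fun x => subq_pred x) _ (subq_cls_subproof x).

Lemma subq_cls_eq x y : N x -> N y -> subq_cls x = subq_cls y <-> K (x - y).
Proof.
move=> Nx Ny; have [Nrx Kx] := subq_reprP Nx; have [Nry Ky] := subq_reprP Ny.
rewrite /subq_cls; split=> [/(congr1 val) /=|Kxy]; last first.
  apply: val_inj => /=; move/asboolP: (Nx) => ->; move/asboolP: (Ny) => ->.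
  exact: subq_repr_eq.
move/asboolP: (Nx) => ->; move/asboolP: (Ny) => -> eqr.
by rewrite -(subrKA (subq_repr y)) -[subq_repr y - y]opprB -{1}eqr; apply: smB.
Qed.

Lemma subq_valK x : subq_cls (subq_val x) = x.
Proof.
apply: val_inj => /=; case: x => x /= /asboolP[Nx eqx].
by move/asboolP: Nx => ->.
Qed.

Lemma subq_clsK x : N x -> K (x - subq_val (subq_cls x)).
Proof.
move=> Nx; apply/subq_cls_eq => //; first exact: subq_valP.
by rewrite subq_valK.
Qed.

Lemma subq_ind (P : subq -> Prop) : (forall x, N x -> P (subq_cls x)) -> forall x, P x.
Proof. by move=> h x; rewrite -(subq_valK x); apply/h/subq_valP. Qed.

Definition subq_add x y := subq_cls (subq_val x + subq_val y).
Definition subq_opp x := subq_cls (- subq_val x).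
Definition subq_scale a x := subq_cls (a *: subq_val x).

Lemma subq_addE x y : N x -> N y -> subq_add (subq_cls x) (subq_cls y) = subq_cls (x + y).
Proof.
move=> Nx Ny; apply/esym/subq_cls_eq; try by apply: smD => //; apply: subq_valP.
by rewrite opprD addrACA; apply: smD; apply: subq_clsK.
Qed.

Lemma subq_oppE x : N x -> subq_opp (subq_cls x) = subq_cls (- x).
Proof.
move=> Nx; apply/esym/subq_cls_eq; try by apply: smN => //; apply: subq_valP.
by rewrite -opprD; apply: smN; apply: subq_clsK.
Qed.

Lemma subq_scaleE a x : N x -> subq_scale a (subq_cls x) = subq_cls (a *: x).
Proof.
move=> Nx; apply/esym/subq_cls_eq; try by apply: smZ => //; apply: subq_valP.
by rewrite -scalerBr; apply: smZ; apply: subq_clsK.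
Qed.

Lemma subq_addA : associative subq_add.
Proof.
elim/subq_ind=> x Nx; elim/subq_ind=> y Ny; elim/subq_ind=> z Nz.
by rewrite !subq_addE ?addrA //; apply: smD.
Qed.

Lemma subq_addC : commutative subq_add.
Proof. by move=> x y; rewrite /subq_add addrC. Qed.

Lemma subq_add0 : left_id (subq_cls 0) subq_add.
Proof. by elim/subq_ind=> x Nx; rewrite subq_addE ?add0r //; apply: sm0. Qed.

Lemma subq_addN : left_inverse (subq_cls 0) subq_opp subq_add.
Proof.
by elim/subq_ind=> x Nx; rewrite subq_oppE // subq_addE ?addNr //; apply: smN.
Qed.

HB.instance Definition _ :=
  GRing.isZmodule.Build subq subq_addA subq_addC subq_add0 subq_addN.

Lemma subq_scaleA a b x : subq_scale a (subq_scale b x) = subq_scale (a * b) x.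
Proof. by elim/subq_ind: x => x Nx; rewrite !subq_scaleE ?scalerA //; apply: smZ. Qed.

Lemma subq_scale1 : left_id 1 subq_scale.
Proof. by elim/subq_ind=> x Nx; rewrite subq_scaleE ?scale1r. Qed.

Lemma subq_scaleDr : right_distributive subq_scale +%R.
Proof.
move=> a; elim/subq_ind=> x Nx; elim/subq_ind=> y Ny.
rewrite /GRing.add /= subq_addE // !subq_scaleE ?subq_addE ?scalerDr //; try exact: smZ.
exact: smD.
Qed.

Lemma subq_scaleDl x : {morph subq_scale^~ x : a b / a + b}.
Proof.
move=> a b; elim/subq_ind: x => x Nx.
rewrite [in RHS]/GRing.add /= !subq_scaleE // ?subq_addE ?scalerDl //; exact: smZ.
Qed.

HB.instance Definition _ := GRing.Zmodule_isLmodule.Build A subq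
  subq_scaleA subq_scale1 subq_scaleDr subq_scaleDl.

Lemma subq_clsL a x y : N x -> N y ->
  subq_cls (a *: x + y) = a *: subq_cls x + subq_cls y.
Proof.
move=> Nx Ny; rewrite [RHS]/GRing.add /= [X in subq_add X _]/GRing.scale /=.
by rewrite subq_scaleE // subq_addE //; apply: smZ.
Qed.

(** Representatives are not chosen linearly, but the error lies in K; a map on N that respects K can
    therefore be defined on representatives. *)
Lemma subq_val_linear a x y : K (a *: subq_val x + subq_val y - subq_val (a *: x + y)).
Proof.
have Nx := subq_valP x; have Ny := subq_valP y.
rewrite -{2}(subq_valK x) -{2}(subq_valK y) -subq_clsL //.
by apply: subq_clsK; apply: smL.
Qed.

Lemma subq_cls0 : subq_cls 0 = 0.
Proof. by []. Qed.

Lemma subq_cls_eq0 x : N x -> subq_cls x = 0 <-> K x.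
Proof. by move=> Nx; rewrite -subq_cls0 subq_cls_eq ?subr0 //; apply: sm0. Qed.

End Subquotient.

Section Quotient.
Context {A : comNzRingType} {V : lmodType A}.
Variable K : submod V.

Definition quot := subq (@fullm A V) K.
HB.instance Definition _ := GRing.Lmodule.on quot.

Definition quot_pi : V -> quot := @subq_cls A V fullm K.

Lemma quot_pi_linear : linear quot_pi.
Proof. by move=> a x y; apply: subq_clsL. Qed.

HB.instance Definition _ := GRing.isLinear.Build A V quot _ quot_pi quot_pi_linear.

Lemma quot_pi_surj (y : quot) : exists x, quot_pi x = y.
Proof. by exists (subq_val y); apply: subq_valK. Qed.

Lemma quot_pi_eq0 x : quot_pi x = 0 <-> K x.
Proof. exact: subq_cls_eq0. Qed.

End Quotient.

(** * Noetherian modules and parameters *)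

Section Noetherian.
Context {A : comNzRingType}.

Definition sm_fg {V : lmodType A} (N : submod V) : Prop :=
  exists s : seq V, N = spanm [set` s].

Definition noeth_mod (V : lmodType A) : Prop := forall N : submod V, sm_fg N.

Lemma spanm_cons (V : lmodType A) x (t : seq V) v : spanm [set` x :: t] v ->
  exists a y, spanm [set` t] y /\ v = a *: x + y.
Proof.
have hN : submodule [set v | exists a y, spanm [set` t] y /\ v = a *: x + y].
  apply/submoduleE; split; first by exists 0, 0; rewrite scale0r addr0; split=> //; apply: sm0.
  move=> b _ _ [a [y [ty ->]]] [a' [y' [ty' ->]]].
  exists (b * a + a'), (b *: y + y'); split; first exact: smL.
  by rewrite scalerDr scalerDl scalerA addrACA.
move: v; apply: (spanm_sub (N := Submod hN)) => z /=; rewrite inE => /orP[/eqP ->|tz].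
  by exists 1, 0; rewrite scale1r addr0; split=> //; apply: sm0.
by exists 0, z; rewrite scale0r add0r; split=> //; apply: subset_spanm.
Qed.

Lemma spanm_nil (V : lmodType A) (v : V) : spanm [set` [::]] v -> v = 0.
Proof. by move=> h; apply: (spanm_sub (N := zerom) _ h). Qed.

Hypothesis noethA : noetherian A.

(** Induction on the generators: the coefficients of x in elements of N form an ideal, whose
    finitely many generators are lifted to N by [g]; what remains of N lies in the span of t. *)
Lemma noeth_spanm (V : lmodType A) (t : seq V) (N : submod V) :
  N `<=` spanm [set` t] -> sm_fg N.
Proof.
elim: t N => [|x t IH] N Nt.
  exists [::]; apply: submod_eq => [v /Nt|] //.
  by apply: spanm_sub.
have hJ : submodule [set a : A^o | exists2 n, N n & spanm [set` t] (n - a *: x)].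
  apply/submoduleE; split.
    by exists 0; rewrite /= ?scale0r ?subr0; apply: sm0.
  move=> b a a' [n Nn tn] [n' Nn' tn']; exists (b *: n + n'); first exact: smL.
  rewrite scalerDl opprD addrACA; apply: smD => //.
  have -> : (b *: a) *: x = b *: (a *: x) by rewrite scalerA.
  by rewrite -scalerBr; apply: smZ.
have [u equ] := noethA hJ.
have /boolp.choice[g hg] : forall a : A, exists n, (exists2 n, N n & spanm [set` t] (n - a *: x)) ->
    N n /\ spanm [set` t] (n - a *: x).
  move=> a; have [[n Nn tn]|no] := pselect (exists2 n, N n & spanm [set` t] (n - a *: x)).
    by exists n.
  by exists 0 => /no.
have [s eqs] : sm_fg (capm N (spanm [set` t])) by apply: IH => v [].
exists (s ++ map g u); apply: submod_eq; last first.
  apply: spanm_sub => v /=; rewrite mem_cat => /orP[vs|/mapP[a ua ->]].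
    have : capm N (spanm [set` t]) v by rewrite eqs; apply: subset_spanm.
    by case.
  have : submod_span [set` u] a by apply: (subset_spanm (V := A^o)).
  by rewrite equ => /hg[].
(* Every coefficient a of the ideal is already attained, modulo the span of t, by a combination of
   the chosen lifts. *)
have key a : spanm [set` u] a ->
    exists2 n, spanm [set` map g u] n & spanm [set` t] (n - a *: x).
  have hK : submodule [set a : A^o |
      exists2 n, spanm [set` map g u] n & spanm [set` t] (n - a *: x)].
    apply/submoduleE; split.
      by exists 0; rewrite /= ?scale0r ?subr0; apply: sm0.
    move=> b c c' [n Nn tn] [n' Nn' tn']; exists (b *: n + n'); first exact: smL.
    rewrite scalerDl opprD addrACA; apply: smD => //.
    have -> : (b *: c) *: x = b *: (c *: x) by rewrite scalerA.
    by rewrite -scalerBr; apply: smZ.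
  move: a; apply: (spanm_sub (N := Submod hK)) => a ua; exists (g a).
    by apply: subset_spanm; apply/mapP; exists a.
  have : submod_span [set` u] a by apply: (subset_spanm (V := A^o)).
  by rewrite equ => /hg[].
move=> v Nv; have [a [y [ty eqv]]] := spanm_cons (Nt _ Nv).
have [n sn tn] : exists2 n, spanm [set` map g u] n & spanm [set` t] (n - a *: x).
  apply: key; rewrite spanmE equ; exists v => //.
  by rewrite eqv addrC addKr.
have Nn : N n.
  apply: (spanm_sub _ sn) => _ /mapP[b ub ->].
  have : submod_span [set` u] b by apply: (subset_spanm (V := A^o)).
  by rewrite equ => /hg[].
rewrite -(subrK n v); apply: smD; last first.
  by apply: spanmS sn => z /= zu; rewrite mem_cat zu orbT.
have : spanm [set` s] (v - n).
  rewrite -eqs; split; first exact: smB.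
  have -> : v - n = y - (n - a *: x) by rewrite eqv opprB addrCA addrA.
  exact: smB.
by apply: spanmS => z /= zs; rewrite mem_cat zs.
Qed.

Lemma noeth_fin_gen (V : lmodType A) : fin_gen V -> noeth_mod V.
Proof.
move=> [t eqt] N; apply: (@noeth_spanm _ t) => v _.
have : [set: V] v by [].
by rewrite -eqt.
Qed.

Lemma fin_gen_regular : fin_gen A^o.
Proof.
exists [:: 1 : A^o]; apply/seteqP; split=> // a _.
rewrite -[a]mulr1; apply: (smZ (N := spanm [set` [:: 1 : A^o]])).
by apply: subset_spanm; rewrite /= inE.
Qed.

Lemma noeth_regular : noeth_mod A^o.
Proof. exact/noeth_fin_gen/fin_gen_regular. Qed.

Lemma noeth_acc (V : lmodType A) (L : nat -> submod V) : noeth_mod V ->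
  (forall n, L n `<=` L n.+1) -> exists n0, forall n, L n `<=` L n0.
Proof.
move=> hV incr; have mono i j : (i <= j)%N -> L i `<=` L j.
  by move/subnK <-; elim: (j - i)%N => // k IH x /IH /incr.
have hU : submodule [set v | exists n, L n v].
  apply/submoduleE; split; first by exists 0%N; apply: sm0.
  move=> a x y [i Lx] [j Ly]; exists (maxn i j).
  by apply: smL; [apply: mono Lx; lia | apply: mono Ly; lia].
have [s eqs] := hV (Submod hU).
have [n0 h0] : exists n0, forall x, x \in s -> L n0 x.
  have : forall x, x \in s -> exists n, L n x.
    move=> x xs; have : Submod hU x by rewrite eqs; apply: subset_spanm.
    by [].
  elim: s {eqs} => [|x s IH] hs; first by exists 0%N.
  have [|n hn] := IH; first by move=> y ys; apply: hs; rewrite inE ys orbT.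
  have [k hk] := hs x (mem_head _ _); exists (maxn n k) => y; rewrite inE.
  move=> /orP[/eqP ->|/hn]; first by apply: mono hk; lia.
  by apply: mono; lia.
exists n0 => n x Lx; have : Submod hU x by exists n.
by rewrite eqs; apply: spanm_sub.
Qed.

(** Without a maximal member, choice would produce a strictly increasing sequence of submodules. *)
Lemma noeth_max (V : lmodType A) (P : submod V -> Prop) : noeth_mod V ->
  (exists N, P N) -> exists2 M, P M & forall N, P N -> M `<=` N -> N `<=` M.
Proof.
move=> hV [N0 PN0]; apply: contrapT => no.
have /boolp.choice[g hg] (M : {M | P M}) :
    exists N : {N | P N}, sval M `<` sval N.
  apply: contrapT => h; apply: no; exists (sval M); first exact: svalP.
  move=> N PN MN; apply: contrapT => nNM; apply: h.
  by exists (exist _ N PN); split.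
pose L n := sval (iter n g (exist _ N0 PN0)).
have [n h] : exists n0, forall n, L n `<=` L n0.
  by apply: noeth_acc => // n; have [] := hg (iter n g (exist _ N0 PN0)).
have [_] := hg (iter n g (exist _ N0 PN0)); apply; exact: (h n.+1).
Qed.

End Noetherian.

(** * Finite length modulo powers of a maximal ideal *)

Section MaximalIdeal.
Context {A : comNzRingType}.
Variable m : set A.
Hypothesis maxm : maximal_ideal m.

(** A / m is a field, and b is an inverse of a modulo m. *)
Lemma maximal_idealP a : ~ m a -> exists b c, m c /\ b * a + c = 1.
Proof.
case: maxm => hm m1 hmax na.
pose M : submod A^o := Submod hm.
pose Q := addm (scalem a fullm) M.
have mQ : M `<=` Q by apply: addm_inr.
have [eqQ|eqQ] := hmax Q (submod_setP Q) mQ; last first.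
  have : (Q : set A) 1 by rewrite eqQ.
  by move=> [_ [c [[b _ <-] mc eq1]]]; exists b, c; split=> //; rewrite eq1 mulrC.
exfalso; apply: na; rewrite -eqQ; apply: addm_inl; exists (1 : A^o) => //=.
exact: mulr1.
Qed.

Lemma maximal_prime : prime_ideal m.
Proof.
case: (maxm) => hm m1 _; split=> // x y mxy.
have [mx|/maximal_idealP[b [c [mc eq1]]]] := pselect (m x); first by left.
right; rewrite -[y]mul1r -eq1 mulrDl -mulrA.
have M : m = (Submod hm : set A^o) by [].
by rewrite [c * y]mulrC M; apply: (smD (N := Submod hm)); apply: (smZ (N := Submod hm)).
Qed.

Section FiniteLength.
Context {V : lmodType A}.

(** N / K is a quotient of the field A / m, hence simple or zero, and no chain has two strict
    steps. *)
Lemma finlen_cyclic (N K : submod V) x :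
  (forall v, N v -> exists a y, K y /\ v = a *: x + y) ->
  (forall a, m a -> K (a *: x)) -> finlen N K.
Proof.
move=> gen mx.
have simple (L : submod V) : K `<=` L -> L `<=` N -> ~ (L `<=` K) -> N `<=` L.
  move=> KL LN nLK; have [y Ly ny] : exists2 y, L y & ~ K y.
    by apply: contrapT => h; apply: nLK => y Ly; apply: contrapT => ny; apply: h; exists y.
  have [a [k [Kk eqy]]] := gen y (LN _ Ly).
  have na : ~ m a by move=> /mx Kax; apply: ny; rewrite eqy; apply: smD.
  have [b [c [mc eq1]]] := maximal_idealP na.
  have Lx : L x.
    have -> : x = b *: (a *: x) + c *: x by rewrite scalerA -scalerDl eq1 scale1r.
    apply: smD; last exact/KL/mx.
    apply: smZ; have -> : a *: x = y - k by rewrite eqy addrK.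
    by apply: smB => //; apply: KL.
  by move=> v /gen[a' [k' [Kk' ->]]]; apply: smD; [exact: smZ | exact: KL].
exists 1%N => k; suff h N' : chain K N' k -> N' `<=` N -> (k <= 1)%N by move=> /h; apply.
case=> [//|N1 N2 k1 c]; case: c => [//|N0 {}N1 k2 c lt01 [sub12 nsub12] subN].
have [sub01 nsub01] := lt01; exfalso; apply: nsub12.
have K1 : K `<=` N1 by move=> z /(chain_sub c) /sub01.
have nK1 : ~ (N1 `<=` K) by move=> h; apply: nsub01 => z /h; apply: chain_sub c _.
by move=> z /subN; apply: simple => // w /sub12 /subN.
Qed.

(** Adding the generators of N to m N one at a time gives a filtration whose steps are those of
    [finlen_cyclic]. *)
Lemma finlen_mulm (N : submod V) : sm_fg N -> finlen N (mulm m N).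
Proof.
move=> [s eqs]; set K := mulm m N.
suff h (t : seq V) : {subset t <= s} -> finlen (addm K (spanm [set` t])) K.
  have := h s (fun _ => id); rewrite -eqs; apply: finlenS => //; exact: addm_inr.
elim: t => [_|x t IH sub].
  apply: finlenS (finlenxx K) => // v [y [z [Ky /spanm_nil -> ->]]].
  by rewrite addr0.
have xN : N x by rewrite eqs; apply: subset_spanm; apply: sub; apply: mem_head.
have le : addm K (spanm [set` t]) `<=` addm K (spanm [set` x :: t]).
  by apply: addmS => //; apply: spanmS => z /= zt; rewrite inE zt orbT.
apply: (finlen_add (addm_inl _) le); last first.
  by apply: IH => y yt; apply: sub; rewrite inE yt orbT.
apply: (@finlen_cyclic _ _ x).
  move=> v [k [z [Kk /spanm_cons[a [y [ty ->]]] ->]]]; exists a, (k + y).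
  by split; [exists k, y | rewrite addrCA].
by move=> a ma; apply: addm_inl; apply: mulm_gen.
Qed.

Lemma finlen_pow (N : submod V) k : noeth_mod V -> finlen N (iter k (mulm m) N).
Proof.
move=> hV; elim: k => [|k IH]; first exact: finlenxx.
apply: finlen_add IH _; first exact: mulm_subr.
  by elim: k => //= k IH x /mulm_subr /IH.
exact: finlen_mulm.
Qed.

End FiniteLength.
End MaximalIdeal.

(** * Prime ideals over a regular sequence *)

Section Primes.
Context {A : comNzRingType}.
Hypothesis noethA : noetherian A.

Lemma idealM (J : submod A^o) (a b : A) : J b -> J (a * b).
Proof. exact: smZ. Qed.

(** An ideal maximal among those that contain J and avoid the multiplicative set S is prime: if
    neither x nor y lies in it, enlarging it by either one makes it meet S, and the product of the
    two elements found would lie in it together with x y. *)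
Lemma prime_avoiding (J : submod A^o) (S : set A) :
  S 1 -> (forall x y, S x -> S y -> S (x * y)) -> (forall x, J x -> ~ S x) ->
  exists P, [/\ prime_ideal P, J `<=` P & forall x, P x -> ~ S x].
Proof.
move=> S1 SM JS.
have [P [JP PS] Pmax] : exists2 P : submod A^o, J `<=` P /\ (forall x, P x -> ~ S x) &
    forall N : submod A^o, J `<=` N /\ (forall x, N x -> ~ S x) -> P `<=` N -> N `<=` P.
  apply: (noeth_max (P := fun P => J `<=` P /\ forall x, P x -> ~ S x)); last by exists J; split.
  exact: noeth_regular.
exists (P : set A); split=> //; split; first exact: submod_setP; first by move/PS; apply.
move=> x y Pxy; apply: contrapT => /not_orP[nx ny].
have meet (z : A) : ~ P z -> exists p a : A, P p /\ S (a * z + p).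
  move=> nz; apply: contrapT => h; apply: nz.
  have sub : P `<=` addm (scalem z (fullm : submod A^o)) P by apply: addm_inr.
  apply: (Pmax (addm (scalem z (fullm : submod A^o)) P) _ sub).
    split=> [w /JP /sub//|w [_ [p [[a _ <-] Pp ->]]]] Sw.
    by apply: h; exists p, a; split=> //; rewrite mulrC.
  by apply: addm_inl; exists (1 : A^o) => //; apply: mulr1.
have [p [a [Pp Sp]]] := meet x nx; have [q [b [Pq Sq]]] := meet y ny.
apply: (PS _ _ (SM _ _ Sp Sq)).
rewrite mulrDl mulrDr -addrA mulrACA; apply: (smD (N := P)); first exact: idealM.
by apply: (smD (N := P)); [exact: idealM | rewrite mulrC; apply: idealM].
Qed.

Lemma proper_in_maximal (P : set A) : ideal P -> ~ P 1 ->
  exists2 M, maximal_ideal M & P `<=` M.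
Proof.
move=> hP nP1.
pose proper_over (M : submod A^o) : Prop := P `<=` M /\ ~ M 1.
have [|M [PM nM1] Mmax] := noeth_max (P := proper_over) (noeth_regular noethA).
  by exists (Submod hP); split.
exists (M : set A) => //; split=> //; first exact: submod_setP.
move=> J hJ MJ; have [J1|nJ1] := pselect (J 1).
  right; apply/seteqP; split=> // a _.
  by have := idealM (J := Submod hJ) a J1; rewrite mulr1.
left; apply/seteqP; split=> //.
by apply: (Mmax (Submod hJ)) => //; split=> // x /PM /MJ.
Qed.

Section RegularSequence.
Variables (m : set A) (d : nat) (s : seq A).
Hypotheses (localm : local_ring m) (dimd : krull_dim A d).
Hypotheses (s_reg : regular_seq A^o s) (s_size : size s = d).

Definition gen_ideal (t : seq A) : submod A^o := mulm [set` t] fullm.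

Lemma gen_ideal_mem t a : a \in t -> gen_ideal t a.
Proof. by move=> ta; rewrite -[a]mulr1; apply: (mulm_gen (N := fullm) (x := 1 : A^o)). Qed.

Lemma gen_ideal_sub t (P : submod A^o) : (forall a, a \in t -> P a) -> gen_ideal t `<=` P.
Proof.
by move=> tP; apply: mulm_sub => a x ta _; rewrite [_ *: _]mulrC; apply/idealM/tP.
Qed.

(** The prime Q is chosen to avoid all [u * x ^+ k] with u outside P. These miss the ideal of the
    first i terms, since x can be cancelled modulo it and the ideal lies in P. The case k = 0 puts Q
    inside P, and x itself is not in Q. *)
Lemma prime_descent i (P : set A) : (i < size s)%N -> prime_ideal P ->
  [set` take i.+1 s] `<=` P ->
  exists Q, [/\ prime_ideal Q, [set` take i s] `<=` Q & Q `<` P].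
Proof.
move=> si [hP nP1 primeP] sP; set x := s`_i.
have Px : P x by apply: sP; rewrite /= (take_nth 0) // mem_rcons mem_head.
have JP : gen_ideal (take i s) `<=` P.
  apply: (gen_ideal_sub (P := Submod hP)) => a ta; apply: sP.
  by rewrite /= (take_nth 0) // mem_rcons inE ta orbT.
have [reg _] := s_reg.
have [Q [primeQ JQ QS]] : exists Q, [/\ prime_ideal Q, gen_ideal (take i s) `<=` Q &
    forall y, Q y -> ~ exists u k, ~ P u /\ y = u * x ^+ k].
  apply: prime_avoiding; first by exists 1, 0%N; rewrite mulr1.
    move=> y y' [u [k [nu ->]]] [u' [k' [nu' ->]]]; exists (u * u'), (k + k')%N.
    by split; [move/primeP => -[] | rewrite mulrACA exprD].
  move=> y + [u [k [nu eqy]]]; rewrite {}eqy; elim: k => [|k IH]; first by rewrite mulr1 => /JP.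
  move=> h; apply: IH; apply: (reg i) => //.
  have <- : u * x ^+ k.+1 = s`_i *: (u * x ^+ k : A^o) by rewrite exprS mulrCA.
  exact: h.
exists Q; split=> //; first by move=> a ta; exact: (JQ _ (gen_ideal_mem ta)).
split=> [y Qy|PQ]; last by apply: (QS _ (PQ _ Px)); exists 1, 1%N; rewrite mul1r expr1.
by apply: contrapT => nPy; apply: (QS _ Qy); exists y, 0%N; rewrite mulr1.
Qed.

(** Iterated descent: a prime over the first i terms has height at least i. *)
Lemma prime_chain_regular i (P : set A) : (i <= size s)%N -> prime_ideal P ->
  [set` take i s] `<=` P -> exists C : nat -> set A,
    [/\ forall j, (j <= i)%N -> prime_ideal (C j),
        forall j, (j < i)%N -> C j `<` C j.+1 & C i = P].
Proof.
elim: i P => [|i IH] P si primeP sP; first by exists (fun=> P).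
have [Q [primeQ sQ ltQP]] := prime_descent si primeP sP.
have [C [hC ltC eqC]] := IH Q (ltnW si) primeQ sQ.
exists (fun j => if (j <= i)%N then C j else P); split.
- by move=> j _; case: ifP => [/hC|].
- move=> j; rewrite ltnS => ji; rewrite ji; case: (ltnP j i) => [/ltC//|ij].
  have -> : j = i by lia.
  by rewrite eqC.
- by rewrite ltnn.
Qed.

(** A prime over s lies at the top of a chain of length d; if it were properly contained in m,
    adding m would give a chain of length d + 1. *)
Lemma prime_over_regular (P : set A) : prime_ideal P -> [set` s] `<=` P -> P = m.
Proof.
move=> primeP sP; have [hP nP1 _] := primeP; have [_ maxm uniqm] := localm.
have [M /uniqm -> Pm] := proper_in_maximal hP nP1.
apply: contrapT => neP.
have [||C [hC ltC eqC]] := @prime_chain_regular (size s) P _ primeP.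
- by [].
- by rewrite take_size.
suff /(proj2 dimd) : prime_chain A d.+1 by rewrite ltnn.
exists (fun j => if (j <= d)%N then C j else m); split.
  by move=> j _; case: ifP => [|_]; [rewrite -s_size => /hC | exact: maximal_prime].
move=> j; rewrite ltnS => jd; rewrite jd; case: (ltnP j d) => [|dj].
  by rewrite -s_size => /ltC.
have -> : j = size s by lia.
by rewrite eqC; split=> // mP; apply: neP; apply/seteqP.
Qed.

(** Otherwise some prime over s would avoid the powers of y, yet m is the only prime over s. *)
Lemma regular_radical y : m y -> exists k : nat, gen_ideal s (y ^+ k).
Proof.
move=> my; apply: contrapT => h.
have [P [primeP sP PS]] : exists P, [/\ prime_ideal P, gen_ideal s `<=` P &
    forall x, P x -> ~ exists k : nat, x = y ^+ k].
  apply: prime_avoiding; first by exists 0%N.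
    by move=> z z' [k ->] [k' ->]; exists (k + k')%N; rewrite exprD.
  by move=> z sz [k eqz]; apply: h; exists k; rewrite -eqz.
apply: (PS y); last by exists 1%N.
by rewrite (prime_over_regular primeP) // => a /gen_ideal_mem /sP.
Qed.

End RegularSequence.
End Primes.

(** * Graded submodules and the Hilbert basis theorem *)

Section Graded.
Context {A : comNzRingType} {V : lmodType A}.
Implicit Types (N L D : nat -> submod V) (s : seq A).

(* A graded module is a pair of sequences L n `<=` N n of submodules of V, on
   which the variables act as multiplications by the elements of s; gnoeth says
   that its graded submodules D are generated in bounded degree. *)
Definition gnoeth s N L : Prop :=
  forall D, (forall n, L n `<=` D n) -> (forall n, D n `<=` N n) ->
  (forall n, mulm [set` s] (D n) `<=` D n.+1) ->
  exists n0, forall n, (n0 <= n)%N -> D n.+1 `<=` addm (mulm [set` s] (D n)) (L n.+1).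

Lemma gnoeth_restr s N N' L :
  (forall n, N' n `<=` N n) -> gnoeth s N (fun=> zerom) -> gnoeth s N' L.
Proof.
move=> N'N gN D LD DN sD; have [|n v /DN /N'N //|n0 h] := gN D _ _ sD.
  by move=> n _ ->; apply: sm0.
exists n0 => n /h DD v /DD; apply: addmS => // _ ->; exact: sm0.
Qed.

Lemma mulm_cons_l x s (M : submod V) v : M v -> mulm [set` x :: s] M (x *: v).
Proof. by move=> Mv; apply: mulm_gen => //=; apply: mem_head. Qed.

Lemma mulm_cons_r x s (M : submod V) : mulm [set` s] M `<=` mulm [set` x :: s] M.
Proof. by apply: mulmS => // a /= sa; rewrite inE sa orbT. Qed.

Lemma mulm_cons x s (M : submod V) v : mulm [set` x :: s] M v ->
  addm (scalem x M) (mulm [set` s] M) v.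
Proof.
move: v; apply: mulm_sub => a v xsa Mv.
have /orP[/eqP ->|sa] : (a == x) || (a \in s) by rewrite -in_cons.
  by apply: addm_inl; exists v.
by apply: addm_inr; apply: mulm_gen.
Qed.

Lemma scale_comb (a b : A) (u u' v v' : V) :
  b *: (a *: u + u' + (a *: v + v')) = a *: (b *: (u + v)) + b *: (u' + v').
Proof. by rewrite addrACA -scalerDr [LHS]scalerDr !scalerA [b * a]mulrC. Qed.

(** In degree n this is the sum of the [x ^+ i *: N (n - i)], the image in V of the degree n part of
    N[x]; [gtail] is the part divisible by x. The sum need not be direct, so coefficients are not
    well defined: below, a leading coefficient is one that occurs in some decomposition. *)
Fixpoint gext (x : A) N (n : nat) : submod V :=
  if n is n'.+1 then addm (N n) (scalem x (gext x N n')) else N 0%N.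

Definition gtail (x : A) N (n : nat) : submod V :=
  if n is n'.+1 then scalem x (gext x N n') else zerom.

Lemma gextP x N n g : gext x N n g -> exists w t, [/\ N n w, gtail x N n t & g = w + t].
Proof. by case: n => [|n] //= Ng; exists g, 0; rewrite addr0. Qed.

Lemma gext_scale x N n g : gext x N n g -> gext x N n.+1 (x *: g).
Proof. by move=> hg; apply: addm_inr; exists g. Qed.

Lemma gext_closed x y N : (forall n v, N n v -> N n.+1 (y *: v)) ->
  forall n v, gext x N n v -> gext x N n.+1 (y *: v).
Proof.
move=> yN; elim=> [|n IH] v; first by move=> /yN; apply: addm_inl.
move=> [w [_ [/yN Nw [g hg <-] ->]]]; rewrite scalerDr scalerA mulrC -scalerA.
by apply: smD; [exact: addm_inl | apply: gext_scale; apply: IH].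
Qed.

Lemma gtail_closed x y N : (forall n v, N n v -> N n.+1 (y *: v)) ->
  forall n v, gtail x N n v -> gtail x N n.+1 (y *: v).
Proof.
move=> yN [|n] v; first by move=> v0; rewrite [v]v0 scaler0; apply: sm0.
move=> [g hg <-]; exists (y *: g); first exact: (gext_closed yN).
by rewrite !scalerA mulrC.
Qed.

Section HilbertBasis.
Variables (x : A) (s : seq A) (N : nat -> submod V).
Hypotheses (noethV : noeth_mod V) (sN : forall n, mulm [set` s] (N n) `<=` N n.+1).
Hypothesis gN : gnoeth s N (fun=> zerom).

Let yN y : y \in s -> forall n v, N n v -> N n.+1 (y *: v).
Proof. by move=> sy n v Nv; apply: sN; apply: mulm_gen. Qed.

Section Initial.
Variable D : nat -> submod V.
Hypothesis DN : forall n, D n `<=` gext x N n.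
Hypothesis sD : forall n, mulm [set` x :: s] (D n) `<=` D n.+1.

Lemma init_subproof j k : submodule
  [set w | N k w /\ exists2 t, gtail x N k t & D (j + k)%N (x ^+ j *: (w + t))].
Proof.
apply/submoduleE; split.
  by split; [exact: sm0 | exists 0; rewrite ?addr0 ?scaler0; apply: sm0].
move=> a w w' [Nw [t ht Dt]] [Nw' [t' ht' Dt']]; split; first exact: smL.
exists (a *: t + t'); first exact: smL.
by rewrite scale_comb; apply: smL.
Qed.

(* The coefficients of x ^+ j of the elements of D (j + k) divisible by x ^+ j. *)
Definition init j k : submod V := Submod (init_subproof j k).

Let xD n v : D n v -> D n.+1 (x *: v).
Proof. by move=> Dv; apply: sD; apply: mulm_cons_l. Qed.

Let yD y n v : y \in s -> D n v -> D n.+1 (y *: v).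
Proof. by move=> sy Dv; apply: sD; apply: mulm_cons_r; apply: mulm_gen. Qed.

Lemma init_incr j k : init j k `<=` init j.+1 k.
Proof.
move=> w [Nw [t ht Dt]]; split=> //; exists t => //.
by rewrite addSn exprS -scalerA; apply: xD.
Qed.

Lemma init_mono i j k : (i <= j)%N -> init i k `<=` init j k.
Proof. by move/subnK <-; elim: (j - i)%N => // l IH w /IH /init_incr. Qed.

Lemma init_closed j k : mulm [set` s] (init j k) `<=` init j k.+1.
Proof.
apply: mulm_sub => y w sy [Nw [t ht Dt]]; split; first exact: yN.
exists (y *: t); first by apply: gtail_closed ht; apply: yN.
by rewrite -scalerDr scalerA mulrC -scalerA addnS; apply: yD.
Qed.

(** A combination of leading coefficients lifts to the same combination of elements of D; only the
    tail t changes. *)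
Lemma init_lift j k w : mulm [set` s] (init j k) w -> exists2 t, gtail x N k.+1 t &
  mulm [set` s] (D (j + k)%N) (x ^+ j *: (w + t)).
Proof.
have hS : submodule [set w | exists2 t, gtail x N k.+1 t &
    mulm [set` s] (D (j + k)%N) (x ^+ j *: (w + t))].
  apply/submoduleE; split; first by exists 0; rewrite ?addr0 ?scaler0; apply: sm0.
  move=> a v v' [t ht Dt] [t' ht' Dt']; exists (a *: t + t'); first exact: smL.
  by rewrite scale_comb; apply: smL.
move: w; apply: (mulm_sub (K := Submod hS)) => y w sy [Nw [t ht Dt]].
exists (y *: t); first by apply: gtail_closed ht; apply: yN.
by rewrite -scalerDr scalerA mulrC -scalerA; apply: mulm_gen.
Qed.

(** For each k the ascending chain in j stops at some [j0 k]. The stable terms form a graded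
    submodule of N, generated by its degrees up to some k0, so the maximum of the first k0 + 1
    values of j0 serves all k. *)
Lemma init_stable_j : exists J, forall j k, init j k `<=` init J k.
Proof.
have /boolp.choice[j0 hj0] k : exists j0, forall j, init j k `<=` init j0 k.
  by apply: (@noeth_acc _ _ (fun j => init j k)) => // j; apply: init_incr.
have [||n|k0 hk0] := gN (D := fun k => init (j0 k) k).
- by move=> n _ ->; apply: sm0.
- by move=> n w [].
- by move=> w /init_closed; apply: hj0.
exists (\max_(k < k0.+1) j0 k)%N => j k w /hj0 {j}.
elim: k w => [|k IH] w.
  by apply: init_mono; rewrite -[0%N]/(nat_of_ord (@ord0 k0)); apply: leq_bigmax.
case: (leqP k.+1 k0) => [kk0|k0k].
  have lt : (k.+1 < k0.+1)%N by [].
  by apply: init_mono; rewrite -[k.+1]/(nat_of_ord (Ordinal lt)); apply: leq_bigmax.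
move/(hk0 k k0k) => [w1 [_ [sw1 -> ->]]]; rewrite addr0.
by apply: init_closed; apply: mulmS sw1.
Qed.

Lemma init_stable_k J : exists K, forall j k, (j <= J)%N -> (K <= k)%N ->
  init j k.+1 `<=` mulm [set` s] (init j k).
Proof.
have /boolp.choice[k0 hk0] j : exists k0, forall k, (k0 <= k)%N ->
    init j k.+1 `<=` mulm [set` s] (init j k).
  have [||n|k0 hk0] := gN (D := init j).
  - by move=> n _ ->; apply: sm0.
  - by move=> n w [].
  - exact: init_closed.
  by exists k0 => k /hk0 h w /h [w1 [_ [sw1 -> ->]]]; rewrite addr0.
exists (\max_(j < J.+1) k0 j)%N => j k jJ Kk; apply: hk0; apply: leq_trans Kk.
by rewrite -[j]/(nat_of_ord (Ordinal (jJ : (j < J.+1)%N))); apply: leq_bigmax.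
Qed.

(** An element of D is reduced to zero by subtracting elements of the module generated from the
    preceding degree that have the same leading coefficient. The bound J + K ensures that in each
    degree n + 1 = i + k either i exceeds J or k exceeds K. *)
Lemma hilbert_stable : exists n0, forall n, (n0 <= n)%N ->
  D n.+1 `<=` mulm [set` x :: s] (D n).
Proof.
have [J hJ] := init_stable_j; have [K hK] := init_stable_k J.
exists (J + K)%N => n le_n v Dv.
(* The power of x split off so far is kept in front, and the degree k of the cofactor decreases. *)
suff key k i g : (i + k = n.+1)%N -> gext x N k g -> D n.+1 (x ^+ i *: g) ->
    mulm [set` x :: s] (D n) (x ^+ i *: g).
  by rewrite -[v]scale1r -(expr0 x); apply: (key n.+1) => //; rewrite ?scale1r //; apply: DN.
elim: k i g => [|k IH] i g ik gg Dg; have [w [t [Nw ht eqg]]] := gextP gg.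
  have [t' ht' Et'] : exists2 t', gtail x N 0 t' &
      mulm [set` x :: s] (D n) (x ^+ i *: (w + t')).
    have : init i 0 w by split=> //; exists t; rewrite // ik -eqg.
    move/hJ; have -> : i = n.+1 by lia.
    have Jn : (J <= n)%N by lia.
    move/(init_mono Jn) => [_ [t' ht' Dt']]; exists t' => //.
    by rewrite exprS -scalerA; apply: mulm_cons_l; rewrite addn0 in Dt'.
  (* In degree 0 both tails vanish, so that w + t' is g itself. *)
  by rewrite eqg; move: ht ht' Et' => /= -> ->.
have [t' ht' Et'] : exists2 t', gtail x N k.+1 t' &
    mulm [set` x :: s] (D n) (x ^+ i *: (w + t')).
  have : init i k.+1 w by split=> //; exists t; rewrite // ik -eqg.
  (* For small i the coefficient w comes from s times coefficients of lower degree; for large i it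
     already occurs with the exponent i - 1, and one multiplies by x. *)
  have [iJ|Ji] := leqP i J.
    have Kk : (K <= k)%N by lia.
    move/(hK _ _ iJ Kk) => /init_lift[t' ht' Et']; exists t' => //.
    have -> : n = (i + k)%N by lia.
    exact: mulm_cons_r.
  move/hJ; case: i ik Ji {Dg} => // i ik Ji.
  move/(init_mono (Ji : (J <= i)%N)) => [_ [t' ht' Dt']]; exists t' => //.
  rewrite exprS -scalerA; apply: mulm_cons_l.
  by have -> : n = (i + k.+1)%N by lia.
have [g' hg' eqg'] : gtail x N k.+1 (t - t') by apply: smB.
have eqd : x ^+ i *: g - x ^+ i *: (w + t') = x ^+ i.+1 *: g'.
  by rewrite -scalerBr eqg opprD addrACA subrr add0r -eqg' scalerA -exprSr.
apply: (sm_subK _ Et'); rewrite eqd; apply: IH => //; first by lia.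
by rewrite -eqd; apply: smB => //; apply: sD.
Qed.

End Initial.

Lemma gnoeth_gext : gnoeth (x :: s) (gext x N) (fun=> zerom).
Proof.
move=> D _ DN sD; have [n0 h] := hilbert_stable DN sD.
by exists n0 => n /h hn v /hn; apply: addm_inl.
Qed.

End HilbertBasis.

(* The Rees module: the sum over the monomials of degree n in s of their
   multiples of W, hence the power I ^ n W for the ideal I generated by s. *)
Fixpoint grees (W : submod V) s : nat -> submod V :=
  if s is x :: s' then gext x (grees W s') else fun n => if n is 0%N then W else zerom.

Lemma grees_closed W s n : mulm [set` s] (grees W s n) `<=` grees W s n.+1.
Proof.
elim: s n => [|x s IH] n; first by apply: mulm_sub.
apply: mulm_sub => y v /=; rewrite inE => /orP[/eqP ->|sy]; first exact: gext_scale.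
by apply: gext_closed => {}n {}v hv; apply: IH; apply: mulm_gen.
Qed.

Lemma gnoeth_grees W s : noeth_mod V -> gnoeth s (grees W s) (fun=> zerom).
Proof.
move=> hV; elim: s => [|x s IH] /=; last by apply: gnoeth_gext => //; apply: grees_closed.
by move=> D _ DN _; exists 0%N => n _ v /DN v0; rewrite [v]v0; apply: sm0.
Qed.

Lemma iter_grees W s n : iter n (mulm [set` s]) W `<=` grees W s n.
Proof.
elim: n => [|n IH] /=; first by elim: s => //= x s.
by move=> v hv; apply: grees_closed; apply: mulmS hv.
Qed.

Lemma gnoeth_iter W s L : noeth_mod V ->
  gnoeth s (fun n => iter n (mulm [set` s]) W) L.
Proof.
move=> hV; apply: (@gnoeth_restr s (grees W s)); first exact: iter_grees.
exact: gnoeth_grees.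
Qed.

(** The intersections of K with the powers form a graded submodule of the Rees module of W. From
    degree c on, each is contained in s times the preceding one, and the one in degree c lies in
    K. *)
Lemma artin_rees W s (K : submod V) : noeth_mod V -> exists c, forall n,
  capm K (iter (c + n) (mulm [set` s]) W) `<=` iter n (mulm [set` s]) K.
Proof.
move=> hV; pose D n := capm K (iter n (mulm [set` s]) W).
have [||n|c hc] := gnoeth_iter (W := W) (s := s) (L := fun=> zerom) hV (D := D).
- by move=> n _ ->; apply: sm0.
- by move=> n v [].
- apply: mulm_sub => y v sy [Kv hv]; split; first exact: smZ.
  by apply: mulm_gen.
exists c; elim=> [|n IH] /=; first by move=> v [].
rewrite addnS => v /(hc (c + n)%N (leq_addr _ _)) [w [_ [hw -> ->]]].
by rewrite addr0; apply: mulmS hw.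
Qed.

Lemma grees_sub W s n : grees W s n `<=` W.
Proof.
elim: s n => [[//|n] v v0|x s IH]; first by rewrite [v]v0; apply: sm0.
elim=> [|n IHn]; first exact: IH.
by move=> _ [w [_ [hw [g hg <-] ->]]]; apply: smD; [exact: IH hw | apply: smZ; apply: IHn].
Qed.

(** Pigeonhole by induction on s: a monomial of degree at least k1 + k2 has exponent at least k2 in
    x or degree at least k1 in the other variables. *)
Lemma iter_radical s (Q : submod A^o) : (forall y, y \in s -> exists k : nat, Q (y ^+ k)) ->
  exists k, forall W : submod V, iter k (mulm [set` s]) W `<=` mulm (Q : set A) W.
Proof.
move=> hQ; suff [k hk] : exists k, forall (W : submod V) n, (k <= n)%N ->
    grees W s n `<=` mulm (Q : set A) W.
  by exists k => W v /iter_grees; apply: hk.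
elim: s hQ => [|x s IH] hQ; first by exists 1%N => W [//|n] _ v v0; rewrite [v]v0; apply: sm0.
have [|k1 h1] := IH; first by move=> y sy; apply: hQ; rewrite inE sy orbT.
have [k2 h2] := hQ x (mem_head _ _); exists (k1 + k2)%N => W n le_n v hv.
have Qx i w : (k2 <= i)%N -> W w -> mulm (Q : set A) W (x ^+ i *: w).
  move=> /subnK <- Ww; apply: mulm_gen => //; rewrite exprD; exact: smZ.
(* The factors x met so far are collected in x ^+ i, until their number reaches k2. *)
suff key i : (k1 + k2 <= n + i)%N -> mulm (Q : set A) W (x ^+ i *: v).
  by have := key 0%N; rewrite addn0 scale1r; apply.
elim: n v {le_n} i hv => [|n IHn] v i.
  by move=> hv le_i; apply: Qx; [lia | exact: (@grees_sub W (x :: s) 0)].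
move=> [w [_ [hw [g hg <-] ->]]] le_n; rewrite scalerDr scalerA -exprSr.
apply: smD; last by apply: IHn => //; lia.
have [le_i|lt_i] := leqP k2 i; first by apply: Qx => //; apply: grees_sub hw.
by apply: smZ; apply: h1 hw; lia.
Qed.

End Graded.

(** * Eventually polynomial functions *)

Section DifferencePolynomial.
Context {R : realType}.
Implicit Types f g : nat -> R.

Definition delta f : nat -> R := fun n => f n.+1 - f n.

(* Eventually equal to a polynomial of degree < k. *)
Definition dpoly k f : Prop := exists n0, forall n, (n0 <= n)%N -> iter k delta f n = 0.

Lemma iter_deltaB k f g n :
  iter k delta (fun n => f n - g n) n = iter k delta f n - iter k delta g n.
Proof.
elim: k n => [|k IH] n //=; rewrite /delta !IH; ring.
Qed.

Lemma iter_deltaS k f n : iter k delta (fun n => f n.+1) n = iter k delta f n.+1.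
Proof. by elim: k n => [|k IH] n //=; rewrite /delta !IH. Qed.

Lemma iter_deltaZ k (c : R) f n :
  iter k delta (fun n => c * f n) n = c * iter k delta f n.
Proof. by elim: k n => [|k IH] n //=; rewrite /delta !IH mulrBr. Qed.

Lemma dpoly_delta k f : dpoly k (delta f) <-> dpoly k.+1 f.
Proof. by split=> -[n0 h]; exists n0 => n /h; rewrite iterSr. Qed.

Lemma dpolyB k f g : dpoly k f -> dpoly k g -> dpoly k (fun n => f n - g n).
Proof.
move=> [a ha] [b hb]; exists (maxn a b) => n le_n.
by rewrite iter_deltaB ha ?hb ?subrr //; lia.
Qed.

Lemma dpolyS k f : dpoly k f -> dpoly k.+1 f.
Proof. by move=> [a ha]; exists a => n le_n /=; rewrite /delta !ha ?subrr //; lia. Qed.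

Lemma dpoly_ext k f g : f =1 g -> dpoly k f -> dpoly k g.
Proof. by move=> /funext ->. Qed.

Lemma dpoly_shift k f : dpoly k (fun n => f n.+1) <-> dpoly k f.
Proof.
split=> -[a ha]; exists a.+1 => n le_n; last by rewrite iter_deltaS; apply: ha; lia.
have -> : n = n.-1.+1 by lia.
by rewrite -iter_deltaS; apply: ha; lia.
Qed.

Lemma dpoly_shiftn k f c : dpoly k (fun n => f (n + c)%N) <-> dpoly k f.
Proof.
elim: c => [|c IH]; first by split; apply: dpoly_ext => n; rewrite addn0.
rewrite -IH -(dpoly_shift k (fun n => f (n + c)%N)).
by split; apply: dpoly_ext => n; rewrite addnS.
Qed.

Definition bigO_pow k f : Prop :=
  exists C : R, exists n0, forall n, (n0 <= n)%N -> `|f n| <= C * n%:R ^+ k.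

Lemma bigO_pow_pos k f : bigO_pow k f -> exists2 C : R, 0 <= C & exists2 n0, (0 < n0)%N &
  forall n, (n0 <= n)%N -> `|f n| <= C * n%:R ^+ k.
Proof.
move=> [C [n0 h]]; exists `|C| => //; exists n0.+1 => // n le_n.
apply: le_trans (h n (ltnW le_n)) _; apply: ler_wpM2r; last exact: ler_norm.
by apply: exprn_ge0.
Qed.

(** Telescoping from n0: there are n - n0 differences, each at most C n^k, and the initial value is
    absorbed because n^(k+1) >= 1. *)
Lemma bigO_pow_delta k f : bigO_pow k (delta f) -> bigO_pow k.+1 f.
Proof.
move=> /bigO_pow_pos[C C0 [n0 n0_gt0 h]].
exists (`|f n0| + C), n0 => n le_n.
have : `|f n| <= `|f n0| + C * (n - n0)%:R * n%:R ^+ k.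
  elim: n le_n => [|n IH] le_n; first by rewrite sub0n mulr0 mul0r addr0; have -> : n0 = 0%N by lia.
  have [lt_n|] := leqP n0 n; last first.
    move=> lt; have -> : n0 = n.+1 by lia.
    by rewrite subnn mulr0 mul0r addr0.
  have -> : f n.+1 = f n + delta f n by rewrite /delta addrC subrK.
  apply: le_trans (ler_normD _ _) _.
  have := lerD (IH lt_n) (h n lt_n); move/le_trans; apply.
  rewrite -addrA lerD2l subSn // -natr1 mulrDr mulr1 mulrDl.
  have le_pow : (n%:R : R) ^+ k <= n.+1%:R ^+ k.
    by apply: lerXn2r; rewrite ?nnegrE // ler_nat.
  by apply: lerD; apply: ler_wpM2l => //; rewrite mulr_ge0.
move/le_trans; apply; rewrite mulrDl; apply: lerD.
  rewrite -[X in X <= _]mulr1; apply: ler_wpM2l => //.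
  by rewrite -natrX ler1n expn_gt0; lia.
rewrite -mulrA; apply: ler_wpM2l => //; rewrite exprS; apply: ler_wpM2r; first exact: exprn_ge0.
by rewrite ler_nat leq_subr.
Qed.

Lemma dpoly_bigO k f : dpoly k.+1 f -> bigO_pow k f.
Proof.
elim: k f => [|k IH] f; last by move/dpoly_delta/IH/bigO_pow_delta.
move=> [n0 h]; exists `|f n0|, n0 => n le_n; rewrite mulr1.
have -> : f n = f n0.
  rewrite -(subnK le_n) addnC; elim: (n - n0)%N => [|j IHj]; first by rewrite addn0.
  by rewrite addnS -IHj; apply/eqP; rewrite -subr_eq0; apply/eqP/h; lia.
by [].
Qed.

Lemma cvg_invn : (n%:R : R)^-1 @[n --> \oo] --> (0 : R).
Proof. by rewrite -cvg_shiftS; exact: cvg_harmonic. Qed.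

(** Induction by (k + 1) C(n, k + 1) = (n - k) C(n, k). *)
Lemma cvg_binomial k : 'C(n, k)%:R / n%:R ^+ k @[n --> \oo] --> (k`!%:R^-1 : R).
Proof.
elim: k => [|k IH].
  under eq_fun do rewrite bin0 mul1r invr1; rewrite invr1; exact: cvg_cst.
have E n : (0 < n)%N -> 'C(n, k.+1)%:R / n%:R ^+ k.+1 =
    'C(n, k)%:R / n%:R ^+ k * ((1 - k%:R * n%:R^-1) / k.+1%:R) :> R.
  move=> n0; have nz : (n%:R : R) != 0 by rewrite pnatr_eq0; lia.
  have kz : (k.+1%:R : R) != 0 by rewrite pnatr_eq0.
  (* For n < k both binomials vanish, while truncated subtraction would falsify the recurrence after
     the cast to R. *)
  have [le_kn|lt_nk] := leqP k n; last first.
    by rewrite !bin_small ?mul0r //; lia.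
  have : (k.+1%:R : R) * 'C(n, k.+1)%:R = (n%:R - k%:R) * 'C(n, k)%:R.
    by rewrite -natrM -natrB // -natrM mul_bin_left.
  move/(congr1 (fun z => z / k.+1%:R)); rewrite mulrAC mulfV // mul1r => ->.
  by rewrite exprS invfM; field; rewrite [1 + _]addrC natr1 kz nz expf_neq0.
have lim : 'C(n, k)%:R / n%:R ^+ k * ((1 - k%:R * n%:R^-1) / k.+1%:R) @[n --> \oo]
    --> k`!%:R^-1 * ((1 - k%:R * 0) / k.+1%:R : R).
  apply: cvgM => //; apply: cvgMl; apply: cvgB; first exact: cvg_cst.
  by apply: cvgMr; exact: cvg_invn.
have -> : (k.+1)`!%:R^-1 = k`!%:R^-1 * ((1 - k%:R * 0) / k.+1%:R) :> R.
  by rewrite mulr0 subr0 mul1r factS natrM invfM mulrC.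
apply: cvg_trans lim; apply: near_eq_cvg; near=> n.
by rewrite E //; near: n; exists 1%N.
Unshelve. all: by end_near. Qed.

Lemma bigO_pow_cvg0 k f : bigO_pow k f -> f n / n%:R ^+ k.+1 @[n --> \oo] --> (0 : R).
Proof.
move=> /bigO_pow_pos[C C0 [n0 n0_gt0 h]].
have lim : C * n%:R^-1 @[n --> \oo] --> (0 : R).
  by rewrite -(mulr0 C); apply: cvgMr; exact: cvg_invn.
apply/cvgr0Pnorm_le => e e0; move/cvgr0Pnorm_le/(_ e e0): lim => [n1 _ h1].
exists (maxn n0 n1) => // n /= le_n.
have le1 : (n1 <= n)%N by lia.
have le0 : (n0 <= n)%N by lia.
apply: le_trans _ (h1 n le1); rewrite /= !normrM (ger0_norm C0).
have nz : (n%:R : R) != 0 by rewrite pnatr_eq0; lia.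
rewrite exprS invfM normrM mulrCA [C * _]mulrC; apply: ler_wpM2l => //.
rewrite !normfV normrX normr_nat ler_pdivrMr; first exact: h.
by rewrite exprn_gt0 // ltr0n; lia.
Qed.

Lemma delta_binomial k : delta (fun n => 'C(n, k.+1)%:R) = fun n => 'C(n, k)%:R.
Proof. by apply/funext => n; rewrite /delta binS natrD addrAC subrr add0r. Qed.

Lemma iter_delta_binomial k n : iter k delta (fun n => 'C(n, k)%:R) n = 1.
Proof.
elim: k => [|k IH]; first by rewrite /= bin0.
by rewrite iterSr delta_binomial.
Qed.

Lemma dpoly_cvg0 k f : dpoly k f -> f n / n%:R ^+ k @[n --> \oo] --> (0 : R).
Proof.
case: k => [|k] df; last exact: bigO_pow_cvg0 (dpoly_bigO df).
case: df => n0 h; have lim : (0 : R) @[n --> \oo] --> (0 : R) by exact: cvg_cst.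
apply: cvg_trans lim; apply: near_eq_cvg.
by exists n0 => // n /= le_n; rewrite [f n]h // mul0r.
Qed.

(* The difference of order k is eventually a constant c, and f - c 'C(n, k) is of
   smaller degree. *)
Lemma dpoly_cvg k f : dpoly k.+1 f -> exists2 c : R,
  f n / n%:R ^+ k @[n --> \oo] --> c & (c = 0 -> dpoly k f).
Proof.
move=> [n0 h]; pose c := iter k delta f n0.
have cst n : (n0 <= n)%N -> iter k delta f n = c.
  move=> le_n; rewrite -(subnK le_n) addnC; elim: (n - n0)%N => [|j IH].
    by rewrite addn0.
  by rewrite addnS -IH; apply/eqP; rewrite -subr_eq0; apply/eqP/h; lia.
pose g n := f n - c * 'C(n, k)%:R.
have dg : dpoly k g.
  by exists n0 => n le_n; rewrite iter_deltaB iter_deltaZ iter_delta_binomial mulr1 cst // subrr.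
exists (c * k`!%:R^-1); last first.
  move/eqP; rewrite mulf_eq0 => /orP[/eqP c0|]; last first.
    by rewrite invr_eq0 pnatr_eq0 -leqn0 leqNgt fact_gt0.
  by exists n0 => n /cst ->.
have lim : g n / n%:R ^+ k + c * ('C(n, k)%:R / n%:R ^+ k) @[n --> \oo]
    --> 0 + c * k`!%:R^-1.
  apply: cvgD; first exact: dpoly_cvg0.
  by apply: cvgMr; exact: cvg_binomial.
rewrite add0r in lim; apply: cvg_trans lim; apply: near_eq_cvg; near=> n.
by rewrite mulrA -mulrDl subrK.
Unshelve. all: by end_near. Qed.

(** As long as r exceeds k, the growth bound makes f n / n^r tend to 0; this limit is the
    coefficient of degree r, so the degree drops. *)
Lemma dpoly_bigO_pow r k f : dpoly r f -> bigO_pow k f -> dpoly k.+1 f.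
Proof.
elim: r => [|r IH] dr fO.
  by elim: {fO}k.+1 => // j; apply: dpolyS.
have [le_rk|lt_kr] := leqP r k.
  by rewrite -(subnK le_rk) -addnS; elim: (k - r)%N => // j; apply: dpolyS.
have [c lim hc] := dpoly_cvg dr; apply: IH => //; apply: hc.
have {}fO : bigO_pow r.-1 f.
  have [C C0 [n0 n0_gt0 h]] := bigO_pow_pos fO; exists C, n0 => n le_n.
  apply: le_trans (h n le_n) _; apply: ler_wpM2l => //.
  by apply: ler_weXn2l; [rewrite ler1n; lia | lia].
have : f n / n%:R ^+ r @[n --> \oo] --> (0 : R).
  by rewrite -(ltn_predK lt_kr); apply: bigO_pow_cvg0.
by move=> lim0; apply: cvg_unique lim lim0.
Qed.

End DifferencePolynomial.

(** * Hilbert-Serre theorem and growth of Tor *)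

Section HilbertSerre.
Context {R : realType} {A : comNzRingType} {V : lmodType A}.
Implicit Types (N L : nat -> submod V) (s : seq A) (W : submod V).

Lemma finlen_scale (x : A) (N M K L : submod V) :
  M `<=` N -> L `<=` K -> finlen N M ->
  (forall v, N v -> K (x *: v)) -> (forall v, N v -> M v <-> L (x *: v)) ->
  (forall v, K v -> exists w, N w /\ L (v - x *: w)) ->
  len N M = len K L.
Proof. by move=> MN LK fin h1 h2 h3; case: (len_iso (f := GRing.scale x) MN LK h1 h2 h3 fin). Qed.

(* Multiplication by the last variable has a kernel and a cokernel that are
   finitely generated graded modules over the other variables. *)
Theorem hilbert_serre s N L :
  (forall n, L n `<=` N n) -> (forall n, finlen (N n) (L n)) ->
  (forall n, mulm [set` s] (N n) `<=` N n.+1) ->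
  (forall n, mulm [set` s] (L n) `<=` L n.+1) ->
  gnoeth s N L -> dpoly (size s) (fun n => (len (N n) (L n))%:R : R).
Proof.
elim: s N L => [|x s IH] N L LN fin sN sL gN.
  have [n0 h] := gN N LN (fun _ _ => id) sN; exists n0.+1 => n le_n /=.
  have eqn : n = n.-1.+1 by lia.
  suff -> : N n = L n by rewrite len_xx.
  apply: submod_eq => //; rewrite eqn => v /h [|w [u [hw Lu ->]]]; first by lia.
  by apply: smD => //; move: w hw; apply: mulm_sub.
have xN n v : N n v -> N n.+1 (x *: v) by move=> Nv; apply: sN; apply: mulm_cons_l.
have xL n v : L n v -> L n.+1 (x *: v) by move=> Lv; apply: sL; apply: mulm_cons_l.
have sN' n : mulm [set` s] (N n) `<=` N n.+1 by move=> v /mulm_cons_r /sN.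
have sL' n : mulm [set` s] (L n) `<=` L n.+1 by move=> v /mulm_cons_r /sL.
(* K / L is the kernel of multiplication by x on N / L, and N / C is its cokernel; in degree 0
   nothing is hit, so C 0 is L 0. *)
pose K n := capm (N n) (prem (GRing.scale x) (L n.+1)).
pose C n := if n is n'.+1 then addm (scalem x (N n')) (L n) else L 0%N.
have LK n : L n `<=` K n by move=> v Lv; split; [exact: LN | exact: xL].
have KN n : K n `<=` N n by move=> v [].
have LC n : L n `<=` C n by case: n => [//|n]; apply: addm_inr.
have CN n : C n `<=` N n.
  case: n => [|n]; first exact: LN.
  by apply: addm_sub => [_ [v Nv <-]|]; [exact: xN | exact: LN].
have yclosed y (M M' : submod V) : y \in s ->
    mulm [set` s] M `<=` M' -> forall v, M v -> M' (y *: v).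
  by move=> sy h v Mv; apply: h; apply: mulm_gen.
have hK : dpoly (size s) (fun n => (len (K n) (L n))%:R : R).
  apply: IH => //.
  - by move=> n; apply: finlenS (fin n).
  - move=> n; apply: mulm_sub => y v sy [Nv Lv]; split; first exact: (yclosed y _ _ sy (sN' n)).
    by rewrite /= scalerA mulrC -scalerA; apply: (yclosed y _ _ sy (sL' n.+1)).
  (* As D lies in K, x sends D into L; a bound on the degrees of generators over x :: s is thus one
     over s. *)
  - move=> D LD DK sD; have [||n|n0 h] := gN D => //.
    + by move=> n v /DK /KN.
    + move=> v /mulm_cons [_ [u [[w Dw <-] hu ->]]]; apply: smD; last exact: sD.
      by apply: LD; have [] := DK _ _ Dw.
    + exists n0 => n le_n v /(h n le_n) [z [u [+ Lu ->]]].
      move=> /mulm_cons [_ [u' [[w Dw <-] hu' ->]]].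
      rewrite [x *: w + u']addrC -addrA; exists u', (x *: w + u); split=> //.
      by apply: smD => //; have [] := DK _ _ Dw.
have hC : dpoly (size s) (fun n => (len (N n) (C n))%:R : R).
  apply: IH => //.
  - by move=> n; apply: finlenS (fin n).
  - case=> [|n]; first by move=> v /sL' /LC.
    apply: mulm_sub => y v sy [_ [u [[w Nw <-] Lu ->]]]; rewrite scalerDr; apply: smD.
      rewrite scalerA mulrC -scalerA; apply: addm_inl; exists (y *: w) => //.
      exact: (yclosed y _ _ sy (sN' n)).
    by apply: LC; apply: (yclosed y _ _ sy (sL' n.+1)).
  - move=> D CD DN sD; have [||n|n0 h] := gN D => //.
    + by move=> n v /LC /CD.
    + move=> v /mulm_cons [_ [u [[w Dw <-] hu ->]]]; apply: smD; last exact: sD.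
      by apply: CD; apply: addm_inl; exists w => //; apply: DN.
    + exists n0 => n le_n v /(h n le_n) [z [u [+ Lu ->]]].
      move=> /mulm_cons [_ [u' [[w Dw <-] hu' ->]]].
      rewrite [x *: w + u']addrC -addrA; exists u', (x *: w + u); split=> //.
      apply: smD; last exact: LC.
      by apply: addm_inl; exists w => //; apply: DN.
(* By the exact sequence of multiplication by x, the difference of the lengths is the length of the
   cokernel in degree n + 1 minus that of the kernel in degree n. *)
apply/dpoly_delta; apply: dpoly_ext (dpolyB (proj2 (dpoly_shift _ _) hC) hK) => n.
rewrite /delta (len_add (LC n.+1) (CN n.+1)) // (len_add (LK n) (KN n)) // !natrD.
suff -> : len (C n.+1) (L n.+1) = len (N n) (K n) by ring.
apply/esym/(finlen_scale (x := x)) => //.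
- by apply: finlenS (fin n).
- by move=> v Nv; apply: addm_inl; exists v.
- by move=> v Nv; split=> [[]|Lv].
- move=> _ [_ [u [[w Nw <-] Lu ->]]]; exists w; split=> //.
  by rewrite addrC addrA addNr add0r.
Qed.

Lemma iter_mulm_sub J W n : iter n (mulm J) W `<=` W.
Proof. by elim: n => //= n IH v /mulm_subr /IH. Qed.

Section Powers.
Variable J : set A.
Hypothesis finJ : forall W, finlen W (mulm J W).

Lemma finlen_iter W n k : finlen (iter n (mulm J) W) (iter (n + k) (mulm J) W).
Proof.
elim: k => [|k IH]; first by rewrite addn0; apply: finlenxx.
rewrite addnS; apply: (finlen_add (K := iter (n + k) (mulm J) W)) => //.
- exact: mulm_subr.
- by rewrite addnC iterD; apply: iter_mulm_sub.
Qed.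

Lemma len_iterS W n k : len (iter n (mulm J) W) (iter (n + k.+1) (mulm J) W) =
  (len (iter n (mulm J) W) (iter (n + k) (mulm J) W) +
   len (iter (n + k) (mulm J) W) (iter (n + k).+1 (mulm J) W))%N.
Proof.
rewrite addnS; apply: len_add; first exact: mulm_subr.
  by rewrite addnC iterD; apply: iter_mulm_sub.
by have := finlen_iter W n k.+1; rewrite addnS.
Qed.

(** The Hilbert-Samuel function: its difference is the Hilbert function of the associated graded
    module, to which [hilbert_serre] applies. *)
Lemma dpoly_iter W (s : seq A) : noeth_mod V ->
  (forall W', mulm J W' = mulm [set` s] W') ->
  dpoly (size s).+1 (fun n => (len W (iter n (mulm J) W))%:R : R).
Proof.
move=> hV eqJ; have {}eqJ : mulm J = mulm [set` s] :> (submod V -> submod V).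
  exact/funext.
apply/dpoly_delta.
apply: (dpoly_ext (f := fun n => (len (iter n (mulm J) W) (iter n.+1 (mulm J) W))%:R)).
  by move=> n; rewrite /delta (len_iterS W 0 n) /= add0n natrD addrAC subrr add0r.
apply: hilbert_serre => [n|n|n|n|].
- exact: mulm_subr.
- by have := finlen_iter W n 1; rewrite addn1.
- by rewrite -eqJ.
- by rewrite -eqJ.
- by rewrite eqJ; apply: gnoeth_iter.
Qed.

End Powers.
End HilbertSerre.

(** * Growth of the length of Tor *)

Section TorGrowth.
Context {R : realType} {A : comNzRingType}.
Variables (m : set A) (d : nat) (I : set A) (F : int -> set A).
Hypotheses (localm : local_ring m) (CMm : cohen_macaulay m) (dimd : krull_dim A d).
Hypotheses (primI : primary_to m I) (admF : admissible I F).

Let noethA : noetherian A. Proof. by case: localm. Qed.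
Let maxm : maximal_ideal m. Proof. by case: localm. Qed.

Lemma krull_dim_unique k : krull_dim A k -> k = d.
Proof.
move=> [c1 h1]; have [c2 h2] := dimd.
by apply/eqP; rewrite eqn_leq h1 // h2.
Qed.

Lemma parameters : exists2 s : seq A, size s = d & [set` s] `<=` m /\
  forall y, m y -> exists k : nat, gen_ideal s (y ^+ k).
Proof.
have [d' /krull_dim_unique -> [[s [sm s_reg s_size]] _]] := CMm.
exists s => //; split=> // y; exact: (regular_radical noethA localm dimd s_reg s_size).
Qed.

Lemma ideal_gens (J : set A) : ideal J -> exists s : seq A,
  [set` s] `<=` J /\ forall V (W : submod V), mulm J W = mulm [set` s] W.
Proof.
move=> hJ; have [s eqs] := noethA hJ; exists s; split.
  by rewrite -eqs; apply: (@subset_spanm A A^o).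
by move=> V W; rewrite -eqs -spanmE mulm_spanm.
Qed.

Section Module.
Variable V : lmodType A.
Hypothesis noethV : noeth_mod V.
Implicit Type W : submod V.

(** As m is finitely generated, some power m^k has m^k W inside J W, and W / m^k W has finite
    length. *)
Lemma finlen_radical (J : set A) W : ideal J ->
  (forall y, m y -> exists k : nat, J (y ^+ k)) -> finlen W (mulm J W).
Proof.
move=> hJ radJ; have hm : ideal m by case: maxm.
have [t [tm eqt]] := ideal_gens hm.
have [k hk] := iter_radical (V := V) (s := t) (Q := Submod hJ) (fun y ty => radJ y (tm y ty)).
apply: finlenS (finlen_pow maxm W k noethV) => //.
have -> : mulm m = mulm [set` t] :> (submod V -> submod V) by apply/funext => W'; apply: eqt.
exact: hk.
Qed.

Let idealI : ideal I. Proof. by case: primI => -[]. Qed.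

Let finI W : finlen W (mulm I W).
Proof. by apply: finlen_radical => // y; case: primI => _ <-. Qed.

(** The ideal of d parameters has a power inside I, so I^n W can be compared with powers of an ideal
    with d generators, for which Hilbert-Serre gives the exponent d. *)
Lemma bigO_iter W : bigO_pow d (fun n => (len W (iter n (mulm I) W))%:R : R).
Proof.
have [s s_size [sm s_rad]] := parameters.
have eqs (W' : submod V) : mulm (gen_ideal s : set A) W' = mulm [set` s] W'.
  apply: submod_eq; last by apply: mulmS => // a sa; apply: gen_ideal_mem.
  by move=> v /(mulm_ideal_mul (J' := setT)); rewrite mulm_setT.
have fins W' : finlen W' (mulm [set` s] W').
  by rewrite -eqs; apply: finlen_radical => //; apply: submod_setP.
have [a ha] : exists a, forall W', iter a (mulm [set` s]) W' `<=` mulm I W'.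
  apply: (iter_radical (Q := Submod idealI)) => y /sm; case: primI => _ <- [k hk].
  by exists k.
have hq := @dpoly_iter R _ _ _ fins W s noethV (fun=> erefl).
have [C C0 [n0 n0_gt0 h]] := bigO_pow_pos (dpoly_bigO hq).
(* The bound for the parameters is used at (a + 1) n; with a + 1 instead of a this index is at least
   n, hence at least n0, even when a = 0. *)
exists (C * a.+1%:R ^+ size s), n0 => n le_n.
have le_an : (n0 <= a.+1 * n)%N by rewrite mulSn; lia.
rewrite -mulrA -s_size -exprMn -natrM; apply: le_trans _ (h _ le_an).
rewrite !ger0_norm // ler_nat; apply: len_leS => // [||].
- elim: n {le_n le_an} => [|n IH]; first by rewrite muln0.
  rewrite mulnS iterD /= => v hv; apply: (mulmS (fun _ => id) IH).
  by apply: ha; apply: mulm_subr hv.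
- exact: iter_mulm_sub.
- by have := finlen_iter fins W 0 (a.+1 * n); rewrite add0n.
Qed.

Lemma dpoly_iterI W : dpoly d.+1 (fun n => (len W (iter n (mulm I) W))%:R : R).
Proof.
have [s [_ eqs]] := ideal_gens idealI.
by apply: dpoly_bigO_pow (bigO_iter W); apply: (dpoly_iter (R := R) finI W noethV (eqs V)).
Qed.

Lemma bigO_graded W : (0 < d)%N ->
  bigO_pow d.-1 (fun n => (len (iter n (mulm I) W) (iter n.+1 (mulm I) W))%:R : R).
Proof.
move=> d0; apply: dpoly_bigO; rewrite prednK //.
apply: dpoly_ext (proj2 (dpoly_delta _ _) (dpoly_iterI W)) => n.
by rewrite /delta (len_iterS finI W 0 n) /= add0n natrD addrAC subrr add0r.
Qed.

Lemma iter_admissible W n : iter n (mulm I) W `<=` mulm (F n%:Z) W.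
Proof.
have [_ powF _ _] := admF; suff h : iter n (mulm I) W `<=` mulm (ideal_pow I n) W.
  by move=> v /h; apply: mulmS => // a; apply: (powF n%:Z).
elim: n => [|n IH] /=; first by rewrite mulm_setT.
by move=> v hv; apply: mulm_comp; apply: mulmS hv.
Qed.

Lemma finlen_admissible W n : finlen W (mulm (F n%:Z) W).
Proof.
apply: finlenS (finlen_iter finI W 0 n) => //; exact: iter_admissible.
Qed.

Lemma admissible_iter : exists c : nat, forall W n,
  mulm (F (n + c)%N%:Z) W = iter n (mulm I) (mulm (F c%:Z) W).
Proof.
have [_ _ _ [n0 hF]] := admF; exists `|n0|%N => W; elim=> [|n IH]; first by rewrite add0n.
rewrite /= -IH hF; last by lia.
have -> : (n.+1 + `|n0|)%N%:Z - 1 = (n + `|n0|)%N%:Z by lia.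
apply: submod_eq; [exact: mulm_ideal_mul | exact: mulm_comp].
Qed.

Definition tor_len (J : set A) (K : submod V) : nat :=
  len (capm K (mulm J fullm)) (mulm J K).

(* By Artin-Rees K cap F_n V is contained in I ^ (n - c) K, so that the length
   is O(n ^ (d - 1)). *)
Lemma dpoly_tor K : (0 < d)%N -> dpoly d (fun n => (tor_len (F n%:Z) K)%:R : R).
Proof.
move=> d0; have [c hc] := admissible_iter.
have [s [_ eqs]] := ideal_gens idealI.
have eqI : mulm I = mulm [set` s] :> (submod V -> submod V) by apply/funext => W; apply: eqs.
(* Multiplication by I leads from F n onto F (n + 1) only from the index c on. *)
apply/(dpoly_shiftn _ _ c).
have fin n : finlen K (mulm (F n%:Z) K) by apply: finlen_admissible.
have sub n : mulm (F n%:Z) K `<=` capm K (mulm (F n%:Z) fullm).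
  by move=> v hv; split; [exact: mulm_subr hv | apply: mulmS hv].
have dr : dpoly (size s) (fun n => (tor_len (F (n + c)%N%:Z) K)%:R : R).
  apply: hilbert_serre => [n|n|n|n|].
  - exact: sub.
  - by apply: finlenS (fin (n + c)%N) => // v [].
  - rewrite -eqI => v hv; split; first by have [] := mulm_subr hv.
    rewrite hc /= -hc; by apply: mulmS hv => // x [].
  - by rewrite -eqI (hc K n.+1) /= -hc.
  (* By the choice of c, the intersection of K with F_(n+c) V lies in I^n F_c V, the degree n part
     of a Rees module. *)
  - apply: (@gnoeth_restr _ _ s (fun n => iter n (mulm [set` s]) (mulm (F c%:Z) fullm))).
      by move=> n v [_]; rewrite hc eqI.
    exact: gnoeth_iter.
rewrite -(prednK d0); apply: dpoly_bigO_pow dr _.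
have [c' hc'] := artin_rees (mulm (F c%:Z) fullm) s K noethV.
have [C C0 [n0 n0_gt0 h]] := bigO_pow_pos (bigO_graded K d0).
(* The numerator lies in I^(n-c') K by Artin-Rees and the denominator contains I^(n+c) K; e is the
   difference of these exponents. *)
pose e := (c' + c)%N.
have bound n k : (n0 <= n)%N -> (len (iter n (mulm I) K) (iter (n + k) (mulm I) K))%:R <=
    k%:R * (C * (n + k)%:R ^+ d.-1) :> R.
  move=> le_n; elim: k => [|k IH]; first by rewrite addn0 len_xx mul0r.
  rewrite len_iterS // natrD -natr1 mulrDl mul1r; apply: lerD.
    apply: le_trans IH _; apply: ler_wpM2l => //; apply: ler_wpM2l => //.
    by apply: lerXn2r; rewrite ?nnegrE // ler_nat; lia.
  have le_nk : (n0 <= n + k)%N by lia.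
  apply: le_trans (ler_norm _) _; apply: le_trans (h _ le_nk) _; apply: ler_wpM2l => //.
  by apply: lerXn2r; rewrite ?nnegrE // ler_nat; lia.
(* There are e graded pieces, each of length at most C (n - c' + e)^(d-1), and n - c' + e <= (e + 1)
   n. *)
exists (e%:R * (C * e.+1%:R ^+ d.-1)), (n0 + c' + e)%N => n le_n.
have eqn : n = (c' + (n - c'))%N by lia.
rewrite ger0_norm //; apply: (@le_trans _ _ (e%:R * (C * (n - c' + e)%:R ^+ d.-1))).
  apply: le_trans (bound (n - c')%N e _); last by lia.
  rewrite ler_nat; apply: len_leS.
  - by move=> v [Kv]; rewrite hc {1}eqn eqI => Fv; apply: hc'; split.
  - have -> : (n - c' + e)%N = (n + c)%N by lia.
    exact: iter_admissible.
  - exact: sub.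
  - exact: finlen_iter.
rewrite -!mulrA -exprMn -natrM; do 2!apply: ler_wpM2l => //.
apply: lerXn2r; rewrite ?nnegrE // ler_nat mulSn; nia.
Qed.

End Module.
End TorGrowth.

(** * The length of Tor *)

Section LinearMaps.
Context {A : comNzRingType}.

Lemma to_linear (U W : lmodType A) (f : U -> W) :
  linear f -> exists g : {linear U -> W}, forall x, g x = f x.
Proof.
move=> hf; pose g : {linear U -> W} := HB.pack f (GRing.isLinear.Build A U W _ f hf).
by exists g.
Qed.

(** Defines a map by its graph, for cases where an element has several decompositions that give the
    same value. *)
Lemma linear_of_rel (U W : lmodType A) (G : U -> W -> Prop) :
  (forall u, exists w, G u w) -> (forall u w w', G u w -> G u w' -> w = w') ->
  (forall a u u' w w', G u w -> G u' w' -> G (a *: u + u') (a *: w + w')) ->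
  exists h : {linear U -> W}, forall u, G u (h u).
Proof.
move=> /boolp.choice[h hG] uniqG linG.
have [|g hg] := @to_linear _ _ h; last by exists g => u; rewrite hg.
by move=> a u u'; apply: uniqG (hG _) _; apply: linG.
Qed.

Definition ker {U W : lmodType A} (f : {linear U -> W}) : submod U := prem f zerom.

Definition surj {U W : Type} (f : U -> W) : Prop := forall y, exists x, f x = y.

Definition projective (G : lmodType A) : Prop :=
  forall (U W : lmodType A) (p : {linear U -> W}) (f : {linear G -> W}),
  (forall x, exists u, p u = f x) -> exists g : {linear G -> U}, forall x, p (g x) = f x.

Lemma rV_sum_delta r (v : 'rV[A]_r) : v = \sum_i v 0 i *: delta_mx 0 i.
Proof. by rewrite {1}[v]matrix_sum_delta big_ord1. Qed.

Lemma rV_linear r (W : lmodType A) (u : 'I_r -> W) :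
  exists g : {linear 'rV[A]_r -> W}, forall v, g v = \sum_i v 0 i *: u i.
Proof.
apply: to_linear => a v w; rewrite scaler_sumr -big_split /=; apply: eq_bigr => i _.
by rewrite !mxE scalerDl scalerA.
Qed.

Lemma rV_linearE r (W : lmodType A) (f : {linear 'rV[A]_r -> W}) v :
  f v = \sum_i v 0 i *: f (delta_mx 0 i).
Proof.
by rewrite {1}(rV_sum_delta v) linear_sum; apply: eq_bigr => i _; rewrite linearZ.
Qed.

Lemma projective_rV r : projective 'rV[A]_r.
Proof.
move=> U W p f lift.
have /boolp.choice[u hu] (i : 'I_r) : exists u, p u = f (delta_mx 0 i) by apply: lift.
have [g hg] := rV_linear u; exists g => v.
rewrite hg linear_sum rV_linearE; apply: eq_bigr => i _; by rewrite linearZ hu.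
Qed.

Lemma projective_prod (G G' : lmodType A) :
  projective G -> projective G' -> projective (G * G')%type.
Proof.
move=> hG hG' U W p f lift.
have [i hi] : exists i : {linear G -> (G * G')%type}, forall x, i x = (x, 0).
  by apply: to_linear => a x y; congr pair; rewrite /= ?scaler0 ?addr0.
have [j hj] : exists j : {linear G' -> (G * G')%type}, forall x, j x = (0, x).
  by apply: to_linear => a x y; congr pair; rewrite /= ?scaler0 ?addr0.
have [x|g hg] := hG U W p (f \o i); first exact: lift.
have [x|g' hg'] := hG' U W p (f \o j); first exact: lift.
have [h hh] : exists h : {linear (G * G')%type -> U}, forall x, h x = g x.1 + g' x.2.
  by apply: to_linear => a x y; rewrite /= !linearP scalerDr addrACA.
exists h => -[x y]; rewrite hh linearD hg hg' /= -linearD hi hj.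
by congr (f (_, _)); rewrite ?addr0 ?add0r.
Qed.

Lemma rV_cover (V : lmodType A) (N : submod V) : sm_fg N ->
  exists r (p : {linear 'rV[A]_r -> V}), forall x, N x <-> exists v, p v = x.
Proof.
move=> [s eqs]; have [p hp] := rV_linear (fun i : 'I_(size s) => s`_i).
exists (size s), p => x; split=> [Nx|[v <-]]; last first.
  rewrite hp eqs; apply: sm_sum => i _; apply: smZ; apply: subset_spanm.
  by rewrite /= mem_nth.
suff : N `<=` imm p fullm by move=> /(_ _ Nx)[v _ eqv]; exists v.
rewrite eqs; apply: spanm_sub => _ /(nthP 0)[i si <-].
exists (delta_mx 0 (Ordinal si)) => //; rewrite hp (bigD1 (Ordinal si)) //= mxE !eqxx scale1r.
by rewrite big1 ?addr0 // => j /negPf nj; rewrite mxE eqxx nj scale0r.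
Qed.

Lemma fin_gen_cover (M : lmodType A) : fin_gen M ->
  exists r (p : {linear 'rV[A]_r -> M}), surj p.
Proof.
move=> [s eqs]; have [|r [p hp]] := @rV_cover M fullm; last by exists r, p => y; apply/hp.
by exists s; apply: submod_eq => x; rewrite spanmE eqs.
Qed.

Lemma fin_gen_imm (U W : lmodType A) (f : {linear U -> W}) : surj f -> fin_gen U -> fin_gen W.
Proof.
move=> fsurj [s eqs]; exists (map f s); apply/seteqP; split=> // y _.
have [x <-] := fsurj y; have : [set: U] x by [].
rewrite -eqs; apply: (spanm_sub (N := prem f (spanm [set` map f s]))) => z zs.
by apply: subset_spanm; apply/mapP; exists z.
Qed.

Lemma fin_gen_rV r : fin_gen 'rV[A]_r.
Proof.
exists [seq delta_mx 0 i | i : 'I_r]; apply/seteqP; split=> // v _.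
rewrite [v]rV_sum_delta -spanmE; apply: sm_sum => i _; apply: smZ; apply: subset_spanm.
by apply/mapP; exists i; rewrite ?mem_enum.
Qed.

Lemma fin_gen_prod (U W : lmodType A) : fin_gen U -> fin_gen W -> fin_gen (U * W)%type.
Proof.
move=> /fin_gen_cover[r [p hp]] /fin_gen_cover[r' [p' hp']].
have [f hf] : exists f : {linear 'rV[A]_(r + r') -> (U * W)%type},
    forall v, f v = (p (lsubmx v), p' (rsubmx v)).
  by apply: to_linear => a v w; rewrite !linearP.
apply: (@fin_gen_imm _ _ f); last exact: fin_gen_rV.
move=> [x y]; have [v <-] := hp x; have [w <-] := hp' y.
by exists (row_mx v w); rewrite hf row_mxKl row_mxKr.
Qed.

End LinearMaps.

(** * Independence of the projective cover *)

Section TorLength.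
Context {A : comNzRingType}.
Variable J : set A.

Lemma mulm_sub_tor (V : lmodType A) (K : submod V) : mulm J K `<=` capm K (mulm J fullm).
Proof. by move=> v hv; split; [exact: mulm_subr hv | apply: mulmS hv]. Qed.

Section Independence.
Variables (M G G' : lmodType A) (p : {linear G -> M}) (p' : {linear G' -> M}).
Hypotheses (projG : projective G) (projG' : projective G') (psurj : surj p) (psurj' : surj p').

(** Lift the identity of M to phi and psi in both directions. Then psi phi - id maps G into ker p,
    hence J G into J ker p, and so phi is injective on the classes modulo J ker p. *)
Lemma tor_inj_subproof : exists phi : {linear G -> G'},
  (forall x, capm (ker p) (mulm J fullm) x -> capm (ker p') (mulm J fullm) (phi x)) /\
  (forall x, capm (ker p) (mulm J fullm) x -> mulm J (ker p') (phi x) -> mulm J (ker p) x).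
Proof.
have [phi hphi] := projG (f := p) (fun x => psurj' (p x)).
have [psi hpsi] := projG' (f := p') (fun x => psurj (p' x)).
exists phi; split=> x [Kx Jx].
  split; first by rewrite /ker /= hphi.
  by apply: mulm_map Jx.
move=> Jphi; have Jpp : mulm J (ker p) (psi (phi x)).
  by apply: mulm_map Jphi => y Ky; rewrite /ker /= hpsi.
apply: (sm_subK (y := psi (phi x))) => //; rewrite -opprB; apply: smN.
apply: (mulm_map (f := (psi \o phi) \- idfun) _ Jx) => y _.
by rewrite /ker /= linearB /= hpsi hphi subrr.
Qed.

End Independence.

(** Injections in both directions between modules of finite length force equal lengths. *)
Lemma tor_len_unique (M G G' : lmodType A) (p : {linear G -> M}) (p' : {linear G' -> M}) :
  projective G -> projective G' -> surj p -> surj p' ->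
  finlen (capm (ker p) (mulm J fullm)) (mulm J (ker p)) ->
  tor_len J (ker p') = tor_len J (ker p) /\
  finlen (capm (ker p') (mulm J fullm)) (mulm J (ker p')).
Proof.
move=> hG hG' sp sp' fin.
have [phi [phi1 phi2]] := tor_inj_subproof hG hG' sp sp'.
have [psi [psi1 psi2]] := tor_inj_subproof hG' hG sp' sp.
have sub := @mulm_sub_tor _ (ker p); have sub' := @mulm_sub_tor _ (ker p').
have fin' := finlen_inj sub psi1 psi2 fin; split=> //.
apply/eqP; rewrite eqn_leq; apply/andP; split.
  exact: (len_inj sub' sub psi1 psi2).
exact: (len_inj sub sub' phi1 phi2).
Qed.

End TorLength.

(** * Tensor products of free modules with A / J *)

Section TensorRow.
Context {A : comNzRingType}.
Variables (J : set A) (Q : lmodType A) (pi : {linear A^o -> Q}).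
Hypotheses (idealJ : ideal J) (quotJ : is_quotient J pi).

Lemma pi1E (a : A) : pi a = a *: pi 1.
Proof. by rewrite -linearZ; congr (pi _); rewrite /GRing.scale /= mulr1. Qed.

Lemma mulm_row r (v : 'rV[A]_r) : mulm J fullm v <-> forall i, J (v 0 i).
Proof.
split=> [Jv i|Jv]; last first.
  by rewrite [v]rV_sum_delta; apply: sm_sum => i _; apply: mulm_gen.
have [f hf] : exists f : {linear 'rV[A]_r -> A^o}, forall v, f v = v 0 i.
  by apply: to_linear => a x y; rewrite !mxE.
suff : mulm J fullm `<=` prem f (Submod idealJ) by move=> /(_ _ Jv) /=; rewrite hf.
apply: mulm_sub => a x Ja _; rewrite /= linearZ /= hf /GRing.scale /= mulrC.
exact: (smZ (N := Submod idealJ)).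
Qed.

Section Tensor.
Variable r : nat.

Definition row_tensor (v : 'rV[A]_r) (q : Q) : {ffun 'I_r -> Q} := [ffun i => v 0 i *: q].

Lemma row_tensor_bilinear : bilinear_map row_tensor.
Proof.
split=> [q a v w|v a q q']; apply/ffunP => i; rewrite !ffunE ?mxE.
  by rewrite scalerDl scalerA.
by rewrite scalerDr !scalerA mulrC.
Qed.

Lemma row_tensor_lift (U : lmodType A) (c : 'rV[A]_r -> Q -> U) : bilinear_map c ->
  exists h : {linear {ffun 'I_r -> Q} -> U}, (forall v q, h (row_tensor v q) = c v q) /\
    forall y, h y = \sum_i c (delta_mx 0 i) (y i).
Proof.
move=> [cl cr].
have [h hh] : exists h : {linear {ffun 'I_r -> Q} -> U}, forall y,
    h y = \sum_i c (delta_mx 0 i) (y i).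
  apply: to_linear => a y z; rewrite scaler_sumr -big_split; apply: eq_bigr => i _.
  by rewrite !ffunE cr.
exists h; split=> // v q; rewrite hh.
have [cq hcq] := to_linear (cl q); rewrite -hcq rV_linearE; apply: eq_bigr => i _.
have [ci hci] := to_linear (cr (delta_mx 0 i)).
by rewrite ffunE -hci linearZ hci hcq.
Qed.

Lemma is_tensor_row : is_tensor row_tensor.
Proof.
split; first exact: row_tensor_bilinear.
move=> U c hc; have [h [h1 h2]] := row_tensor_lift hc; exists h; split=> // h' hh' y.
have -> : y = \sum_i row_tensor (delta_mx 0 i) (y i).
  apply/ffunP => j; rewrite sum_ffunE (bigD1 j) //= ffunE mxE !eqxx scale1r.
  by rewrite big1 ?addr0 // => i ij; rewrite ffunE mxE eqxx eq_sym (negPf ij) scale0r.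
by rewrite !linear_sum; apply: eq_bigr => i _; rewrite hh' h1.
Qed.

Variables (T : lmodType A) (b : 'rV[A]_r -> Q -> T).
Hypothesis tensb : is_tensor b.

Lemma tensor_row_linear : linear (b^~ (pi 1)).
Proof. by case: tensb => -[]. Qed.

(** Any tensor product of A^r with A / J is A^r / J A^r by way of v (x) 1. By its universal property
    it is compared with the model Q^r, where this can be read off coordinates. *)
Lemma tensor_row_spec : surj (b^~ (pi 1)) /\
  forall v, b v (pi 1) = 0 <-> mulm J fullm v.
Proof.
have [bil univ] := tensb; have [bl br] := bil.
have [h [h1 _]] := univ _ _ row_tensor_bilinear.
have [h' [h1' h2']] := row_tensor_lift bil.
have [k [k1 k2]] := univ _ _ bil.
(* The composite and the identity both solve the universal problem of b for itself. *)
have hK t : h' (h t) = t.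
  have hb v q : (h' \o h) (b v q) = b v q by rewrite /= h1 h1'.
  exact: (etrans (k2 (h' \o h) hb t) (esym (k2 idfun (fun _ _ => erefl) t))).
have [qsurj q0] := quotJ; split=> [t|v].
  have /boolp.choice[a ha] i : exists a, pi a = h t i by apply: qsurj.
  exists (\row_i a i); rewrite -[RHS]hK h2'.
  have [c hc] := to_linear (bl (pi 1)); rewrite -hc rV_linearE; apply: eq_bigr => i _.
  have [ci hci] := to_linear (br (delta_mx 0 i)).
  by rewrite hc mxE -ha [pi (a i)]pi1E -!hci linearZ.
rewrite mulm_row; split=> [bv0 i|Jv].
  have := h1 v (pi 1); rewrite bv0 linear0 => /ffunP/(_ i); rewrite !ffunE -pi1E => /esym.
  by move/q0.
rewrite -[LHS]hK h1; have -> : row_tensor v (pi 1) = 0; last by rewrite linear0.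
by apply/ffunP => i; rewrite !ffunE -pi1E; apply/q0.
Qed.

End Tensor.
End TensorRow.

Section LengthTor1.
Context {R : realType} {A : comNzRingType}.
Hypothesis noethA : noetherian A.
Variables (J : set A) (M : lmodType A).
Hypotheses (idealJ : ideal J) (fgM : fin_gen M).

(** Both modules are identified with a subquotient Y / X of the free module in degree 1: [diff1]
    carries it to (K cap J P_0) / J K, and [beta], v |-> v (x) 1, to the homology ker t1 / im t2. *)
Lemma is_length_Tor1P (Q : lmodType A) (pi : {linear A^o -> Q}) (l : \bar R)
    (r : nat) (p : {linear 'rV[A]_r -> M}) : is_quotient J pi -> surj p ->
  finlen (capm (ker p) (mulm J fullm)) (mulm J (ker p)) ->
  is_length_Tor1 M Q l -> l = (tor_len J (ker p))%:R%:E.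
Proof.
move=> quotJ psurj fin [P [T0 [T1 [T2 [b0 [b1 [b2 [t1 [t2 [[h0 h1 h2] [e1 e2 ->]]]]]]]]]]].
have [<- finP] := tor_len_unique (@projective_rV A r) (@projective_rV A (rk0 P)) psurj
  (@augm_surj A M P) fin.
set K := ker (augm P) in finP *; set N := capm K (mulm J fullm) in finP.
have [s1 k1] := tensor_row_spec idealJ quotJ h1.
have [s0 k0] := tensor_row_spec idealJ quotJ h0.
have [s2 _] := tensor_row_spec idealJ quotJ h2.
have [beta hbeta] := to_linear (tensor_row_linear pi h1).
pose Y := prem (diff1 P) (mulm J fullm); pose X := prem (diff1 P) (mulm J K).
have d1K v : K (diff1 P v) by apply/exact0; exists v.
have XY : X `<=` Y by move=> v; apply: mulmS.
have sub := @mulm_sub_tor _ J _ K.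
have [YN XN] : (forall v, Y v -> N (diff1 P v)) /\ (forall v, Y v -> mulm J K (diff1 P v) -> X v).
  by split=> v //; split=> //; apply: d1K.
have finYX := finlen_inj sub YN XN finP.
have [eqlen _] : len Y X = len N (mulm J K) /\ finlen N (mulm J K).
  apply: (len_iso (f := diff1 P)) => //.
  move=> y [/exact0[v eqv] Jy]; exists v; rewrite /Y /= eqv subrr; split=> //; exact: sm0.
rewrite /tor_len -/N -eqlen.
pose Z := prem t1 zerom; pose B := imm t2 fullm.
have Zbeta v : Z (beta v) <-> Y v by rewrite /Z /= hbeta e1; apply: k0.
have Xbeta v : X v <-> B (beta v).
  split=> [|[t _ eqt]].
    rewrite /X /= => Jv; have : mulm J (imm (diff1 P) fullm) (diff1 P v).
      by apply: mulmS Jv => // _ /exact0[w <-]; exists w.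
    (* Write d1 v = d1 u with u in J P_1: then v - u is a boundary, and u vanishes in the tensor
       product. *)
    move/mulm_imm => [u Ju equ]; have : diff1 P (v - u) = 0 by rewrite linearB equ subrr.
    move/exact1 => [w eqw]; exists (b2 w (pi 1)) => //.
    by rewrite e2 eqw -hbeta linearB hbeta [beta u]hbeta (proj2 (k1 u)) // subr0.
  have [w eqw] := s2 t; move: eqt; rewrite -eqw e2 -hbeta => /esym eqb.
  have : mulm J fullm (v - diff2 P w) by apply/k1; rewrite -hbeta linearB eqb subrr.
  move/(mulm_map (f := diff1 P) (K := K) (fun u _ => d1K u)); rewrite linearB.
  by have -> : diff1 P (diff2 P w) = 0; [apply/exact1; exists w | rewrite subr0].
have BZ : B `<=` Z.
  move=> _ [t _ <-]; have [w <-] := s2 t; rewrite e2 -hbeta; apply/Zbeta.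
  rewrite /Y /=; have -> : diff1 P (diff2 P w) = 0; last exact: sm0.
  by apply/exact1; exists w.
have [eqlen' finZB] : len Y X = len Z B /\ finlen Z B.
  apply: (len_iso (f := beta)) => //.
  - by move=> v /Zbeta.
  - move=> z Zz; have [v eqv] := s1 z; exists v; rewrite -Zbeta hbeta eqv subrr.
    by split=> //; apply: sm0.
rewrite eqlen' -(length_quotE R BZ finZB); congr length_quot.
Qed.

(** Rules out the default value of [xget] in [length_Tor1]. *)
Lemma is_length_Tor1_exists : exists (Q : lmodType A) (pi : {linear A^o -> Q}) (l : \bar R),
  is_quotient J pi /\ is_length_Tor1 M Q l.
Proof.
pose K := Submod idealJ; pose Q : lmodType A := quot K.
pose pi : {linear A^o -> Q} := @quot_pi A A^o K.
have quotJ : is_quotient J pi.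
  by split=> [q|a]; [exact: quot_pi_surj | exact: quot_pi_eq0].
have [r0 [aug haug]] := fin_gen_cover fgM.
have fg r (N : submod 'rV[A]_r) : sm_fg N by apply: noeth_fin_gen => //; apply: fin_gen_rV.
have [r1 [d1 hd1]] := rV_cover (fg _ (ker aug)).
have [r2 [d2 hd2]] := rV_cover (fg _ (ker d1)).
pose P := @Build_free_resolution A M r0 r1 r2 d2 d1 aug haug hd1 hd2.
have bil r r' (f : {linear 'rV[A]_r -> 'rV[A]_r'}) :
    bilinear_map (fun v (q : Q) => row_tensor (f v) q).
  have [bl br] := @row_tensor_bilinear A Q r'.
  by split=> [q a v w|v]; [rewrite linearP bl | exact: br].
have [_ t1P] := @is_tensor_row A Q r1; have [t1 [ht1 _]] := t1P _ _ (bil _ _ d1).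
have [_ t2P] := @is_tensor_row A Q r2; have [t2 [ht2 _]] := t2P _ _ (bil _ _ d2).
exists Q, pi, (length_quot R [set x | t1 x = 0] (range t2)); split=> //.
exists P, {ffun 'I_r0 -> Q}, {ffun 'I_r1 -> Q}, {ffun 'I_r2 -> Q}.
exists (@row_tensor A Q r0), (@row_tensor A Q r1), (@row_tensor A Q r2), t1, t2.
split; first by split; apply: is_tensor_row.
by split.
Qed.

Lemma length_Tor1E (G : lmodType A) (p : {linear G -> M}) : projective G -> surj p ->
  finlen (capm (ker p) (mulm J fullm)) (mulm J (ker p)) ->
  length_Tor1 R M J = (tor_len J (ker p))%:R%:E.
Proof.
move=> hG psurj fin; have [r [q qsurj]] := fin_gen_cover fgM.
have [eqt finq] := tor_len_unique hG (@projective_rV A r) psurj qsurj fin.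
rewrite -eqt /length_Tor1; case: xgetP => [l _ [Q [pi [quotJ]]]|no].
  exact: (is_length_Tor1P quotJ qsurj finq).
have [Q [pi [l h]]] := is_length_Tor1_exists.
by exfalso; apply: (no l); exists Q, pi.
Qed.

End LengthTor1.

(** * The defect of an extension *)

Section Defect.
Context {A : comNzRingType}.
Variable J : set A.

(* The length of the kernel of N / J N -> E / J E. *)
Definition defect {V : lmodType A} (N E : submod V) : nat :=
  len (capm N (mulm J E)) (mulm J N).

Lemma mulm_sub_defect (V : lmodType A) (N E : submod V) : N `<=` E ->
  mulm J N `<=` capm N (mulm J E).
Proof. by move=> NE v hv; split; [exact: mulm_subr hv | apply: mulmS hv]. Qed.

(** Here phi induces an isomorphism E / N -> E' / N'. An element of N' cap J E' is w + phi x with w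
    in J N' and x in J E; then phi x lies in N', so x lies in N, and the kernels surject. *)
Lemma defect_push (V V' : lmodType A) (phi : {linear V -> V'})
    (N E : submod V) (N' E' : submod V') : N `<=` E -> N' `<=` E' ->
  (forall x, N x -> N' (phi x)) -> (forall x, E x -> N' (phi x) -> N x) ->
  (forall y, E' y -> exists2 x, E x & N' (y - phi x)) ->
  finlen (capm N (mulm J E)) (mulm J N) -> (defect N' E' <= defect N E)%N.
Proof.
move=> NE NE' phiN phiK phiE fin; apply: (len_surj (f := phi)) fin.
- exact: mulm_sub_defect.
- exact: mulm_sub_defect.
- exact: mulm_map.
move=> y [N'y Jy]; have : mulm J (addm N' (imm phi E)) y.
  apply: mulmS Jy => // z /phiE[x Ex Nz]; exists (z - phi x), (phi x).
  by rewrite subrK; split=> //; exists x.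
move/mulm_addm => [w [_ [Jw /mulm_imm[x Jx <-] eqy]]]; exists x.
have eqw : y - phi x = w by rewrite eqy addrK.
rewrite eqw; split=> //; split=> //; apply: phiK; first exact: mulm_subr Jx.
by rewrite -(subKr y (phi x)) eqw; apply: smB => //; apply: mulm_subr Jw.
Qed.

(** The last condition on phi says that N' / J N' -> N / J N is injective, and so is its restriction
    to the kernels. *)
Lemma defect_pull (V V' : lmodType A) (phi : {linear V' -> V})
    (N E : submod V) (N' E' : submod V') : N `<=` E -> N' `<=` E' ->
  (forall x, N' x -> N (phi x)) -> (forall x, E' x -> E (phi x)) ->
  (forall x, N' x -> mulm J N (phi x) -> mulm J N' x) ->
  finlen (capm N (mulm J E)) (mulm J N) -> (defect N' E' <= defect N E)%N.
Proof.
move=> NE NE' phiN phiE phiJ fin; apply: (len_inj (f := phi)) fin.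
- exact: mulm_sub_defect.
- exact: mulm_sub_defect.
- by move=> x [N'x JE'x]; split; [exact: phiN | exact: mulm_map JE'x].
- by move=> x [N'x _]; apply: phiJ.
Qed.

Lemma defect_retract (V : lmodType A) (rho : {linear V -> V}) (N E : submod V) :
  N `<=` E -> (forall x, E x -> N (rho x)) -> (forall x, N x -> rho x = x) ->
  defect N E = 0%N.
Proof.
move=> NE rhoE rhoN; rewrite /defect -[RHS](len_xx (mulm J N)); congr len.
apply: submod_eq; last exact: mulm_sub_defect.
by move=> x [Nx JEx]; rewrite -(rhoN _ Nx); apply: mulm_map JEx.
Qed.

End Defect.

(** * Horseshoe covers and the snake lemma *)

Section Horseshoe.
Context {A : comNzRingType}.
Variables (M N : lmodType A) (E : extension M N) (GN GM : lmodType A).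
Variables (pN : {linear GN -> N}) (pM : {linear GM -> M}) (lam : {linear GM -> ext_mid E}).
Hypotheses (pN_surj : surj pN) (pM_surj : surj pM).
Hypothesis lamE : forall y, ext_out E (lam y) = pM y.

Definition cover_fun (v : GN * GM) : ext_mid E := ext_in E (pN v.1) + lam v.2.

Lemma cover_linear : linear cover_fun.
Proof.
by move=> a x y; rewrite /cover_fun /= !linearP scalerDr addrACA.
Qed.

HB.instance Definition _ := GRing.isLinear.Build A (GN * GM)%type (ext_mid E) _
  cover_fun cover_linear.

Definition cover : {linear (GN * GM)%type -> ext_mid E} := cover_fun.

Definition inl_fun (x : GN) : GN * GM := (x, 0).
Lemma inl_linear : linear inl_fun.
Proof. by move=> a x y; congr pair; rewrite /= ?scaler0 ?addr0. Qed.
HB.instance Definition _ := GRing.isLinear.Build A GN (GN * GM)%type _ inl_fun inl_linear.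
Definition inlG : {linear GN -> (GN * GM)%type} := inl_fun.

Definition snd_fun (v : GN * GM) : GM := v.2.
Lemma snd_linear : linear snd_fun.
Proof. by []. Qed.
HB.instance Definition _ := GRing.isLinear.Build A (GN * GM)%type GM _ snd_fun snd_linear.
Definition sndG : {linear (GN * GM)%type -> GM} := snd_fun.

Definition ext_sub : submod (ext_mid E) := imm (ext_in E) fullm.
Definition cover_sub : submod (GN * GM)%type := imm inlG (ker pN).

Lemma ext_out_in x : ext_out E (ext_in E x) = 0.
Proof. by apply/ext_exact; exists x. Qed.

Lemma ext_subP e : ext_sub e <-> ext_out E e = 0.
Proof.
split=> [[x _ <-]|/ext_exact[x <-]]; first exact: ext_out_in.
by exists x.
Qed.

Lemma cover_surj : surj cover.
Proof.
move=> e; have [y eqy] := pM_surj (ext_out E e).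
have /ext_exact[n eqn] : ext_out E (e - lam y) = 0 by rewrite linearB lamE eqy subrr.
have [x eqx] := pN_surj n; exists (x, y).
by rewrite /cover /= /cover_fun /= eqx eqn subrK.
Qed.

Lemma cover_sub_ker : cover_sub `<=` ker cover.
Proof.
move=> _ [x + <-]; rewrite /ker /cover /= /cover_fun /= => ->.
by rewrite linear0 add0r linear0.
Qed.

(** With the two lemmas that follow, this gives the exact sequence 0 -> ker pN -> ker cover -> ker
    pM -> 0. *)
Lemma ker_cover_lift y : pM y = 0 -> exists x, ker cover (x, y).
Proof.
move=> pMy; have /ext_exact[n eqn] : ext_out E (lam y) = 0 by rewrite lamE.
have [x eqx] := pN_surj n; exists (- x).
by rewrite /ker /cover /= /cover_fun /= !linearN eqx eqn addNr.
Qed.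

Lemma ker_cover_snd v : ker cover v -> pM v.2 = 0.
Proof.
move=> /(congr1 (ext_out E)).
by rewrite linear0 /cover /= /cover_fun linearD ext_out_in add0r lamE.
Qed.

Lemma ker_cover_inl x : ker cover (x, 0) -> pN x = 0.
Proof.
rewrite /ker /cover /= /cover_fun /= linear0 addr0 => h.
by apply: (@ext_in_inj _ _ _ E); rewrite h linear0.
Qed.

Variable J : set A.

Lemma mulm_inlG x : mulm J fullm (x, 0 : GM) <-> mulm J (fullm : submod GN) x.
Proof.
split=> [|Jx]; last by apply: (mulm_map (f := inlG)) Jx.
have [f hf] : exists f : {linear (GN * GM)%type -> GN}, forall v, f v = v.1 by apply: to_linear.
by move=> /(mulm_map (f := f) (K := fullm) (fun _ _ => I)); rewrite hf.
Qed.

Lemma mulm_pair x y : mulm J (fullm : submod GN) x -> mulm J (fullm : submod GM) y ->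
  mulm J fullm (x, y).
Proof.
move=> /mulm_inlG Jx Jy.
have [f hf] : exists f : {linear GM -> (GN * GM)%type}, forall y, f y = (0, y).
  by apply: to_linear => a u v; congr pair; rewrite /= ?scaler0 ?addr0.
have -> : (x, y) = (x, 0) + f y by rewrite hf; congr pair; rewrite /= ?addr0 ?add0r.
by apply: smD => //; apply: (mulm_map (f := f)) Jy.
Qed.

(** X / J KE is Tor_1(E, A/J). In it C / J KE is the image of Tor_1(N, A/J), and X / C is its image
    in Tor_1(M, A/J). *)
Let KE := ker cover.
Let X := capm KE (mulm J fullm).
Let C := capm X (addm cover_sub (mulm J KE)).

Hypothesis finN : finlen (capm (ker pN) (mulm J fullm)) (mulm J (ker pN)).
Hypothesis finM : finlen (capm (ker pM) (mulm J fullm)) (mulm J (ker pM)).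
Hypothesis finE : finlen (capm (ker cover) (mulm J fullm)) (mulm J (ker cover)).

Let JX : mulm J KE `<=` X. Proof. exact: mulm_sub_tor. Qed.
Let JC : mulm J KE `<=` C. Proof. by move=> v hv; split; [exact: JX | apply: addm_inr]. Qed.
Let CX : C `<=` X. Proof. by move=> v []. Qed.

Let JcoverS : mulm J cover_sub `<=` mulm J KE.
Proof. by apply: mulmS => //; apply: cover_sub_ker. Qed.

(** The map Tor_1(N, A/J) -> Tor_1(E, A/J) has image C / J KE, and the length of its kernel is the
    defect of the syzygies. *)
Lemma horseshoe_N : tor_len J (ker pN) = (len C (mulm J KE) + defect J cover_sub KE)%N /\
  finlen (capm cover_sub (mulm J KE)) (mulm J cover_sub).
Proof.
have [-> fin] : tor_len J (ker pN) = len (capm cover_sub (mulm J fullm)) (mulm J cover_sub) /\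
    finlen (capm cover_sub (mulm J fullm)) (mulm J cover_sub).
  apply: (len_iso (f := inlG)) => //.
  - exact: mulm_sub_tor.
  - exact: mulm_sub_tor.
  - move=> x [Kx Jx]; split; first by exists x.
    by apply/mulm_inlG.
  - move=> x [Kx _]; split=> [|/mulm_imm[z Jz [<-]]//].
    by apply: mulm_map => y Ky; exists y.
  - move=> _ [[x Kx <-] /mulm_inlG Jx]; exists x; rewrite subrr; split=> //; exact: sm0.
split; last by apply: finlenS fin => // v [cv Jv]; split=> //; apply: mulmS Jv.
rewrite (@len_add _ _ _ (capm cover_sub (mulm J KE))) //.
- congr addn.
  have [||||||-> _] := len_iso (f := idfun) (N := capm cover_sub (mulm J fullm))
    (K := capm cover_sub (mulm J KE)) (N' := C) (K' := mulm J KE); last by [].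
  + by move=> v [cv Jv]; split=> //; apply: mulmS Jv.
  + exact: JC.
  + move=> v [cv Jv]; split; last exact: addm_inl.
    by split=> //; apply: cover_sub_ker.
  + by move=> v [cv _]; split=> [[]|].
  + move=> y [[Ky Jy] [u [w [cu Jw eqy]]]]; exists u; rewrite eqy /= addrAC subrr add0r.
    split=> //; split=> //; have -> : u = y - w by rewrite eqy addrK.
    by apply: smB => //; apply: mulmS Jw.
  + by apply: finlenS fin => // v hv; split; [exact: mulm_subr hv | exact: JcoverS].
- by move=> v hv; split; [exact: mulm_subr hv | exact: JcoverS].
- by move=> v [cv Jv]; split=> //; apply: mulmS Jv.
Qed.

Lemma mulm_ker_pM y : mulm J (ker pM) y -> exists2 v, mulm J KE v & v.2 = y.
Proof.
move=> Jy; have : mulm J (imm sndG KE) y.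
  by apply: mulmS Jy => // z /ker_cover_lift[x Kx]; exists (x, z).
by move/mulm_imm.
Qed.

(** The map Tor_1(E, A/J) -> Tor_1(M, A/J) has image X / C, and its cokernel is identified by the
    connecting map with the kernel of N/JN -> E/JE. *)
Lemma horseshoe_M : tor_len J (ker pM) = (len X C + defect J ext_sub fullm)%N /\
  finlen (capm ext_sub (mulm J fullm)) (mulm J ext_sub).
Proof.
pose Y := imm sndG X.
have YM : Y `<=` capm (ker pM) (mulm J fullm).
  move=> _ [v [Kv Jv] <-]; split; first exact: ker_cover_snd.
  by apply: (mulm_map (f := sndG)) Jv.
have MY : mulm J (ker pM) `<=` Y.
  by move=> y /mulm_ker_pM[v /JX Xv <-]; exists v.
have eXY : len X C = len Y (mulm J (ker pM)).
  have [||||||-> _] := len_iso (f := sndG) (N := X) (K := C) (N' := Y)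
    (K' := mulm J (ker pM)); last by [].
  - exact: CX.
  - exact: MY.
  - by move=> v Xv; exists v.
  - move=> v Xv; split=> [[_ [_ [w [[x _ <-] Jw ->]]]]|/mulm_ker_pM[w Jw eqw]].
      rewrite linearD /= {1}/snd_fun /= add0r.
      by apply: (mulm_map (f := sndG)) Jw => u /ker_cover_snd.
    split=> //; exists (v - w), w; rewrite subrK; split=> //.
    have Kvw : KE (v - w) by apply: smB; [case: Xv | apply: mulm_subr Jw].
    have eqvw : v - w = (v.1 - w.1, 0) by congr pair; rewrite /= eqw subrr.
    rewrite eqvw in Kvw *; exists (v.1 - w.1) => //; exact: ker_cover_inl.
  - by move=> _ [v Xv <-]; exists v; rewrite subrr; split=> //; apply: sm0.
  - exact: finlenS finE.
have [eqd fin] : len (capm (ker pM) (mulm J fullm)) Y = defect J ext_sub fullm /\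
    finlen (capm ext_sub (mulm J fullm)) (mulm J ext_sub).
  (* The lift [lam] induces the connecting map: on ker pM cap J GM its values lie both in the image
     of N and in J E. *)
  apply: (len_iso (f := lam)).
  - exact: YM.
  - exact: mulm_sub_defect.
  - move=> y [Ky Jy]; split; first by apply/ext_subP; rewrite lamE.
    by apply: mulm_map Jy.
  - move=> y [Ky Jy]; split=> [[[x y'] [Kv Jv] eqy]|Jlam].
      have -> : lam y = ext_in E (pN (- x)).
        apply/eqP; rewrite -subr_eq0 !linearN opprK addrC -eqy; exact/eqP.
      apply: (mulm_map (f := ext_in E \o pN) (N := fullm)) => [z _|]; first by exists (pN z).
      have [f hf] : exists f : {linear (GN * GM)%type -> GN}, forall v, f v = v.1.
        by apply: to_linear.
      apply: smN; rewrite -[x]/((x, y').1) -hf.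
      by apply: mulm_map Jv.
    have : mulm J (imm (ext_in E \o pN) fullm) (lam y).
      by apply: mulmS Jlam => // _ [n _ <-]; have [x <-] := pN_surj n; exists x.
    move/mulm_imm => [x Jx eqx]; exists (- x, y) => //; split; last first.
      by apply: mulm_pair => //; apply: smN.
    by rewrite /KE /ker /cover /= /cover_fun /= !linearN -eqx /= addNr.
  - move=> z [/ext_subP oz Jz]; have : mulm J (imm cover fullm) z.
      by apply: mulmS Jz => // w _; have [v <-] := cover_surj w; exists v.
    move/mulm_imm => [[x y] Jv eqz]; exists y; split.
      split; last by apply: (mulm_map (f := sndG)) Jv.
      by rewrite /ker /= -lamE -oz -eqz /cover /= /cover_fun linearD ext_out_in add0r.
    rewrite -eqz /cover /= /cover_fun addrK.
    apply: (mulm_map (f := ext_in E \o pN) (N := fullm)) => [w _|]; first by exists (pN w).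
    have [f hf] : exists f : {linear (GN * GM)%type -> GN}, forall v, f v = v.1.
      by apply: to_linear.
    by rewrite /= -[x]/((x, y).1) -hf; apply: mulm_map Jv.
  - exact: finlenS finM.
by split=> //; rewrite /tor_len (len_add MY YM finM) eqd -eXY addnC.
Qed.

(* The snake lemma for the two rows obtained from N, E, M by reduction modulo J. *)
Lemma horseshoe : (tor_len J (ker pN) + tor_len J (ker pM) =
  tor_len J (ker cover) + (defect J cover_sub (ker cover) + defect J ext_sub fullm))%N.
Proof.
have [-> _] := horseshoe_N; have [-> _] := horseshoe_M.
rewrite [in RHS]/tor_len (len_add JC CX finE); ring.
Qed.

End Horseshoe.

(** * T-split extensions *)

Section TSplitTheory.
Context {R : realType} {A : comNzRingType}.
Variables (m : set A) (d : nat) (I : set A) (F : int -> set A).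
Hypotheses (localm : local_ring m) (CMm : cohen_macaulay m) (dimd : krull_dim A d).
Hypotheses (primI : primary_to m I) (admF : admissible I F) (d_gt0 : (0 < d)%N).

Let noethA : noetherian A. Proof. by case: localm. Qed.

Definition tor_seq (X : lmodType A) (n : nat) : R := fine (length_Tor1 R X (F n.+1%:Z)).

Definition defect_seq (M N : lmodType A) (E : extension M N) (n : nat) : R :=
  tor_seq M n + tor_seq N n - tor_seq (ext_mid E) n.

Lemma tor_finlen (G X : lmodType A) (p : {linear G -> X}) n : fin_gen G ->
  finlen (capm (ker p) (mulm (F n%:Z) fullm)) (mulm (F n%:Z) (ker p)).
Proof.
move=> fgG; have noethG : noeth_mod G by apply: noeth_fin_gen.
by apply: finlenS (finlen_admissible localm primI admF noethG (ker p) n) => // v [].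
Qed.

Lemma tor_seqE (G X : lmodType A) (p : {linear G -> X}) n :
  fin_gen G -> projective G -> surj p -> tor_seq X n = (tor_len (F n.+1%:Z) (ker p))%:R.
Proof.
move=> fgG projG psurj; have [idF _ _ _] := admF.
rewrite /tor_seq (length_Tor1E noethA (proj1 (idF n.+1%:Z)) (fin_gen_imm psurj fgG) projG psurj) //.
exact: tor_finlen.
Qed.

(** A value of [limn] is meaningful only for a convergent sequence; convergence comes from
    [dpoly_tor] with degree bound d - 1. *)
Lemma eT_cvg (X : lmodType A) : fin_gen X ->
  (d.-1)`!%:R / n%:R ^+ d.-1 * tor_seq X n @[n --> \oo] --> eT R d F X.
Proof.
move=> fgX; have [r [p psurj]] := fin_gen_cover fgX.
have noethG : noeth_mod 'rV[A]_r by apply: noeth_fin_gen => //; apply: fin_gen_rV.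
have dt := dpoly_tor (R := R) localm CMm dimd primI admF noethG (ker p) d_gt0.
have := proj2 (dpoly_shift _ _) dt; rewrite -{1}(prednK d_gt0) => /dpoly_cvg[c lim _].
suff cv : (d.-1)`!%:R / n%:R ^+ d.-1 * tor_seq X n @[n --> \oo] --> (d.-1)`!%:R * c.
  by rewrite /eT -/(tor_seq X _); have -> := cvg_lim (@Rhausdorff R) cv.
have -> : (fun n => (d.-1)`!%:R / n%:R ^+ d.-1 * tor_seq X n) =
    (fun n => (d.-1)`!%:R * ((tor_len (F n.+1%:Z) (ker p))%:R / n%:R ^+ d.-1)).
  apply/funext => n; rewrite (tor_seqE n (fin_gen_rV r) (@projective_rV A r) psurj).
  by rewrite mulrAC mulrA.
exact: cvgMr.
Qed.

Section Extension.
Variables (M N : lmodType A) (E : extension M N).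
Hypotheses (fgM : fin_gen M) (fgN : fin_gen N).

Lemma ext_cover_exists : exists (rN rM : nat) (pN : {linear 'rV[A]_rN -> N})
    (pM : {linear 'rV[A]_rM -> M}) (lam : {linear 'rV[A]_rM -> ext_mid E}),
  [/\ surj pN, surj pM & forall y, ext_out E (lam y) = pM y].
Proof.
have [rN [pN pN_surj]] := fin_gen_cover fgN; have [rM [pM pM_surj]] := fin_gen_cover fgM.
have [lam hlam] := @projective_rV A rM _ _ (ext_out E) pM (fun y => ext_out_surj E (pM y)).
by exists rN, rM, pN, pM, lam.
Qed.

Lemma defect_seqE (GN GM : lmodType A) (pN : {linear GN -> N}) (pM : {linear GM -> M})
    (lam : {linear GM -> ext_mid E}) n :
  fin_gen GN -> fin_gen GM -> projective GN -> projective GM -> surj pN -> surj pM ->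
  (forall y, ext_out E (lam y) = pM y) ->
  defect_seq E n = (defect (F n.+1%:Z) (cover_sub GM pN) (ker (cover pN lam)) +
    defect (F n.+1%:Z) (ext_sub E) fullm)%:R.
Proof.
move=> fgGN fgGM hGN hGM sN sM hlam; have sE := cover_surj sN sM hlam.
rewrite /defect_seq (tor_seqE n fgGM hGM sM) (tor_seqE n fgGN hGN sN).
rewrite (tor_seqE n (fin_gen_prod fgGN fgGM) (projective_prod hGN hGM) sE).
rewrite -natrD addnC (horseshoe sN sM hlam); try exact: tor_finlen.
  by rewrite natrD addrAC subrr add0r.
by apply: tor_finlen; apply: fin_gen_prod.
Qed.

Lemma fin_gen_mid : fin_gen (ext_mid E).
Proof.
have [rN [rM [pN [pM [lam [sN sM hlam]]]]]] := ext_cover_exists.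
by apply: (fin_gen_imm (cover_surj sN sM hlam)); apply: fin_gen_prod; apply: fin_gen_rV.
Qed.

Lemma defect_seq_ge0 n : 0 <= defect_seq E n.
Proof.
have [rN [rM [pN [pM [lam [sN sM hlam]]]]]] := ext_cover_exists.
rewrite (defect_seqE n (fin_gen_rV rN) (fin_gen_rV rM) _ _ sN sM hlam) //;
  exact: projective_rV.
Qed.

Lemma defect_seq_cvg :
  (d.-1)`!%:R / n%:R ^+ d.-1 * defect_seq E n @[n --> \oo] --> eT_ext R d F E.
Proof.
have -> : (fun n => (d.-1)`!%:R / n%:R ^+ d.-1 * defect_seq E n) = (fun n =>
    (d.-1)`!%:R / n%:R ^+ d.-1 * tor_seq M n + (d.-1)`!%:R / n%:R ^+ d.-1 * tor_seq N n -
    (d.-1)`!%:R / n%:R ^+ d.-1 * tor_seq (ext_mid E) n).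
  by apply/funext => n; rewrite /defect_seq mulrBr mulrDr.
by apply: cvgB; [apply: cvgD|]; apply: eT_cvg => //; apply: fin_gen_mid.
Qed.

End Extension.

Lemma T_split_le (M N M' N' : lmodType A) (E : extension M N) (E' : extension M' N') :
  fin_gen M -> fin_gen N -> fin_gen M' -> fin_gen N' ->
  (forall n, defect_seq E' n <= defect_seq E n) ->
  T_split R d F E -> T_split R d F E'.
Proof.
move=> fgM fgN fgM' fgN' le_def; rewrite /T_split => E0.
have lim := @defect_seq_cvg _ _ E fgM fgN; rewrite E0 in lim.
suff lim0 : (d.-1)`!%:R / n%:R ^+ d.-1 * defect_seq E' n @[n --> \oo] --> (0 : R).
  exact: cvg_unique (@defect_seq_cvg _ _ E' fgM' fgN') lim0.
have zero : (0 : R) @[n --> \oo] --> (0 : R) by exact: cvg_cst.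
apply: (squeeze_cvgr _ zero lim); near=> n.
have c_ge0 : 0 <= (d.-1)`!%:R / n%:R ^+ d.-1 :> R by apply: divr_ge0.
apply/andP; split; first by apply: mulr_ge0 => //; apply: defect_seq_ge0.
exact: ler_wpM2l.
Unshelve. all: by end_near. Qed.

(** The same cover of M serves both extensions, so that [Phi] and h induce isomorphisms on the
    quotients K_E / K_N and E / N, as [defect_push] demands. *)
Lemma T_split_push (M N N' : lmodType A) (f : {linear N -> N'})
    (E : extension M N) (E' : extension M N') :
  fin_gen M -> fin_gen N -> fin_gen N' ->
  ext_morphism f id E E' -> T_split R d F E -> T_split R d F E'.
Proof.
move=> fgM fgN fgN' [h [h_in h_out]]; apply: T_split_le => // n.
have [rN [rM [pN [pM [lam [sN sM hlam]]]]]] := ext_cover_exists E fgM fgN.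
have [rN' [pN' sN']] := fin_gen_cover fgN'.
pose lam' : {linear 'rV[A]_rM -> ext_mid E'} := h \o lam.
have hlam' y : ext_out E' (lam' y) = pM y by rewrite /lam' /= h_out hlam.
have fg := @fin_gen_rV A; have proj := @projective_rV A.
rewrite (defect_seqE n (fg _) (fg _) (proj _) (proj _) sN sM hlam).
rewrite (defect_seqE n (fg _) (fg _) (proj _) (proj _) sN' sM hlam').
have finN := tor_finlen pN n.+1 (fg _); have finM := tor_finlen pM n.+1 (fg _).
have fgE := fin_gen_prod (fg rN) (fg rM).
have finE := tor_finlen (cover pN lam) n.+1 fgE.
have [phi hphi] := @projective_rV A rN _ _ pN' (f \o pN) (fun x => sN' (f (pN x))).
have [Phi hPhi] : exists Phi : {linear ('rV[A]_rN * 'rV[A]_rM)%type ->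
    ('rV[A]_rN' * 'rV[A]_rM)%type},
    forall v, Phi v = (phi v.1, v.2).
  by apply: to_linear => a x y; rewrite /= linearP.
have coverPhi v : cover pN' lam' (Phi v) = h (cover pN lam v).
  by rewrite /cover /= /cover_fun hPhi /= hphi linearD h_in.
rewrite ler_nat; apply: leq_add.
  have [_ fin] := horseshoe_N lam finN.
  apply: (defect_push (phi := Phi)) fin.
  - exact: cover_sub_ker.
  - exact: cover_sub_ker.
  - move=> _ [x Kx <-]; exists (phi x); last by rewrite hPhi /= /inl_fun.
    by rewrite /ker /= hphi /= [pN x]Kx linear0.
  - move=> v Kv [x Kx]; rewrite hPhi => -[eqx eq2]; exists v.1.
      by apply: (@ker_cover_inl _ _ _ _ _ _ pN lam); rewrite eq2; case: (v) Kv.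
    by rewrite /= /inl_fun eq2; case: (v).
  - move=> [x' y] Ky; have [x Kx] := ker_cover_lift sN hlam (ker_cover_snd hlam' Ky).
    exists (x, y) => //; rewrite hPhi.
    have eqd : (x', y) - (phi x, y) = (x' - phi x, 0) by congr pair; rewrite /= subrr.
    rewrite /= eqd; exists (x' - phi x) => //.
    apply: (@ker_cover_inl _ _ _ _ _ _ pN' lam'); rewrite -eqd; apply: smB => //.
    have := coverPhi (x, y); rewrite hPhi /ker /= => ->.
    by rewrite [cover pN lam (x, y)]Kx linear0.
have [_ fin] := horseshoe_M sN sM hlam finM finE.
apply: (defect_push (phi := h)) fin => //.
- by move=> _ [x _ <-]; rewrite h_in; exists (f x).
- by move=> e _ /ext_subP; rewrite h_out => /ext_subP.
- move=> e' _; have [e eqe] := ext_out_surj E (ext_out E' e'); exists e => //.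
  by apply/ext_subP; rewrite linearB h_out eqe subrr.
Qed.

(** The same cover of N serves both extensions, so that [Phi] and h are the identity on K_N and on
    N, and [defect_pull] applies. *)
Lemma T_split_pull (M M' N : lmodType A) (g : {linear M' -> M})
    (E : extension M N) (E' : extension M' N) :
  fin_gen M -> fin_gen M' -> fin_gen N ->
  ext_morphism id g E' E -> T_split R d F E -> T_split R d F E'.
Proof.
move=> fgM fgM' fgN [h [h_in h_out]]; apply: T_split_le => // n.
have [rN [rM [pN [pM [lam [sN sM hlam]]]]]] := ext_cover_exists E fgM fgN.
have [rN2 [rM' [pN2 [pM' [lam' [_ sM' hlam']]]]]] := ext_cover_exists E' fgM' fgN.
have fg := @fin_gen_rV A; have proj := @projective_rV A.
rewrite (defect_seqE n (fg _) (fg _) (proj _) (proj _) sN sM hlam).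
rewrite (defect_seqE n (fg _) (fg _) (proj _) (proj _) sN sM' hlam').
have finN := tor_finlen pN n.+1 (fg _); have finM := tor_finlen pM n.+1 (fg _).
have fgE := fin_gen_prod (fg rN) (fg rM).
have finE := tor_finlen (cover pN lam) n.+1 fgE.
have [gam hgam] := proj rM' _ _ pM (g \o pM') (fun y => sM (g (pM' y))).
(* The maps h lam' and lam gam agree in M, so they differ by a map into N; theta lifts it and
   corrects [Phi] so that it covers h. *)
have [|theta htheta] := proj rM' _ _ (ext_in E \o pN) ((h \o lam') \- (lam \o gam)).
  move=> y; have /ext_exact[z eqz] : ext_out E ((h \o lam') y - (lam \o gam) y) = 0.
    by rewrite linearB /= h_out hlam' hlam hgam subrr.
  by have [x eqx] := sN z; exists x; rewrite /= eqx eqz.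
have [Phi hPhi] : exists Phi : {linear ('rV[A]_rN * 'rV[A]_rM')%type ->
    ('rV[A]_rN * 'rV[A]_rM)%type},
    forall v, Phi v = (v.1 + theta v.2, gam v.2).
  apply: to_linear => a x y; congr pair; rewrite /= !linearP //=.
  by rewrite scalerDr addrACA.
have coverPhi v : cover pN lam (Phi v) = h (cover pN lam' v).
  rewrite /cover /= /cover_fun hPhi /= !linearD h_in -addrA; congr (_ + _).
  by have := htheta v.2; rewrite /= => ->; rewrite subrK.
have PhiI x : Phi (x, 0) = (x, 0) by rewrite hPhi /= !linear0 addr0.
rewrite ler_nat; apply: leq_add.
  have [_ fin] := horseshoe_N lam finN.
  apply: (defect_pull (phi := Phi)) fin.
  - exact: cover_sub_ker.
  - exact: cover_sub_ker.
  - by move=> _ [x Kx <-]; exists x; rewrite //= /inl_fun PhiI.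
  - move=> v Kv; rewrite /ker /=; have := coverPhi v; rewrite /= => ->.
    by rewrite [cover_fun _ _ v]Kv linear0.
  - move=> _ [x Kx <-]; rewrite /= /inl_fun PhiI => /mulm_imm[z Jz [<-]].
    by apply: (mulm_map (f := inlG 'rV[A]_rN 'rV[A]_rM')) Jz => w Kw; exists w.
have [_ fin] := horseshoe_M sN sM hlam finM finE.
apply: (defect_pull (phi := h)) fin => //.
- by move=> _ [x _ <-]; rewrite h_in; exists x.
- move=> _ [x _ <-]; rewrite h_in => /mulm_imm[z Jz /ext_in_inj <-].
  by apply: mulm_map Jz => w Kw; exists w.
Qed.

(** With [sec] composed with the cover of M as the lift, K_N is a retract of K_E and N one of E, so
    both kernels vanish for each n. *)
Lemma T_split_trivial (M N : lmodType A) (E : extension M N) (rho : {linear ext_mid E -> N})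
    (sec : {linear M -> ext_mid E}) :
  fin_gen M -> fin_gen N -> (forall x, rho (ext_in E x) = x) ->
  (forall x, ext_out E (sec x) = x) -> (forall x, rho (sec x) = 0) -> T_split R d F E.
Proof.
move=> fgM fgN rhoK secK rho_sec.
have [rN [pN sN]] := fin_gen_cover fgN; have [rM [pM sM]] := fin_gen_cover fgM.
pose lam : {linear 'rV[A]_rM -> ext_mid E} := sec \o pM.
have hlam y : ext_out E (lam y) = pM y by rewrite /lam /= secK.
have def0 n : defect_seq E n = 0.
  have fg := @fin_gen_rV A; have proj := @projective_rV A.
  rewrite (defect_seqE n (fg _) (fg _) (proj _) (proj _) sN sM hlam).
  have [Rho hRho] : exists Rho : {linear ('rV[A]_rN * 'rV[A]_rM)%type ->
      ('rV[A]_rN * 'rV[A]_rM)%type},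
      forall v, Rho v = (v.1, 0).
    by apply: to_linear => a x y; congr pair; rewrite /= ?scaler0 ?addr0.
  rewrite (@defect_retract _ _ _ Rho).
  - rewrite add0n (@defect_retract _ _ _ (ext_in E \o rho)) //.
    + by move=> x _; exists (rho x).
    + by move=> _ [x _ <-]; rewrite /= rhoK.
  - exact: cover_sub_ker.
  - move=> v Kv; rewrite hRho; exists v.1 => //; rewrite /ker /=.
    move: Kv => /(congr1 rho); rewrite linear0 /cover /= /cover_fun linearD rhoK /lam /=.
    by rewrite rho_sec addr0.
  - by move=> _ [x _ <-]; rewrite hRho.
have lim := @defect_seq_cvg _ _ E fgM fgN.
suff lim0 : (d.-1)`!%:R / n%:R ^+ d.-1 * defect_seq E n @[n --> \oo] --> (0 : R).
  exact: cvg_unique lim lim0.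
have -> : (fun n => (d.-1)`!%:R / n%:R ^+ d.-1 * defect_seq E n) = (fun=> 0).
  by apply/funext => n; rewrite def0 mulr0.
exact: cvg_cst.
Qed.

Lemma eT_prod (U W : lmodType A) : fin_gen U -> fin_gen W ->
  eT R d F (U * W)%type = eT R d F U + eT R d F W.
Proof.
move=> fgU fgW.
have [i hi] : exists i : {linear U -> (U * W)%type}, forall x, i x = (x, 0).
  by apply: to_linear => a x y; congr pair; rewrite /= ?scaler0 ?addr0.
have [j hj] : exists j : {linear W -> (U * W)%type}, forall x, j x = (0, x).
  by apply: to_linear => a x y; congr pair; rewrite /= ?scaler0 ?addr0.
have [q hq] : exists q : {linear (U * W)%type -> U}, forall v, q v = v.1 by apply: to_linear.
have [p hp] : exists p : {linear (U * W)%type -> W}, forall v, p v = v.2 by apply: to_linear.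
have i_inj : injective i by move=> x y; rewrite !hi => -[].
have ip : exact_at i p.
  move=> [x y]; rewrite hp; split=> [/= ->|[z]]; first by exists x.
  by rewrite hi => -[_ <-].
have p_surj y : exists v, p v = y by exists (0, y); rewrite hp.
have := @T_split_trivial W U (Extension i_inj ip p_surj) q j fgW fgU.
rewrite /T_split /eT_ext /= => split0; apply/esym/eqP; rewrite -subr_eq0 [eT R d F U + _]addrC.
by apply/eqP/split0 => x; rewrite ?hi ?hj ?hp ?hq.
Qed.

Lemma T_split_sum (M N M' N' : lmodType A) (E : extension M N) (E' : extension M' N') :
  fin_gen M -> fin_gen N -> fin_gen M' -> fin_gen N' ->
  T_split R d F E -> T_split R d F E' -> T_split R d F (ext_sum E E').
Proof.
move=> fgM fgN fgM' fgN'; rewrite /T_split /eT_ext => E0 E0'.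
have -> : eT R d F (ext_mid (ext_sum E E')) = eT R d F (ext_mid E) + eT R d F (ext_mid E').
  by apply: eT_prod; apply: fin_gen_mid.
rewrite !eT_prod //; lra.
Qed.

End TSplitTheory.

(** * Classes of extensions *)

Section ExtClasses.
Context {A : comNzRingType}.

(** Two terms of a free resolution suffice: vanishing on the second syzygies is expressed in
    [cocycle] as vanishing on the kernel of [pres_diff]. *)
Record presentation (M : lmodType A) := Presentation {
  pres0 : nat;
  pres1 : nat;
  pres_diff : {linear 'rV[A]_pres1 -> 'rV[A]_pres0};
  pres_aug : {linear 'rV[A]_pres0 -> M};
  pres_surj : surj pres_aug;
  pres_exact : exact_at pres_diff pres_aug
}.

Lemma presentation_exists (M : lmodType A) : noetherian A -> fin_gen M ->
  exists P : presentation M, True.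
Proof.
move=> noethA fgM; have [r0 [aug saug]] := fin_gen_cover fgM.
have [r1 [d1 hd1]] := rV_cover (noeth_fin_gen noethA (fin_gen_rV r0) (ker aug)).
by exists (Presentation saug hd1).
Qed.

Lemma pres_diffK (M : lmodType A) (P : presentation M) v : pres_aug P (pres_diff P v) = 0.
Proof. by apply/pres_exact; exists v. Qed.

(* The class of the pushout of 0 -> K -> A ^ pres0 -> M -> 0 along the map
   K -> N induced by phi, described as a set of extensions. *)
Definition ext_class (M N : lmodType A) (P : presentation M)
    (phi : 'rV[A]_(pres1 P) -> N) : ext_set M N :=
  fun E => exists lam : {linear 'rV[A]_(pres0 P) -> ext_mid E},
    (forall u, ext_out E (lam u) = pres_aug P u) /\
    (forall v, lam (pres_diff P v) = ext_in E (phi v)).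

Definition cocycle (M N : lmodType A) (P : presentation M)
    (phi : 'rV[A]_(pres1 P) -> N) : Prop :=
  forall v, pres_diff P v = 0 -> phi v = 0.

Lemma quot_lift (V W : lmodType A) (K : submod V) (f : {linear V -> W}) :
  (forall x, K x -> f x = 0) ->
  exists g : {linear quot K -> W}, forall x, g (quot_pi K x) = f x.
Proof.
move=> fK; have [|||g hg] := @linear_of_rel _ (quot K) W
  (fun q w => exists2 x, quot_pi K x = q & f x = w).
- by move=> q; have [x eqx] := quot_pi_surj q; exists (f x), x.
- move=> q w w' [x eqx <-] [x' eqx' <-]; apply/eqP; rewrite -subr_eq0 -linearB; apply/eqP/fK.
  by apply/(quot_pi_eq0 K); rewrite linearB /= eqx eqx' subrr.
- move=> a q q' w w' [x <- <-] [x' <- <-]; exists (a *: x + x'); by rewrite linearP.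
exists g => x; have [y eqy <-] := hg (quot_pi K x).
apply/eqP; rewrite -subr_eq0 -linearB; apply/eqP/fK; apply/(quot_pi_eq0 K).
by rewrite linearB /= eqy subrr.
Qed.

Section Presented.
Variables (M : lmodType A) (P : presentation M).
Local Notation d1 := (pres_diff P).
Local Notation aug := (pres_aug P).

(** The middle term is the pushout, N x A^pres0 modulo the pairs (phi v, - d1 v); the cocycle
    condition is what makes N embed into it. *)
Lemma ext_class_exists (N : lmodType A) (phi : {linear 'rV[A]_(pres1 P) -> N}) :
  cocycle phi -> exists E, ext_class phi E.
Proof.
move=> cphi; pose V : lmodType A := (N * 'rV[A]_(pres0 P))%type.
have [rel hrel] : exists rel : {linear 'rV[A]_(pres1 P) -> V}, forall v, rel v = (phi v, - d1 v).
  apply: to_linear => a v w; congr pair; rewrite /= linearP //.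
  by rewrite opprD scalerN.
pose K := imm rel fullm; pose Q : lmodType A := quot K.
have [i hi] : exists i : {linear N -> Q}, forall n, i n = quot_pi K (n, 0).
  apply: to_linear => a x y; rewrite -linearP; congr quot_pi.
  by congr pair; rewrite /= ?scaler0 ?addr0.
have [lam hlam] : exists lam : {linear 'rV[A]_(pres0 P) -> Q}, forall u, lam u = quot_pi K (0, u).
  apply: to_linear => a x y; rewrite -linearP; congr quot_pi.
  by congr pair; rewrite /= ?scaler0 ?addr0.
have [aug2 haug2] : exists aug2 : {linear V -> M}, forall v, aug2 v = aug v.2.
  by apply: to_linear => a x y; rewrite /= linearP.
have [|p hp] := @quot_lift V M K aug2.
  by move=> _ [v _ <-]; rewrite haug2 hrel /= linearN pres_diffK oppr0.
have i_inj : injective i.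
  move=> x y eqxy; have : quot_pi K (x - y, 0) = 0.
    have -> : (x - y, 0) = (x, 0) - (y, 0) :> V by congr pair; rewrite /= subrr.
    by rewrite linearB /= -!hi eqxy subrr.
  move/quot_pi_eq0 => [v _]; rewrite hrel => -[eqphi /eqP]; rewrite oppr_eq0 => /eqP/cphi phi0.
  by apply/eqP; rewrite -subr_eq0 -eqphi phi0.
have d1lam v : lam (d1 v) = i (phi v).
  rewrite hi hlam; apply/esym/eqP; rewrite -subr_eq0 -linearB; apply/eqP/quot_pi_eq0.
  by exists v => //; rewrite hrel; congr pair; rewrite /= ?subr0 ?sub0r.
have ip : exact_at i p.
  move=> q; split=> [|[n <-]]; last by rewrite hi hp haug2 linear0.
  have [[n u] <-] := quot_pi_surj q; rewrite hp haug2 => /pres_exact[v equ].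
  exists (n + phi v); rewrite linearD -d1lam equ hi hlam -linearD.
  by congr quot_pi; congr pair; rewrite /= ?addr0 ?add0r.
have p_surj x : exists q, p q = x.
  by have [u <-] := pres_surj P x; exists (lam u); rewrite hlam hp haug2.
exists (Extension i_inj ip p_surj), lam; split=> // u.
by rewrite /= hlam hp haug2.
Qed.

(** A lift of the cover of M to E sends the relations into N, and this is phi. *)
Lemma ext_class_surj (N : lmodType A) (E : extension M N) :
  exists2 phi : {linear 'rV[A]_(pres1 P) -> N}, cocycle phi & ext_class phi E.
Proof.
have [lam hlam] := @projective_rV A _ _ _ (ext_out E) aug (fun u => ext_out_surj E (aug u)).
have [|phi hphi] := @projective_rV A _ _ _ (ext_in E) (lam \o d1).
  by move=> v; apply/ext_exact; rewrite /= hlam pres_diffK.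
exists phi; last by exists lam; split=> // v; rewrite hphi.
by move=> v dv; apply: (@ext_in_inj _ _ _ E); rewrite hphi /= dv !linear0.
Qed.

Section Universal.
Variables (N : lmodType A) (phi : 'rV[A]_(pres1 P) -> N) (E : extension M N).
Variable lam : {linear 'rV[A]_(pres0 P) -> ext_mid E}.
Hypotheses (lam_out : forall u, ext_out E (lam u) = aug u).
Hypothesis lam_in : forall v, lam (d1 v) = ext_in E (phi v).

Lemma ext_class_gen e : exists y u, e = ext_in E y + lam u.
Proof.
have [u equ] := pres_surj P (ext_out E e).
have /ext_exact[y eqy] : ext_out E (e - lam u) = 0 by rewrite linearB lam_out equ subrr.
by exists y, u; rewrite eqy subrK.
Qed.

Variables (M' N' : lmodType A) (E' : extension M' N') (f : {linear N -> N'}).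
Variable mu : {linear 'rV[A]_(pres0 P) -> ext_mid E'}.
Hypothesis mu_in : forall v, mu (d1 v) = ext_in E' (f (phi v)).

(** The universal property of the pushout. The map is given by its graph G, because e = ext_in y +
    lam u determines y and u only up to relations. *)
Lemma ext_class_univ : exists h : {linear ext_mid E -> ext_mid E'},
  (forall y, h (ext_in E y) = ext_in E' (f y)) /\ (forall u, h (lam u) = mu u).
Proof.
pose G e e' := exists y u, e = ext_in E y + lam u /\ e' = ext_in E' (f y) + mu u.
have G_lin a e1 e2 e1' e2' : G e1 e1' -> G e2 e2' -> G (a *: e1 + e2) (a *: e1' + e2').
  move=> [y [u [-> ->]]] [y' [u' [-> ->]]]; exists (a *: y + y'), (a *: u + u').
  by split; rewrite !linearP scalerDr addrACA.
have G_in y : G (ext_in E y) (ext_in E' (f y)).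
  by exists y, 0; rewrite !linear0 !addr0.
have G_lam u : G (lam u) (mu u) by exists 0, u; rewrite !linear0 !add0r.
have G0 e' : G 0 e' -> e' = 0.
  move=> [y [u [e0 ->]]]; have au : aug u = 0.
    by have := congr1 (ext_out E) (esym e0); rewrite linear0 linearD ext_out_in add0r lam_out.
  have /pres_exact[v eqv] := au; move: e0; rewrite -eqv lam_in -linearD mu_in.
  rewrite -(linear0 (ext_in E)) => /ext_in_inj /esym yv.
  by rewrite -linearD -linearD yv !linear0.
have G_uniq e w w' : G e w -> G e w' -> w = w'.
  move=> Gw Gw'; have := G_lin (-1) _ _ _ _ Gw' Gw.
  by rewrite !scaleN1r addNr addrC => /G0/eqP; rewrite subr_eq0 => /eqP.
have [|h hG] := linear_of_rel _ G_uniq G_lin.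
  by move=> e; have [y [u eqe]] := ext_class_gen e; exists (ext_in E' (f y) + mu u), y, u.
by exists h; split=> [y|u]; apply: G_uniq (hG _) _.
Qed.

(** Reduces the existence of a morphism of extensions to two identities on the free modules of the
    presentation. *)
Lemma ext_class_morphism (g : M -> M') :
  (forall u, ext_out E' (mu u) = g (aug u)) -> ext_morphism f g E E'.
Proof.
move=> mu_out; have [h [h_in h_lam]] := ext_class_univ; exists h; split=> // e.
have [y [u ->]] := ext_class_gen e.
by rewrite linearD h_in h_lam !linearD !ext_out_in !add0r mu_out lam_out.
Qed.

End Universal.

Lemma ext_class_trans (N N' : lmodType A) (f : {linear N -> N'}) phi
    (E : extension M N) (E' : extension M N') :
  ext_class phi E -> ext_morphism f id E E' -> ext_class (P := P) (f \o phi) E'.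
Proof.
move=> [lam [lam_out lam_in]] [h [h_in h_out]]; exists (h \o lam); split=> [u|v] /=.
  by rewrite h_out lam_out.
by rewrite lam_in h_in.
Qed.

Lemma ext_class_equiv (N : lmodType A) (phi : 'rV[A]_(pres1 P) -> N) (E : extension M N) :
  ext_class phi E -> ext_class phi = ext_equiv E.
Proof.
move=> hE; apply/funext => E'; apply/propext; split=> [[lam' [out' in']]|eqE].
  have [lam [lam_out lam_in]] := hE.
  exact: (ext_class_morphism lam_out lam_in (f := idfun) in').
exact: (ext_class_trans (f := idfun) hE eqE).
Qed.

Lemma ext_class_push (N N' : lmodType A) (f : {linear N -> N'}) (phi : 'rV[A]_(pres1 P) -> N) :
  (exists E, ext_class phi E) -> Ext1_push f (ext_class phi) = ext_class (f \o phi).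
Proof.
move=> [E hE]; apply/funext => E'; apply/propext; split=> [[E1 hE1]|[mu [mu_out mu_in]]].
  exact: ext_class_trans.
have [lam [lam_out lam_in]] := hE; exists E => //.
exact: (ext_class_morphism lam_out lam_in mu_in).
Qed.

(** Two lifts of the cover to the same E differ by a map into N, which is theta; conversely,
    subtracting theta from a lift changes the cocycle by a coboundary. *)
Lemma ext_class_eq (N : lmodType A) (phi psi : {linear 'rV[A]_(pres1 P) -> N}) :
  (exists E, ext_class phi E) ->
  ext_class phi = ext_class psi <->
  exists theta : {linear 'rV[A]_(pres0 P) -> N}, forall v, phi v - psi v = theta (d1 v).
Proof.
move=> [E hE]; split=> [eqc|[theta htheta]].
  have [lam [lam_out lam_in]] := hE.
  have [mu [mu_out mu_in]] : ext_class psi E by rewrite -eqc.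
  have [|theta htheta] := @projective_rV A _ _ _ (ext_in E) (lam \- mu).
    by move=> u; apply/ext_exact; rewrite linearB lam_out mu_out subrr.
  exists theta => v; apply: (@ext_in_inj _ _ _ E).
  by rewrite htheta /= lam_in mu_in linearB.
rewrite (ext_class_equiv hE); apply/esym/ext_class_equiv.
have [lam [lam_out lam_in]] := hE; exists (lam \- (ext_in E \o theta)); split=> [u|v] /=.
  by rewrite linearB ext_out_in subr0 lam_out.
by rewrite lam_in -htheta -linearB subKr.
Qed.

End Presented.

(** The universal property of the pullback for a projective source: any lift of mu to E' has an
    error with values in N, and is corrected by it. *)
Lemma pull_lift (M M' N : lmodType A) (g : M' -> M) (E : extension M N) (E' : extension M' N)
    (h : {linear ext_mid E' -> ext_mid E}) (G : lmodType A)
    (kap : {linear G -> ext_mid E}) (mu : {linear G -> M'}) : projective G ->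
  (forall y, h (ext_in E' y) = ext_in E y) -> (forall e, ext_out E (h e) = g (ext_out E' e)) ->
  (forall u, ext_out E (kap u) = g (mu u)) ->
  exists lam : {linear G -> ext_mid E'},
    (forall u, h (lam u) = kap u) /\ (forall u, ext_out E' (lam u) = mu u).
Proof.
move=> projG h_in h_out kap_out.
have [lam0 hlam0] := projG _ _ (ext_out E') mu (fun u => ext_out_surj E' (mu u)).
have [|theta htheta] := projG _ _ (ext_in E) ((h \o lam0) \- kap).
  by move=> u; apply/ext_exact; rewrite linearB /= h_out hlam0 kap_out subrr.
exists (lam0 \- (ext_in E' \o theta)); split=> u /=.
  by rewrite linearB h_in htheta /= subKr.
by rewrite linearB ext_out_in subr0 hlam0.
Qed.

Definition pres_lift (M M' : lmodType A) (P : presentation M) (P' : presentation M')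
    (g : M' -> M) (gam0 : 'rV[A]_(pres0 P') -> 'rV[A]_(pres0 P))
    (gam1 : 'rV[A]_(pres1 P') -> 'rV[A]_(pres1 P)) : Prop :=
  (forall u, pres_aug P (gam0 u) = g (pres_aug P' u)) /\
  (forall v, pres_diff P (gam1 v) = gam0 (pres_diff P' v)).

Lemma pres_lift_exists (M M' : lmodType A) (P : presentation M) (P' : presentation M')
    (g : {linear M' -> M}) : exists (gam0 : {linear 'rV[A]_(pres0 P') -> 'rV[A]_(pres0 P)})
    (gam1 : {linear 'rV[A]_(pres1 P') -> 'rV[A]_(pres1 P)}), pres_lift g gam0 gam1.
Proof.
have [gam0 h0] := @projective_rV A _ _ _ (pres_aug P) (g \o pres_aug P')
  (fun u => pres_surj P _).
have [|gam1 h1] := @projective_rV A _ _ _ (pres_diff P) (gam0 \o pres_diff P').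
  by move=> v; apply/pres_exact; rewrite /= h0 /= pres_diffK linear0.
by exists gam0, gam1.
Qed.

Lemma ext_class_pull (M M' N : lmodType A) (P : presentation M) (P' : presentation M')
    (g : {linear M' -> M}) (gam0 : {linear 'rV[A]_(pres0 P') -> 'rV[A]_(pres0 P)})
    (gam1 : {linear 'rV[A]_(pres1 P') -> 'rV[A]_(pres1 P)})
    (phi : 'rV[A]_(pres1 P) -> N) : pres_lift g gam0 gam1 ->
  (exists E, ext_class phi E) -> Ext1_pull g (ext_class phi) = ext_class (phi \o gam1).
Proof.
move=> [lift0 lift1] [E hE]; apply/funext => E'; apply/propext; split.
  move=> [E1 [lam [lam_out lam_in]] [h [h_in h_out]]].
  have [|lam' [h_lam' lam'_out]] := pull_lift (@projective_rV A _) h_in h_out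
    (kap := lam \o gam0) (mu := pres_aug P').
    by move=> u; rewrite /= lam_out lift0.
  exists lam'; split=> // v; have /ext_exact[y eqy] : ext_out E' (lam' (pres_diff P' v)) = 0.
    by rewrite lam'_out pres_diffK.
  rewrite -eqy; congr (ext_in E' _); apply: (@ext_in_inj _ _ _ E1).
  by rewrite -h_in eqy h_lam' /= -lift1 lam_in.
move=> [lam' [lam'_out lam'_in]]; have [lam [lam_out lam_in]] := hE; exists E => //.
apply: (ext_class_morphism lam'_out lam'_in (f := idfun) (mu := lam \o gam0)) => [v|u] /=.
  by rewrite -lift1 lam_in.
by rewrite lam_out lift0.
Qed.

(** * Baer sums and sums of cocycles *)

Section BaerSum.
Variables (M N : lmodType A) (P : presentation M).
Variables (phi psi : {linear 'rV[A]_(pres1 P) -> N}).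
Hypotheses (c_phi : cocycle phi) (c_psi : cocycle psi).

Lemma diag_linear : exists diag : {linear M -> (M * M)%type}, forall x, diag x = (x, x).
Proof. by apply: to_linear. Qed.

Lemma codiag_linear : exists codiag : {linear (N * N)%type -> N}, forall y, codiag y = y.1 + y.2.
Proof. by apply: to_linear => a x y; rewrite /= scalerDr addrACA. Qed.

(** Y is the extension of the cocycle (phi, psi) with values in N x N: its morphism to the direct
    sum lies over the diagonal of M, and the sum map of N turns its cocycle into phi + psi. *)
Lemma baer_diagram (E E' Z : extension M N) :
  ext_class phi E -> ext_class psi E' -> ext_class (phi \+ psi) Z ->
  exists2 Y : extension M (N * N)%type,
    ext_morphism id (fun x : M => (x, x)) Y (ext_sum E E') &
    ext_morphism (fun y : N * N => y.1 + y.2) id Y Z.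
Proof.
move=> [lam [lam_out lam_in]] [lam' [lam'_out lam'_in]] [mu [mu_out mu_in]].
have [pr hpr] : exists pr : {linear 'rV[A]_(pres1 P) -> (N * N)%type},
    forall v, pr v = (phi v, psi v).
  by apply: to_linear => a v w; rewrite !linearP.
have [|Y [kap [kap_out kap_in]]] := @ext_class_exists M P _ pr.
  by move=> v dv; rewrite hpr c_phi ?c_psi.
have [lam2 hlam2] : exists lam2 : {linear 'rV[A]_(pres0 P) -> (ext_mid E * ext_mid E')%type},
    forall u, lam2 u = (lam u, lam' u) by apply: to_linear => a v w; rewrite !linearP.
have [diag hdiag] := diag_linear; have [codiag hcodiag] := codiag_linear.
exists Y.
  apply: (ext_class_morphism (E' := ext_sum E E') kap_out kap_in (f := idfun)
    (mu := lam2)) => [v|u].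
    by rewrite hlam2 lam_in lam'_in /= hpr.
  by rewrite hlam2 /= /sum_map /= lam_out lam'_out.
have [h [h_in h_out]] := ext_class_morphism kap_out kap_in (f := codiag) (mu := mu) (g := id)
  (fun v => etrans (mu_in v) (congr1 (ext_in Z) (esym (etrans (hcodiag _)
    (congr1 (fun y => y.1 + y.2) (hpr v)))))) mu_out.
by exists h; split=> // y; rewrite h_in hcodiag.
Qed.

Lemma ext_class_add : Ext1_add (ext_class phi) (ext_class psi) = ext_class (phi \+ psi).
Proof.
apply/funext => Z; apply/propext; split; last first.
  move=> hZ; have [E hE] := ext_class_exists c_phi; have [E' hE'] := ext_class_exists c_psi.
  have [Y YX YZ] := baer_diagram hE hE' hZ; exists Y => //; exists (ext_sum E E') => //.
  by exists E, E'; split=> //; exists idfun.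
move=> [Y [X [E [E' [[lam [lam_out lam_in]] [lam' [lam'_out lam'_in]]]]]]].
move=> [h1 [h1_in h1_out]] [h2 [h2_in h2_out]] [h3 [h3_in h3_out]].
have [lam2 hlam2] : exists lam2 : {linear 'rV[A]_(pres0 P) -> (ext_mid E * ext_mid E')%type},
    forall u, lam2 u = (lam u, lam' u) by apply: to_linear => a v w; rewrite !linearP.
have [|kap [h_kap kap_out]] := pull_lift (g := fun x : M => (x, x))
    (@projective_rV A _) h2_in h2_out (kap := h1 \o lam2) (mu := pres_aug P).
  by move=> u; rewrite /= h1_out hlam2 /= /sum_map /= lam_out lam'_out.
exists (h3 \o kap); split=> [u|v] /=; first by rewrite h3_out kap_out.
have /ext_exact[y eqy] : ext_out Y (kap (pres_diff P v)) = 0 by rewrite kap_out pres_diffK.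
rewrite -eqy h3_in; congr (ext_in Z _).
suff -> : y = (phi v, psi v) by [].
apply: (@ext_in_inj _ _ _ X); rewrite -h2_in eqy h_kap /= hlam2 lam_in lam'_in.
by rewrite -h1_in.
Qed.

End BaerSum.
End ExtClasses.

(** * The module of T-split extensions *)

Section Cochains.
Context {A : comNzRingType}.

Section Evaluation.
Context {r : nat} {N : lmodType A}.

(** Linear maps out of a free module are encoded by their values on the basis, since these families
    form a module that is finitely generated with N. *)
Definition cochain_fun (phi : {ffun 'I_r -> N}) (v : 'rV[A]_r) : N := \sum_i v 0 i *: phi i.

Lemma cochain_linear phi : linear (cochain_fun phi).
Proof.
move=> a v w; rewrite /cochain_fun scaler_sumr -big_split /=; apply: eq_bigr => i _.
by rewrite !mxE scalerDl scalerA.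
Qed.

HB.instance Definition _ phi :=
  GRing.isLinear.Build A 'rV[A]_r N _ (cochain_fun phi) (cochain_linear phi).

Definition cochain phi : {linear 'rV[A]_r -> N} := cochain_fun phi.

Lemma cochainP a phi psi v : cochain (a *: phi + psi) v = a *: cochain phi v + cochain psi v.
Proof.
rewrite /cochain /= /cochain_fun scaler_sumr -big_split /=; apply: eq_bigr => i _.
by rewrite !ffunE scalerDr !scalerA mulrC.
Qed.

Lemma cochain0 v : cochain 0 v = 0.
Proof. by rewrite /cochain /= /cochain_fun big1 // => i _; rewrite ffunE scaler0. Qed.

Lemma cochainZ a phi v : cochain (a *: phi) v = a *: cochain phi v.
Proof. by rewrite -[a *: phi]addr0 cochainP cochain0 addr0. Qed.

Lemma cochain_of_linear (f : {linear 'rV[A]_r -> N}) v :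
  cochain [ffun i => f (delta_mx 0 i)] v = f v.
Proof. by rewrite [RHS]rV_linearE; apply: eq_bigr => i _; rewrite ffunE. Qed.

End Evaluation.

Lemma fin_gen_ffun r (N : lmodType A) : fin_gen N -> fin_gen {ffun 'I_r -> N}.
Proof.
move=> /fin_gen_cover[k [p hp]].
have [f hf] : exists f : {linear 'rV[A]_(r * k) -> {ffun 'I_r -> N}},
    forall v, f v = [ffun i => p (row i (vec_mx v))].
  by apply: to_linear => a v w; apply/ffunP => i; rewrite !ffunE !linearP.
apply: (@fin_gen_imm _ _ _ f); last exact: fin_gen_rV.
move=> phi; have /boolp.choice[u hu] i : exists u, p u = phi i by apply: hp.
exists (mxvec (\matrix_i u i)); rewrite hf; apply/ffunP => i.
by rewrite ffunE mxvecK rowK hu.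
Qed.

Lemma fin_gen_subq (V : lmodType A) (S K : submod V) : sm_fg S -> fin_gen (subq S K).
Proof.
move=> [t eqS]; exists (map (subq_cls S K) t); apply/seteqP; split=> // x _.
rewrite -spanmE; set X := spanm _.
have hX : submodule [set v | S v /\ X (subq_cls S K v)].
  apply/submoduleE; split; first by split; [exact: sm0 | rewrite subq_cls0; apply: sm0].
  by move=> a v w [Sv Xv] [Sw Xw]; split; [exact: smL | rewrite subq_clsL //; apply: smL].
elim/(@subq_ind _ _ S K): x => v Sv; suff : S `<=` Submod hX by move=> /(_ _ Sv)[].
rewrite {1}eqS; apply: spanm_sub => w tw; split; first by rewrite eqS; apply: subset_spanm.
by apply: subset_spanm; apply/mapP; exists w.
Qed.

Section Coboundaries.
Variables (M N : lmodType A) (P : presentation M).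

Lemma coboundary_subproof : submodule [set phi : {ffun 'I_(pres1 P) -> N} |
  exists theta : {linear 'rV[A]_(pres0 P) -> N},
    forall v, cochain phi v = theta (pres_diff P v)].
Proof.
apply/submoduleE; split.
  have [z hz] : exists z : {linear 'rV[A]_(pres0 P) -> N}, forall u, z u = 0.
    by apply: to_linear => a u v; rewrite scaler0 addr0.
  by exists z => v; rewrite hz cochain0.
move=> a phi psi [th hth] [th' hth'].
by exists ((GRing.scale a \o th) \+ th') => v; rewrite cochainP hth hth'.
Qed.

Definition coboundary : submod {ffun 'I_(pres1 P) -> N} := Submod coboundary_subproof.

End Coboundaries.
End Cochains.

Section TModule.
Context {R : realType} {A : comNzRingType}.
Variables (m : set A) (d : nat) (I : set A) (F : int -> set A).
Hypotheses (localm : local_ring m) (CMm : cohen_macaulay m) (dimd : krull_dim A d).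
Hypotheses (primI : primary_to m I) (admF : admissible I F) (d_gt0 : (0 < d)%N).

Let noethA : noetherian A. Proof. by case: localm. Qed.

Local Notation T_split := (T_split R d F).

Section Objects.
Variables (M N : lmodType A) (P : presentation M).
Hypotheses (fgM : fin_gen M) (fgN : fin_gen N).

(** The zero cochain gives the split extension, multiplication by a is a pushout, and a sum of
    cocycles is a Baer sum. *)
Lemma T_cocycle_subproof : submodule [set phi : {ffun 'I_(pres1 P) -> N} |
  cocycle (P := P) (cochain phi) /\
  exists2 E, ext_class (P := P) (cochain phi) E & T_split E].
Proof.
have scale a phi : cocycle (P := P) (cochain phi) ->
    (exists2 E, ext_class (P := P) (cochain phi) E & T_split E) ->
    forall psi : {ffun 'I_(pres1 P) -> N}, (forall v, cochain psi v = a *: cochain phi v) ->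
    cocycle (P := P) (cochain psi) /\
    exists2 E, ext_class (P := P) (cochain psi) E & T_split E.
  move=> c_phi [E hE sE] psi hpsi.
  have c_psi : cocycle (P := P) (cochain psi).
    by move=> v /c_phi; rewrite hpsi => ->; rewrite scaler0.
  split=> //; have [E' hE'] := ext_class_exists c_psi; exists E' => //.
  have [lam [lam_out lam_in]] := hE; have [mu [mu_out mu_in]] := hE'.
  have [f hf] : exists f : {linear N -> N}, forall y, f y = a *: y.
    by apply: to_linear => b x y; rewrite scalerDr !scalerA mulrC.
  have : ext_morphism f id E E'.
    by apply: (ext_class_morphism lam_out lam_in (mu := mu)) => // v; rewrite mu_in hpsi hf.
  by move/(T_split_push localm CMm dimd primI admF d_gt0 fgM fgN fgN); apply.
apply/submoduleE; split.
  have c0 : cocycle (P := P) (cochain (0 : {ffun 'I_(pres1 P) -> N})).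
    by move=> v _; rewrite cochain0.
  split=> //; have [fst_lin hfst] : exists f : {linear (N * M)%type -> N}, forall v, f v = v.1.
    by apply: to_linear.
  have [i hi] : exists i : {linear N -> (N * M)%type}, forall x, i x = (x, 0).
    by apply: to_linear => a x y; congr pair; rewrite /= ?scaler0 ?addr0.
  have [j hj] : exists j : {linear M -> (N * M)%type}, forall x, j x = (0, x).
    by apply: to_linear => a x y; congr pair; rewrite /= ?scaler0 ?addr0.
  have [p hp] : exists p : {linear (N * M)%type -> M}, forall v, p v = v.2 by apply: to_linear.
  have i_inj : injective i by move=> x y; rewrite !hi => -[].
  have ip : exact_at i p.
    move=> [x y]; rewrite hp; split=> [/= ->|[z]]; first by exists x.
    by rewrite hi => -[_ <-].
  have p_surj y : exists v, p v = y by exists (0, y); rewrite hp.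
  pose E0 := Extension i_inj ip p_surj; exists E0.
    exists (j \o pres_aug P); split=> [u|v] /=; first by rewrite hj hp.
    by rewrite pres_diffK hj cochain0 hi.
  apply: (T_split_trivial localm CMm dimd primI admF d_gt0 (E := E0)
    (rho := fst_lin) (sec := j)) => //= x;
    by rewrite ?hi ?hj ?hp ?hfst.
move=> a phi psi [c_phi [E hE sE]] [c_psi [E' hE' sE']].
have [c_aphi [E1 hE1 sE1]] : cocycle (P := P) (cochain (a *: phi)) /\
    exists2 E, ext_class (P := P) (cochain (a *: phi)) E & T_split E.
  apply: (scale a phi c_phi); first by exists E.
  by move=> v; rewrite cochainZ.
have c_sum : cocycle (P := P) (cochain (a *: phi + psi)).
  by move=> v dv; rewrite cochainP c_phi ?c_psi // scaler0 addr0.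
have [Z hZ] := ext_class_exists c_sum.
split=> //; exists Z => //.
have eq_sum : cochain (a *: phi + psi) =1 cochain (a *: phi) \+ cochain psi.
  by move=> v; rewrite cochainP -cochainZ.
have hZ' : ext_class (P := P) (cochain (a *: phi) \+ cochain psi) Z.
  by have [mu [mu_out mu_in]] := hZ; exists mu; split=> // v; rewrite mu_in eq_sum.
(* The property passes from the direct sum to Y by the diagonal, then to Z by the sum map. *)
have [Y YX YZ] := baer_diagram c_aphi c_psi hE1 hE' hZ'.
have [diag hdiag] := diag_linear M; have [codiag hcodiag] := codiag_linear N.
have fgMM := fin_gen_prod fgM fgM; have fgNN := fin_gen_prod fgN fgN.
have sX : T_split (ext_sum E1 E').
  exact: (T_split_sum localm CMm dimd primI admF d_gt0 fgM fgN fgM fgN).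
have sY : T_split Y.
  apply: (T_split_pull localm CMm dimd primI admF d_gt0 (g := diag) fgMM fgM fgNN _ sX).
  by have [h [h1 h2]] := YX; exists h; split=> // e; rewrite hdiag.
apply: (T_split_push localm CMm dimd primI admF d_gt0 (f := codiag) fgM fgNN fgN _ sY).
by have [h [h1 h2]] := YZ; exists h; split=> // y; rewrite hcodiag.
Qed.

Definition T_cocycle : submod {ffun 'I_(pres1 P) -> N} := Submod T_cocycle_subproof.

Definition T_mod : lmodType A := subq T_cocycle (coboundary N P).

Lemma T_mod_fg : fin_gen T_mod.
Proof.
apply: fin_gen_subq; apply: noeth_fin_gen => //; exact: fin_gen_ffun.
Qed.

Definition T_cls : {ffun 'I_(pres1 P) -> N} -> T_mod := subq_cls T_cocycle (coboundary N P).

Definition T_ext (x : T_mod) : ext_set M N := ext_class (P := P) (cochain (subq_val x)).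

Lemma T_cocycle_ext phi : T_cocycle phi -> exists E, ext_class (P := P) (cochain phi) E.
Proof. by move=> [_ [E hE _]]; exists E. Qed.

Lemma ext_class_coboundary phi psi : T_cocycle phi ->
  ext_class (P := P) (cochain phi) = ext_class (P := P) (cochain psi) <->
  coboundary N P (phi - psi).
Proof.
move=> /T_cocycle_ext ex; rewrite ext_class_eq //.
have eqv v : cochain phi v - cochain psi v = cochain (phi - psi) v.
  by rewrite [phi - psi]addrC -[- psi]scaleN1r cochainP scaleN1r [RHS]addrC.
by split=> -[th hth]; exists th => v; rewrite -hth eqv.
Qed.

Lemma T_ext_cls phi : T_cocycle phi -> T_ext (T_cls phi) = ext_class (P := P) (cochain phi).
Proof.
by move=> Tphi; apply/esym/ext_class_coboundary => //; apply: subq_clsK.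
Qed.

Lemma T_ext_inj : injective T_ext.
Proof.
move=> x y eqxy; rewrite -(subq_valK x) -(subq_valK y).
apply/subq_cls_eq; try exact: subq_valP.
by apply/ext_class_coboundary => //; apply: subq_valP.
Qed.

Lemma T_extP c : T_ R d F M N c <-> exists x, T_ext x = c.
Proof.
split=> [[[E0 ->] [E cE sE]]|[x <-]]; last first.
  have [_ [E hE sE]] := subq_valP x; split; last by exists E.
  by exists E; apply: ext_class_equiv.
have [phi c_phi hE] := ext_class_surj P E0.
have eqphi : cochain [ffun i => phi (delta_mx 0 i)] = phi :> (_ -> _).
  by apply/funext => v; apply: cochain_of_linear.
have Tphi : T_cocycle [ffun i => phi (delta_mx 0 i)].
  split; first by move=> v /c_phi; rewrite cochain_of_linear.
  by exists E => //; rewrite eqphi (ext_class_equiv hE).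
by exists (T_cls [ffun i => phi (delta_mx 0 i)]); rewrite T_ext_cls // eqphi;
  apply: ext_class_equiv.
Qed.

Lemma T_ext_scale a x : T_ext (a *: x) = Ext1_scale a (T_ext x).
Proof.
elim/(@subq_ind _ _ T_cocycle (coboundary N P)): x => phi Tphi.
rewrite -[a *: _]addr0 -(subq_cls0 T_cocycle (coboundary N P)).
rewrite -subq_clsL //; last exact: sm0.
rewrite !T_ext_cls //; last by apply: smL => //; apply: sm0.
have [f hf] : exists f : {linear N -> N}, forall y, f y = a *: y.
  by apply: to_linear => b x y; rewrite scalerDr !scalerA mulrC.
have -> : Ext1_scale a (ext_class (P := P) (cochain phi)) =
    Ext1_push f (ext_class (P := P) (cochain phi)).
  by rewrite /Ext1_scale; congr Ext1_push; apply/funext => y; rewrite hf.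
rewrite ext_class_push; last exact: T_cocycle_ext.
by congr ext_class; apply/funext => v; rewrite cochainP cochain0 addr0 /= hf.
Qed.

Lemma T_ext_add x y : T_ext (x + y) = Ext1_add (T_ext x) (T_ext y).
Proof.
elim/(@subq_ind _ _ T_cocycle (coboundary N P)): x => phi Tphi.
elim/(@subq_ind _ _ T_cocycle (coboundary N P)): y => psi Tpsi.
have -> : subq_cls T_cocycle (coboundary N P) phi + subq_cls _ _ psi = T_cls (1 *: phi + psi).
  by rewrite /T_cls subq_clsL // scale1r.
rewrite !T_ext_cls //; last exact: smL.
rewrite ext_class_add; [|exact: (proj1 Tphi)|exact: (proj1 Tpsi)].
by congr ext_class; apply/funext => v; rewrite cochainP scale1r.
Qed.

End Objects.

End TModule.

(** * The functor of T-split extensions *)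

Section TFunctor.
Context {R : realType} {A : comNzRingType}.
Variables (m : set A) (d : nat) (I : set A) (F : int -> set A).
Hypotheses (localm : local_ring m) (CMm : cohen_macaulay m) (dimd : krull_dim A d).
Hypotheses (primI : primary_to m I) (admF : admissible I F) (d_gt0 : (0 < d)%N).

Let noethA : noetherian A. Proof. by case: localm. Qed.

Local Notation T_cocycle := (@T_cocycle R A m d I F localm CMm dimd primI admF d_gt0 _ _ _).
Local Notation T_mod P fgM fgN :=
  (@T_mod R A m d I F localm CMm dimd primI admF d_gt0 _ _ P fgM fgN).
Local Notation T_cls := (@T_cls R A m d I F localm CMm dimd primI admF d_gt0 _ _ _ _ _).
Local Notation T_ext := (@T_ext R A m d I F localm CMm dimd primI admF d_gt0 _ _ _ _ _).

Lemma ext_class_pull_push (M M' N N' : lmodType A) (P : presentation M) (P' : presentation M')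
    (g : {linear M' -> M}) (f : {linear N -> N'})
    (gam0 : {linear 'rV[A]_(pres0 P') -> 'rV[A]_(pres0 P)})
    (gam1 : {linear 'rV[A]_(pres1 P') -> 'rV[A]_(pres1 P)})
    (phi : {linear 'rV[A]_(pres1 P) -> N}) :
  pres_lift g gam0 gam1 -> cocycle phi ->
  Ext1_pull g (Ext1_push f (ext_class phi)) = ext_class (P := P') (f \o phi \o gam1).
Proof.
move=> lift c_phi; have c_f : cocycle (P := P) (f \o phi).
  by move=> v /c_phi; rewrite /= => ->; rewrite linear0.
by rewrite ext_class_push ?(ext_class_pull lift) //; apply: ext_class_exists.
Qed.

Section Morphism.
Variables (M M' N N' : lmodType A) (P : presentation M) (P' : presentation M').
Hypotheses (fgM : fin_gen M) (fgM' : fin_gen M') (fgN : fin_gen N) (fgN' : fin_gen N').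
Variables (g : {linear M' -> M}) (f : {linear N -> N'}).

(** On cochains the action is phi |-> f phi gam1, where gam1 lifts g to the relations. *)
Lemma T_map_exists : exists h : {linear T_mod P fgM fgN -> T_mod P' fgM' fgN'},
  forall x, T_ext (h x) = Ext1_pull g (Ext1_push f (T_ext x)).
Proof.
have [gam0 [gam1 lift]] := pres_lift_exists P P' g; have [lift0 lift1] := lift.
pose t (phi : {ffun 'I_(pres1 P) -> N}) : {ffun 'I_(pres1 P') -> N'} :=
  [ffun i => (f \o cochain phi \o gam1) (delta_mx 0 i)].
have tE phi v : cochain (t phi) v = f (cochain phi (gam1 v)).
  exact: (cochain_of_linear (f \o cochain phi \o gam1)).
have t_lin a phi psi : t (a *: phi + psi) = a *: t phi + t psi.
  by apply/ffunP => i; rewrite !ffunE /= -linearP; congr (f _); apply: cochainP.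
have t_sub phi psi : t (phi - psi) = t phi - t psi.
  by rewrite [phi - psi]addrC -[- psi]scaleN1r t_lin scaleN1r addrC.
have tT phi : T_cocycle fgM fgN phi -> T_cocycle fgM' fgN' (t phi).
  move=> [c_phi [E hE sE]]; have c_f : cocycle (P := P) (f \o cochain phi).
    by move=> v /c_phi eq0; rewrite /= eq0 linear0.
  have c_t : cocycle (P := P') (cochain (t phi)).
    by move=> v dv; rewrite tE c_phi ?linear0 // lift1 dv linear0.
  (* E1 is a pushout of E along f, and E2 a pullback of E1 along g, so T-splitness passes in two
     steps. *)
  split=> //; have [E1 hE1] := ext_class_exists c_f.
  have [E2 hE2] := ext_class_exists c_t; exists E2 => //.
  have [lam [lam_out lam_in]] := hE; have [mu [mu_out mu_in]] := hE1.
  have sE1 : T_split R d F E1.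
    apply: (T_split_push localm CMm dimd primI admF d_gt0 (f := f) fgM fgN fgN' _ sE).
    exact: (ext_class_morphism lam_out lam_in mu_in mu_out).
  have [nu [nu_out nu_in]] := hE2.
  apply: (T_split_pull localm CMm dimd primI admF d_gt0 (g := g) fgM fgM' fgN' _ sE1).
  apply: (ext_class_morphism nu_out nu_in (f := idfun) (mu := mu \o gam0)) => [v|u] /=.
    by rewrite -lift1 mu_in tE.
  by rewrite mu_out lift0.
have tB phi : coboundary N P phi -> coboundary N' P' (t phi).
  by move=> [th hth]; exists (f \o th \o gam0) => v; rewrite tE hth /= lift1.
(* Defined on representatives; their failure to be linear is a coboundary, which t sends to a
   coboundary. *)
have [|h hh] := @to_linear _ _ _
    (fun x : T_mod P fgM fgN => T_cls (t (subq_val x)) : T_mod P' fgM' fgN').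
  move=> a x y; have Sx := subq_valP x; have Sy := subq_valP y.
  apply: etrans (@subq_clsL _ _ _ _ a _ _ (tT _ Sx) (tT _ Sy)).
  apply/subq_cls_eq; first by apply: tT; apply: subq_valP.
    by rewrite -t_lin; apply: tT; apply: smL.
  rewrite -t_lin -t_sub.
  apply: tB; rewrite -opprB; apply: smN.
  exact: subq_val_linear.
exists h => x; rewrite hh T_ext_cls; last by apply: tT; apply: subq_valP.
rewrite (ext_class_pull_push f lift); last by have [] := subq_valP x.
by congr ext_class; apply/funext => v; apply: tE.
Qed.

End Morphism.

Lemma pull_push_id (M N : lmodType A) (P : presentation M) (phi : {linear 'rV[A]_(pres1 P) -> N}) :
  cocycle phi -> Ext1_pull (@idfun M) (Ext1_push (@idfun N) (ext_class phi)) = ext_class phi.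
Proof.
by move=> c_phi; rewrite (@ext_class_pull_push _ _ _ _ P P idfun idfun idfun idfun).
Qed.

(** Composites of lifts of g and g' lift the composite, and classes do not depend on the lifts. *)
Lemma pull_push_comp (M M' M'' N N' N'' : lmodType A) (P : presentation M)
    (P' : presentation M') (P'' : presentation M'')
    (g : {linear M' -> M}) (g' : {linear M'' -> M'})
    (f : {linear N -> N'}) (f' : {linear N' -> N''}) (phi : {linear 'rV[A]_(pres1 P) -> N}) :
  cocycle phi ->
  Ext1_pull (g \o g') (Ext1_push (f' \o f) (ext_class phi)) =
  Ext1_pull g' (Ext1_push f' (Ext1_pull g (Ext1_push f (ext_class phi)))).
Proof.
move=> c_phi; have [gam0 [gam1 lift]] := pres_lift_exists P P' g.
have [gam0' [gam1' lift']] := pres_lift_exists P' P'' g'.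
have liftc : pres_lift (P := P) (P' := P'') (g \o g') (gam0 \o gam0') (gam1 \o gam1').
  case: lift lift' => [h0 h1] [h0' h1'].
  by split=> u; rewrite /= ?h0 ?h0' ?h1 ?h1'.
rewrite (ext_class_pull_push (f' \o f) liftc c_phi) (ext_class_pull_push f lift c_phi).
rewrite (ext_class_pull_push (phi := f \o phi \o gam1) f' lift') //.
by case: lift => _ h1 v dv; rewrite /= c_phi ?linear0 // h1 dv linear0.
Qed.

Lemma T_subfunctor : is_Ext1_subfunctor (fun M N : CM_module m => T_ R d F M N).
Proof.
have fg (M : CM_module m) : fin_gen M := proj1 (CM_sortP M).
(* One presentation of each M is chosen once and for all. As [T_ext] is injective and its classes
   are intrinsic, the functor laws can be checked on classes. *)
pose P (M : CM_module m) : presentation M := sval (cid (presentation_exists noethA (fg M))).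
pose T (M N : CM_module m) := T_mod (P M) (fg M) (fg N).
pose map (M M' N N' : CM_module m) (g : {linear M' -> M}) (f : {linear N -> N'}) :=
  T_map_exists (P M) (P M') (fg M) (fg M') (fg N) (fg N') g f.
pose bmap M M' N N' g f : {linear T M N -> T M' N'} := sval (cid (@map M M' N N' g f)).
have bmapE M M' N N' g f x :
    T_ext (@bmap M M' N N' g f x) = Ext1_pull g (Ext1_push f (T_ext x)).
  exact: (svalP (cid (@map M M' N N' g f))).
have c_val M N (x : T M N) : cocycle (P := P M) (cochain (subq_val x)).
  by have [] := subq_valP x.
have bid (M N : CM_module m) (x : T M N) : bmap M M N N idfun idfun x = x.
  by apply: T_ext_inj; rewrite bmapE; apply: pull_push_id; apply: c_val.
have bcomp (M M' M'' N N' N'' : CM_module m) (g : {linear M' -> M}) (g' : {linear M'' -> M'})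
    (f : {linear N -> N'}) (f' : {linear N' -> N''}) (x : T M N) :
    bmap M M'' N N'' (g \o g') (f' \o f) x = bmap M' M'' N' N'' g' f' (bmap M M' N N' g f x).
  apply: T_ext_inj; rewrite !bmapE; apply: (pull_push_comp (P M') (P M'')); exact: c_val.
pose obj (M N : CM_module m) : fg_module A :=
  Build_fg_module (T_mod_fg (R := R) localm CMm dimd primI admF d_gt0 (P M) (fg M) (fg N)).
pose B := @Build_CM_bifunctor A m obj bmap bid bcomp.
exists B, (fun M N (x : T M N) => T_ext x) => M N; split.
- split; first exact: T_ext_inj.
  by move=> c; apply: T_extP.
- by move=> x y; apply: T_ext_add.
- by move=> a x; apply: T_ext_scale.
- by move=> M' N' g f x; apply: bmapE.
Qed.

End TFunctor.

Theorem theorem4p2 (R : realType) (A : comNzRingType) (m : set A) (d : nat)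
    (I : set A) (F : int -> set A)
    (hlocal : local_ring m) (hCM : cohen_macaulay m)
    (hunram : analytically_unramified m)
    (hdim : krull_dim A d) (hd : (1 <= d)%N)
    (hI : primary_to m I) (hF : admissible I F)
    (hF1 : F 1 = integral_closure I)
    (hFn : exists n0 : nat, forall n : nat, (n0 <= n)%N ->
      F n%:Z = integral_closure (ideal_pow I n)) :
  is_Ext1_subfunctor (fun M N : CM_module m => T_ R d F M N).
Proof. exact: (T_subfunctor hlocal hCM hdim hI hF hd). Qed.
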